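(* Let $f$ be an analytic univalent function on $\mathbb{D}=\{z\in\mathbb{C}:|z|<1\}$ with $f(0)=0$, $f'(0)=1$, and for $c\in\mathbb{C}$ write $K_c[f](z)=z+\sum_{n=2}^\infty a_n(c)z^n$. Then for each $\lambda>0$, $$\sum_{n=2}^\infty (n-1-\lambda)\,|a_n(-\lambda)|^2\le\lambda.$$
   Context: Let $\operatorname{Log}(f(z)/z)$ denote the branch of $\log(f(z)/z)$ on $\mathbb{D}$ vanishing at $z=0$, and for $c\in\mathbb{C}$ set $K_c[f](z)=z\exp\big(c\operatorname{Log}(f(z)/z)\big)$. *)

(* Defs.v *)
From Stdlib Require Import Reals.
From Coquelicot Require Import Coquelicot.
Open Scope R_scope.

Definition in_disk (z : C) : Prop := Cmod z < 1.

Definition Cexp (z : C) : C :=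
  (exp (Re z) * cos (Im z), exp (Re z) * sin (Im z)).

Definition analytic_on_disk (f : C -> C) : Prop :=
  forall z : C, in_disk z -> @ex_derive C_AbsRing C_NormedModule f z.

Definition univalent_on_disk (f : C -> C) : Prop :=
  forall z w : C, in_disk z -> in_disk w -> f z = f w -> z = w.

Definition is_Log_f_over_z (f g : C -> C) : Prop :=
  (forall z : C, in_disk z -> @continuous C_UniformSpace C_UniformSpace g z) /\
  g (RtoC 0) = (RtoC 0) /\
  (forall z : C, in_disk z -> z <> (RtoC 0) -> Cexp (g z) = (f z / z)%C).

(** K_c[f](z) = z exp(c Log(f(z)/z)), with g = Log(f(z)/z). *)
Definition Kc (c : C) (g : C -> C) (z : C) : C := (z * Cexp (c * g z))%C.

Definition taylor_coeffs_on_disk (h : C -> C) (a : nat -> C) : Prop :=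
  forall z : C, in_disk z -> @is_pseries C_AbsRing C_NormedModule a z (h z).

(* Main.v *)
Require Import Defs.
From Stdlib Require Import Reals Lra Lia Psatz Classical ClassicalEpsilon.
From Coquelicot Require Import Coquelicot.
Open Scope R_scope.

(** Write [F (zeta) = log f (exp zeta)], holomorphic for [Re zeta < 0], injective
modulo [2 pi i], with [F (zeta) - zeta -> 0] as [Re zeta -> -oo]. If
[(f z / z) ^ (- lambda) = sum b_n z^n], Parseval turns the inequality
[sum (n - lambda) |b_n|^2 r^(2n) <= 0] on the circle [|z| = r = exp s] into
[V s <= 0], where [V s] is the integral of [k (Re F) Re F'] over [0, 2 pi] and
[k x = - 2 lambda exp (- 2 lambda x)]; then [r -> 1]. Modify [k] far to the left
so that it is constant there and still nondecreasing. Differentiating under the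
integral, [V s2 - V s1] is the integral of [k' (Re F) |F'|^2] over
[s1 <= Re zeta <= s2], which by injectivity is at most [2 pi] times the total
increase of [k]; this is exactly compensated by the limit of [V s1] as [s1 -> -oo].

The area inequality is obtained without a change of variables formula: smear the
target measure with a small bump and exchange the integrals. By injectivity a bump
only meets a small neighbourhood of one point, where [F] is almost affine, and the
integral of the bump against an affine map is explicit. *)

(** Here [b_n = a_(n+1)], and the index [n = 0] contributes [- lambda |b_0|^2 = - lambda], which is
    the bound once moved to the right; [r -> 1] is harmless since only finitely many [n - lambda]
    are negative. With [beta = (f z / z) ^ (- lambda)] and a prime for [z d/dz],
    [F' = 1 - beta' / (lambda beta)], so [|f|^(- 2 lambda) Re F'] is [r^(- 2 lambda)] times
    [|beta|^2 - Re (beta' conj beta) / lambda], whose mean over the circle is the sum of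
    [(1 - n / lambda) |b_n|^2 r^(2n)]. The cut of [k] is forced by its total increase: uncut, [k] is
    unbounded to the left and the area bound would be infinite. Cut at [T], [V s1] tends to
    [2 pi k T], and as [k <= 0] the area term is at most [- 2 pi k T]. An obstacle is regularity:
    [f] is only complex differentiable at each point, and continuity of [f'] would come from
    Cauchy's theory. Instead all smoothness is taken from the power series of [beta], whose
    coefficients are given, and [f'] is recovered from [|f|]. *)

Notation RR := (prod_UniformSpace R_UniformSpace R_UniformSpace).
Notation continuous_CC := (continuous (T := C_UniformSpace) (U := C_UniformSpace)).
Notation continuous_C := (continuous (U := C_UniformSpace)).
Notation continuous_on_C := (continuous (T := C_UniformSpace)).
Notation ball_C := (ball (M := C_UniformSpace)).

(** * Compactness through gauges *)

Definition antitone_gauge {U : Type} (P : R -> U -> Prop) : Prop :=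
  forall d d' x, 0 < d' <= d -> P d x -> P d' x.

(* Compactness in the form used for uniformity: local validity with a gauge [d] gives
validity with a uniform gauge. It is stable under products. *)
Definition gauge_compact {U : UniformSpace} (K : U -> Prop) : Prop :=
  forall P : R -> U -> Prop, antitone_gauge P ->
    (forall x, K x -> exists d, 0 < d /\ forall y, ball x d y -> K y -> P d y) ->
    exists d, 0 < d /\ forall x, K x -> P d x.

(** Choice turns the local radii into a gauge, and Cousin's theorem [compactness_value_1d] gives a
    positive lower bound for it at tags whose balls cover the interval; antitonicity passes from the
    radius at the tag to that bound. The covering comes under a double negation, hence the argument
    by contradiction. *)
Lemma gauge_compact_interval (a b : R) :
  gauge_compact (U := R_UniformSpace) (fun x => a <= x <= b).
Proof.
intros P HP Hloc.
assert (Hd : forall x : R, exists d : posreal, a <= x <= b ->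
  forall y : R, ball x d y -> a <= y <= b -> P d y).
{ intros x. destruct (classic (a <= x <= b)) as [Hx|Hx].
  - destruct (Hloc x Hx) as [d [Hd H]]. exists (mkposreal d Hd). intros _. exact H.
  - exists (mkposreal 1 Rlt_0_1). intros H. contradiction. }
destruct (choice _ Hd) as [del Hdel].
destruct (compactness_value_1d a b del) as [d H].
exists d. split. apply cond_pos.
intros x Hx. apply NNPP. intros Hn. apply (H x Hx). intros [t [Ht [Hb Hle]]].
apply Hn. apply (HP (del t)). split; [apply cond_pos | exact Hle].
apply (Hdel t Ht); auto.
Qed.

(** The tube lemma: at fixed [x], compactness of [L] is applied to a predicate that already asks for
    validity on a ball about [x], so that the width of the tube is the gauge itself. *)
Lemma gauge_compact_prod {U V : UniformSpace} (K : U -> Prop) (L : V -> Prop) :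
  gauge_compact K -> gauge_compact L ->
  gauge_compact (U := prod_UniformSpace U V) (fun p => K (fst p) /\ L (snd p)).
Proof.
intros HK HL P HP Hloc.
destruct (HK (fun d x => forall y, L y -> P d (x, y))) as [d [Hd H]].
- intros d d' x Hdd H y Hy. apply (HP d); auto.
- intros x Hx.
  destruct (HL (fun d y => forall x', ball x d x' -> K x' -> P d (x', y))) as [d [Hd H]].
  + intros d d' y Hdd H x' Hb Hx'. apply (HP d); auto. apply H; auto.
    apply (ball_le x d'); [lra | exact Hb].
  + intros y Hy. destruct (Hloc (x, y)) as [d [Hd H]]. split; auto.
    exists d. split; auto. intros y' Hb Hy' x' Hb' Hx'. apply H. split; auto. split; auto.
  + exists d. split; auto.
- exists d. split; auto. intros [x y] [Hx Hy]. apply H; auto.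
Qed.

(** * Continuity and Riemann integrals with parameters *)

Section RealContinuity.
Context {U : UniformSpace}.
Implicit Types (f g : U -> R) (x : U).

Lemma continuous_Rplus f g x : continuous f x -> continuous g x ->
  continuous (fun u => f u + g u) x.
Proof. intros Hf Hg. exact (continuous_plus (V := R_NormedModule) f g x Hf Hg). Qed.

Lemma continuous_Rminus f g x : continuous f x -> continuous g x ->
  continuous (fun u => f u - g u) x.
Proof. intros Hf Hg. exact (continuous_minus (V := R_NormedModule) f g x Hf Hg). Qed.

Lemma continuous_Ropp f x : continuous f x -> continuous (fun u => - f u) x.
Proof. intros Hf. exact (continuous_opp (V := R_NormedModule) f x Hf). Qed.

Lemma continuous_Rmult f g x : continuous f x -> continuous g x ->
  continuous (fun u => f u * g u) x.
Proof. intros Hf Hg. exact (continuous_mult (K := R_AbsRing) f g x Hf Hg). Qed.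

Lemma continuous_Rdiv f g x : continuous f x -> continuous g x -> g x <> 0 ->
  continuous (fun u => f u / g u) x.
Proof.
intros Hf Hg H. apply continuous_Rmult. exact Hf.
apply (continuous_comp g Rinv). exact Hg. apply continuous_Rinv. exact H.
Qed.

Lemma continuous_pow f n x : continuous f x -> continuous (fun u => f u ^ n) x.
Proof.
intros Hf. induction n; simpl. apply continuous_const. apply continuous_Rmult; auto.
Qed.

Lemma continuous_real_comp (h : R -> R) f x :
  continuous h (f x) -> continuous f x -> continuous (fun u => h (f u)) x.
Proof. intros Hh Hf. apply (continuous_comp f h); auto. Qed.

Lemma continuous_Rmax f g x : continuous f x -> continuous g x ->
  continuous (fun u => Rmax (f u) (g u)) x.
Proof.
intros Hf Hg.
apply (continuous_ext (fun u => (f u + g u + Rabs (f u - g u)) / 2)).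
{ intros u. unfold Rmax, Rabs. destruct (Rle_dec _ _), (Rcase_abs _); lra. }
apply continuous_Rmult; [|apply continuous_const].
apply continuous_Rplus. apply continuous_Rplus; auto.
apply (continuous_real_comp Rabs). apply continuous_Rabs. apply continuous_Rminus; auto.
Qed.

Lemma continuous_Rmin f g x : continuous f x -> continuous g x ->
  continuous (fun u => Rmin (f u) (g u)) x.
Proof.
intros Hf Hg.
apply (continuous_ext (fun u => - Rmax (- f u) (- g u))).
{ intros u. unfold Rmax, Rmin. destruct (Rle_dec _ _), (Rle_dec _ _); lra. }
apply continuous_Ropp, continuous_Rmax; apply continuous_Ropp; auto.
Qed.

Lemma continuous_real_iff f x :
  continuous f x <->
  (forall e, 0 < e -> exists d, 0 < d /\ forall y, ball x d y -> Rabs (f y - f x) < e).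
Proof.
split.
- intros H e He.
  destruct (proj1 (filterlim_locally (F := locally x) f (f x)) H (mkposreal e He)) as [d Hd].
  exists d. split. apply cond_pos. exact Hd.
- intros H. apply filterlim_locally. intros [e He]. destruct (H e He) as [d [Hd H']].
  exists (mkposreal d Hd). exact H'.
Qed.

End RealContinuity.

Lemma continuous_pair {U V W : UniformSpace} (f : U -> V) (g : U -> W) x :
  continuous f x -> continuous g x ->
  continuous (U := prod_UniformSpace V W) (fun u => (f u, g u)) x.
Proof. intros Hf Hg. apply (continuous_comp_2 f g pair); auto.
intros P HP. destruct HP as [d Hd]. exists d. intros y Hy. apply Hd. destruct y. exact Hy.
Qed.

Lemma continuous_fst' {U V W : UniformSpace} (f : U -> prod_UniformSpace V W) x :
  continuous f x -> continuous (fun u => fst (f u)) x.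
Proof. intros Hf. apply (continuous_comp f fst); auto. destruct (f x). apply continuous_fst. Qed.

Lemma continuous_snd' {U V W : UniformSpace} (f : U -> prod_UniformSpace V W) x :
  continuous f x -> continuous (fun u => snd (f u)) x.
Proof. intros Hf. apply (continuous_comp f snd); auto. destruct (f x). apply continuous_snd. Qed.

Lemma continuous_fst_at {V W : UniformSpace} (p : prod_UniformSpace V W) : continuous fst p.
Proof. exact (continuous_fst' (fun p => p) p (continuous_id p)). Qed.

Lemma continuous_snd_at {V W : UniformSpace} (p : prod_UniformSpace V W) : continuous snd p.
Proof. exact (continuous_snd' (fun p => p) p (continuous_id p)). Qed.

Lemma gauge_compact_uniform {U V : UniformSpace} (K : V -> Prop)
  (f : prod_UniformSpace U V -> R) (u0 : U) :
  gauge_compact K -> (forall v, K v -> continuous f (u0, v)) ->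
  forall e, 0 < e -> exists d, 0 < d /\
    forall u v, ball u0 d u -> K v -> Rabs (f (u, v) - f (u0, v)) < e.
Proof.
intros HK Hf e He.
destruct (HK (fun d v => forall u, ball u0 d u -> Rabs (f (u, v) - f (u0, v)) < e)) as [d [Hd H]].
- intros d d' v Hdd H u Hu. apply H. apply (ball_le u0 d'); [lra|exact Hu].
- intros v Hv. destruct (proj1 (continuous_real_iff f (u0, v)) (Hf v Hv) (e / 2)) as [d [Hd H]]. lra.
  exists d. split; auto. intros y Hy HKy u Hu.
  replace (f (u, y) - f (u0, y)) with ((f (u, y) - f (u0, v)) - (f (u0, y) - f (u0, v))) by ring.
  eapply Rle_lt_trans. apply Rabs_triang. rewrite Rabs_Ropp.
  assert (H1 := H (u, y) (conj Hu Hy)).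
  assert (H2 := H (u0, y) (conj (ball_center u0 (mkposreal d Hd)) Hy)). lra.
- exists d. split; auto.
Qed.

Lemma gauge_compact_bounded {U : UniformSpace} (K : U -> Prop) (f : U -> R) :
  gauge_compact K -> (forall u, K u -> continuous f u) ->
  exists M, 0 < M /\ forall u, K u -> Rabs (f u) <= M.
Proof.
intros HK Hf.
(* The bound is encoded as the reciprocal of the gauge: a uniform gauge is then a uniform bound. *)
destruct (HK (fun d u => Rabs (f u) <= / d)) as [d [Hd H]].
- intros d d' u Hdd H. eapply Rle_trans. exact H. apply Rinv_le_contravar; lra.
- intros u Hu. destruct (proj1 (continuous_real_iff f u) (Hf u Hu) 1) as [d [Hd H]]. lra.
  assert (Hp : 0 < Rabs (f u) + 1) by (generalize (Rabs_pos (f u)); lra).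
  exists (Rmin d (/ (Rabs (f u) + 1))). split.
  { apply Rmin_pos; auto. apply Rinv_0_lt_compat; auto. }
  intros y Hy _.
  assert (H1 := H y (ball_le _ _ _ (Rmin_l _ _) _ Hy)).
  assert (H2 : Rabs (f y) <= Rabs (f u) + 1).
  { replace (f y) with (f u + (f y - f u)) by ring. eapply Rle_trans. apply Rabs_triang. lra. }
  eapply Rle_trans. exact H2. rewrite <- (Rinv_inv (Rabs (f u) + 1)) at 1.
  apply Rinv_le_contravar. apply Rmin_pos; auto. apply Rinv_0_lt_compat; auto. apply Rmin_r.
- exists (/ d). split. apply Rinv_0_lt_compat; auto. auto.
Qed.

Lemma ex_RInt_cont (f : R -> R) a b : (forall t, continuous f t) -> ex_RInt f a b.
Proof. intros H. apply (ex_RInt_continuous (V := R_CompleteNormedModule)). auto. Qed.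

Lemma continuous_RInt_param {U : UniformSpace} (f : U -> R -> R) a b :
  a <= b ->
  (forall p, continuous (fun p : prod_UniformSpace U R_UniformSpace => f (fst p) (snd p)) p) ->
  forall u, continuous (fun u => RInt (f u) a b) u.
Proof.
intros Hab Hf u0.
assert (Hc : forall u t, continuous (f u) t).
{ intros u t. apply (continuous_comp (fun t => (u, t)) (fun p => f (fst p) (snd p))).
  apply continuous_pair. apply continuous_const. apply continuous_id. apply Hf. }
apply continuous_real_iff. intros e He.
destruct (gauge_compact_uniform _ (fun p => f (fst p) (snd p)) u0 (gauge_compact_interval a b)
  (fun v _ => Hf (u0, v)) (e / (b - a + 1))) as [d [Hd H]].
{ apply Rdiv_lt_0_compat; lra. }
exists d. split; auto. intros u Hu.
assert (E : RInt (f u) a b - RInt (f u0) a b = RInt (fun t => f u t - f u0 t) a b).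
{ symmetry. apply (RInt_minus (V := R_CompleteNormedModule)); apply ex_RInt_cont; auto. }
rewrite E. eapply Rle_lt_trans.
apply abs_RInt_le_const; auto.
- apply ex_RInt_cont. intros t. apply continuous_Rminus; auto.
- intros t Ht. left. apply (H u t); auto.
- rewrite Rmult_comm. apply Rlt_le_trans with (e / (b - a + 1) * (b - a + 1)).
  apply Rmult_lt_compat_l. apply Rdiv_lt_0_compat; lra. lra.
  right. field. lra.
Qed.

(** As functions of the upper limit [b], both sides have the derivative [G b], the right one by
    differentiation under the integral sign, and both vanish at [b = a]. *)
Lemma RInt_Fubini (f : R -> R -> R) a b c d : a <= b -> c <= d ->
  (forall p, continuous (fun p : RR => f (fst p) (snd p)) p) ->
  RInt (fun x => RInt (f x) c d) a b = RInt (fun y => RInt (fun x => f x y) a b) c d.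
Proof.
intros Hab Hcd Hf.
assert (Hx : forall x y, continuous (fun x => f x y) x).
{ intros x y. apply (continuous_comp (fun t => (t, y)) (fun p => f (fst p) (snd p))).
  apply continuous_pair. apply continuous_id. apply continuous_const. apply Hf. }
assert (Hy : forall x y, continuous (f x) y).
{ intros x y. apply (continuous_comp (fun t => (x, t)) (fun p => f (fst p) (snd p))).
  apply continuous_pair. apply continuous_const. apply continuous_id. apply Hf. }
set (G := fun x => RInt (f x) c d).
assert (HG : forall x, continuous G x) by (apply continuous_RInt_param; auto).
assert (HD : forall y x, is_derive (fun u => RInt (fun v => f v y) a u) x (f x y)).
{ intros y x. apply (is_derive_RInt (V := R_NormedModule) (fun v => f v y) _ a x); auto.
  exists (mkposreal 1 Rlt_0_1). intros z _. apply (RInt_correct (V := R_CompleteNormedModule)).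
  apply ex_RInt_cont. auto. }
assert (H1 : forall x, is_derive (fun u => RInt (fun y => RInt (fun v => f v y) a u) c d) x (G x)).
{ intros x.
  assert (E : G x = RInt (fun y => Derive (fun u => RInt (fun v => f v y) a u) x) c d).
  { unfold G. apply RInt_ext. intros y _. symmetry. apply is_derive_unique. auto. }
  rewrite E.
  apply (is_derive_RInt_param (fun u y => RInt (fun v => f v y) a u)).
  - exists (mkposreal 1 Rlt_0_1). intros z _ t _. eexists. apply HD.
  - intros t _. apply continuity_2d_pt_filterlim.
    apply (continuous_ext (T := RR) (fun p => f (fst p) (snd p))).
    + intros [u v]. simpl. symmetry. apply is_derive_unique. apply HD.
    + apply (Hf (x, t)).
  - exists (mkposreal 1 Rlt_0_1). intros z _. apply ex_RInt_cont.
    (* Continuity of parameter integrals is stated for ordered bounds, while [z] runs over a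
       neighbourhood that may reach to the left of [a]. *)
    intros y. destruct (Rle_dec a z) as [Haz|Haz].
    + apply (continuous_RInt_param (fun y v => f v y)); auto.
      intros p. apply (continuous_comp (fun p : RR => (snd p, fst p)) (fun p => f (fst p) (snd p))).
      apply continuous_pair. apply continuous_snd_at. apply continuous_fst_at. apply Hf.
    + apply (continuous_ext (fun y => - RInt (fun v => f v y) z a)).
      { intros t. apply (opp_RInt_swap (V := R_CompleteNormedModule)). apply ex_RInt_cont; auto. }
      apply continuous_Ropp.
      apply (continuous_RInt_param (fun y v => f v y)). lra.
      intros p. apply (continuous_comp (fun p : RR => (snd p, fst p)) (fun p => f (fst p) (snd p))).
      apply continuous_pair. apply continuous_snd_at. apply continuous_fst_at. apply Hf. }
assert (H2 := is_RInt_derive (V := R_CompleteNormedModule) _ G a b (fun x _ => H1 x) (fun x _ => HG x)).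
apply is_RInt_unique in H2. fold G. rewrite H2.
unfold minus, plus, opp; simpl.
rewrite (RInt_ext (fun y => RInt (fun v => f v y) a a) (fun _ => 0)).
- rewrite RInt_const. unfold scal; simpl; unfold mult; simpl. ring.
- intros y _. apply (RInt_point (V := R_CompleteNormedModule)).
Qed.

(** * The complex exponential and the modulus *)

Lemma Cexp_plus (z w : C) : Cexp (z + w) = (Cexp z * Cexp w)%C.
Proof.
unfold Cexp, Cmult, Cplus, Re, Im; simpl. rewrite exp_plus, cos_plus, sin_plus. f_equal; ring.
Qed.

Lemma Cmod_Cexp (z : C) : Cmod (Cexp z) = exp (Re z).
Proof.
unfold Cmod, Cexp, Re, Im; simpl.
replace (_ + _) with ((exp (fst z)) * (exp (fst z))).
- apply sqrt_square. left. apply exp_pos.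
- generalize (sin2_cos2 (snd z)). unfold Rsqr. intros H.
  transitivity (exp (fst z) * exp (fst z) * (sin (snd z) * sin (snd z) + cos (snd z) * cos (snd z))).
  rewrite H. ring. ring.
Qed.

Lemma Cexp_neq_0 (z : C) : Cexp z <> RtoC 0.
Proof.
intros H. assert (H1 := Cmod_Cexp z). rewrite H, Cmod_0 in H1. generalize (exp_pos (Re z)). lra.
Qed.

Lemma Cmod_minus_sym (z w : C) : Cmod (z - w) = Cmod (w - z).
Proof. rewrite <- Cmod_opp. f_equal. ring. Qed.

Lemma Cmod_le_plus (z w : C) : Cmod z <= Cmod w + Cmod (z - w).
Proof. replace z with (w + (z - w))%C at 1 by ring. apply Cmod_triangle. Qed.

Lemma im_le_Cmod (z : C) : Rabs (Im z) <= Cmod z.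
Proof. eapply Rle_trans; [|apply Rmax_Cmod]. apply Rmax_r. Qed.

Lemma Cmod_le_abs (z : C) : Cmod z <= Rabs (Re z) + Rabs (Im z).
Proof.
unfold Re, Im. destruct z as [x y]. simpl.
replace (x, y) with ((x, 0) + (0, y))%C by (unfold Cplus; simpl; f_equal; ring).
eapply Rle_trans. apply Cmod_triangle. right. f_equal; unfold Cmod; simpl.
- replace (x * (x * 1) + 0 * (0 * 1)) with (Rsqr x) by (unfold Rsqr; ring). apply sqrt_Rsqr_abs.
- replace (0 * (0 * 1) + y * (y * 1)) with (Rsqr y) by (unfold Rsqr; ring). apply sqrt_Rsqr_abs.
Qed.

Lemma ball_of_Cmod (z w : C) d : Cmod (w - z) < d -> ball_C z d w.
Proof.
intros H. split; eapply Rle_lt_trans; try exact H.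
- exact (re_le_Cmod (w - z)).
- exact (im_le_Cmod (w - z)).
Qed.

(** Balls of [C_UniformSpace] are squares, those of the product structure; hence the factor 2. *)
Lemma Cmod_of_ball (z w : C) d : ball_C z d w -> Cmod (w - z) < 2 * d.
Proof.
intros [H1 H2]. eapply Rle_lt_trans. apply Cmod_le_abs.
change (Rabs (fst w - fst z) < d) in H1. change (Rabs (snd w - snd z) < d) in H2.
unfold Re, Im. simpl. fold (fst w - fst z) (snd w - snd z). unfold Rminus in *. lra.
Qed.

Lemma continuous_C_re_im {U : UniformSpace} (f : U -> C) x :
  continuous (fun u => Re (f u)) x -> continuous (fun u => Im (f u)) x ->
  continuous_C f x.
Proof.
intros H1 H2. apply (continuous_ext (U := C_UniformSpace) (fun u => (Re (f u), Im (f u)))).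
intros u. unfold Re, Im. destruct (f u); reflexivity.
apply (continuous_pair _ _ _ H1 H2).
Qed.

Lemma continuous_Re {U : UniformSpace} (f : U -> C) x :
  continuous_C f x -> continuous (fun u => Re (f u)) x.
Proof. exact (continuous_fst' (V := R_UniformSpace) (W := R_UniformSpace) f x). Qed.

Lemma continuous_Im {U : UniformSpace} (f : U -> C) x :
  continuous_C f x -> continuous (fun u => Im (f u)) x.
Proof. exact (continuous_snd' (V := R_UniformSpace) (W := R_UniformSpace) f x). Qed.

Lemma continuous_Cplus {U : UniformSpace} (f g : U -> C) x :
  continuous_C f x -> continuous_C g x ->
  continuous_C (fun u => (f u + g u)%C) x.
Proof.
intros Hf Hg. apply continuous_C_re_im; simpl; unfold Re, Im; simpl; apply continuous_Rplus;
  try (apply continuous_Re; assumption); apply continuous_Im; assumption.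
Qed.

Lemma continuous_Cmult {U : UniformSpace} (f g : U -> C) x :
  continuous_C f x -> continuous_C g x ->
  continuous_C (fun u => (f u * g u)%C) x.
Proof.
intros Hf Hg.
assert (H1 := continuous_Re _ _ Hf). assert (H2 := continuous_Im _ _ Hf).
assert (H3 := continuous_Re _ _ Hg). assert (H4 := continuous_Im _ _ Hg).
apply continuous_C_re_im; unfold Re, Im; simpl;
  [apply continuous_Rminus | apply continuous_Rplus]; apply continuous_Rmult; assumption.
Qed.

Lemma continuous_Cminus {U : UniformSpace} (f g : U -> C) x :
  continuous_C f x -> continuous_C g x ->
  continuous_C (fun u => (f u - g u)%C) x.
Proof.
intros Hf Hg.
assert (H1 := continuous_Re _ _ Hf). assert (H2 := continuous_Im _ _ Hf).
assert (H3 := continuous_Re _ _ Hg). assert (H4 := continuous_Im _ _ Hg).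
apply continuous_C_re_im; unfold Re, Im; simpl; apply continuous_Rminus; assumption.
Qed.

Lemma continuous_Cmod {U : UniformSpace} (f : U -> C) x :
  continuous_C f x -> continuous (fun u => Cmod (f u)) x.
Proof.
intros Hf. unfold Cmod. apply (continuous_real_comp sqrt). apply continuous_sqrt.
apply continuous_Rplus; apply continuous_pow; [apply continuous_Re | apply continuous_Im]; assumption.
Qed.

Lemma continuous_Cexp {U : UniformSpace} (f : U -> C) x :
  continuous_C f x -> continuous_C (fun u => Cexp (f u)) x.
Proof.
intros Hf. assert (H1 := continuous_Re _ _ Hf). assert (H2 := continuous_Im _ _ Hf).
apply continuous_C_re_im; unfold Cexp, Re at 1, Im at 1; simpl; apply continuous_Rmult;
 apply continuous_real_comp; auto using continuous_exp, continuous_cos, continuous_sin.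
Qed.

(** * Integrals of paraboloids *)
Definition pos_part (x : R) : R := Rmax 0 x.

Lemma pos_part_ge_0 x : 0 <= pos_part x.
Proof. apply Rmax_l. Qed.

Lemma pos_part_ge x : x <= pos_part x.
Proof. apply Rmax_r. Qed.

Lemma pos_part_eq x : 0 <= x -> pos_part x = x.
Proof. intros H. apply Rmax_right. exact H. Qed.

Lemma pos_part_eq_0 x : x <= 0 -> pos_part x = 0.
Proof. intros H. apply Rmax_left. exact H. Qed.

Lemma pos_part_le x y : x <= y -> pos_part x <= pos_part y.
Proof. intros H. unfold pos_part. apply Rmax_lub. apply Rmax_l. eapply Rle_trans. exact H. apply Rmax_r. Qed.

Lemma pos_part_mult a x : 0 <= a -> pos_part (a * x) = a * pos_part x.
Proof. intros H. unfold pos_part. rewrite <- RmaxRmult; auto. f_equal. ring. Qed.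

Lemma continuous_pos_part {U : UniformSpace} (f : U -> R) x :
  continuous f x -> continuous (fun u => pos_part (f u)) x.
Proof. intros H. apply continuous_Rmax; auto. apply continuous_const. Qed.

Lemma RInt_subinterval_le (f : R -> R) a b c d :
  a <= c -> c <= d -> d <= b -> (forall t, continuous f t) -> (forall t, 0 <= f t) ->
  RInt f c d <= RInt f a b.
Proof.
intros H1 H2 H3 Hc Hp.
rewrite <- (RInt_Chasles (V := R_CompleteNormedModule) f a c b); try (apply ex_RInt_cont; auto).
rewrite <- (RInt_Chasles (V := R_CompleteNormedModule) f c d b); try (apply ex_RInt_cont; auto).
unfold plus; simpl.
assert (0 <= RInt f a c) by (apply RInt_ge_0; auto; apply ex_RInt_cont; auto).
assert (0 <= RInt f d b) by (apply RInt_ge_0; auto; apply ex_RInt_cont; auto).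
lra.
Qed.

(** Enlarge [[a, b]] until it also contains [[c, d]]; outside [[c, d]] nothing is added. *)
Lemma RInt_support_le (f : R -> R) a b c d :
  a <= b -> c <= d -> (forall t, continuous f t) -> (forall t, 0 <= f t) ->
  (forall t, t <= c \/ d <= t -> f t = 0) ->
  RInt f a b <= RInt f c d.
Proof.
intros H1 H2 Hc Hp Hz.
assert (Hl := Rmin_l a c). assert (Hr := Rmax_l b d).
assert (Hl' := Rmin_r a c). assert (Hr' := Rmax_r b d).
apply Rle_trans with (RInt f (Rmin a c) (Rmax b d)).
- apply RInt_subinterval_le; auto.
- assert (E0 : forall u v, u <= v -> (v <= c \/ d <= u) -> RInt f u v = 0).
  { intros u v Huv H. rewrite (RInt_ext f (fun _ => 0)).
    rewrite RInt_const. unfold scal; simpl; unfold mult; simpl. ring.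
    intros t Ht. rewrite Rmin_left, Rmax_right in Ht by lra. apply Hz. lra. }
  rewrite <- (RInt_Chasles (V := R_CompleteNormedModule) f _ c _); try (apply ex_RInt_cont; auto).
  rewrite <- (RInt_Chasles (V := R_CompleteNormedModule) f c d (Rmax b d)); try (apply ex_RInt_cont; auto).
  unfold plus; simpl. rewrite (E0 (Rmin a c) c), (E0 d (Rmax b d)) by lra. lra.
Qed.

(** A truncated quadratic is chosen because dilations and bounded errors in its argument act on it
    by simple algebra. Of its volume only positivity matters: the volume cancels between the lower
    and the upper estimate of the area inequality. *)
Definition paraboloid (x y : R) : R := pos_part (1 - (x ^ 2 + y ^ 2)).
Definition paraboloid_volume : R := RInt (fun x => RInt (paraboloid x) (-1) 1) (-1) 1.

Lemma continuous_paraboloid {U : UniformSpace} (f g : U -> R) u :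
  continuous f u -> continuous g u -> continuous (fun u => paraboloid (f u) (g u)) u.
Proof.
intros Hf Hg. apply continuous_pos_part, continuous_Rminus. apply continuous_const.
apply continuous_Rplus; apply continuous_pow; auto.
Qed.

Lemma paraboloid_eq_0 x y : 1 <= x ^ 2 + y ^ 2 -> paraboloid x y = 0.
Proof. intros H. apply pos_part_eq_0. lra. Qed.

Lemma continuous_RInt_paraboloid c d x : c <= d ->
  continuous (fun x => RInt (paraboloid x) c d) x.
Proof.
intros H. apply (continuous_RInt_param paraboloid); auto. intros p. apply continuous_paraboloid.
apply continuous_fst_at. apply continuous_snd_at.
Qed.

Lemma continuous_paraboloid_r x y : continuous (paraboloid x) y.
Proof. apply continuous_paraboloid. apply continuous_const. apply continuous_id. Qed.

Lemma RInt_paraboloid_ge_0 x c d : c <= d -> 0 <= RInt (paraboloid x) c d.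
Proof.
intros H. apply RInt_ge_0; auto. apply ex_RInt_cont, continuous_paraboloid_r.
intros; apply pos_part_ge_0.
Qed.

Lemma paraboloid_volume_pos : 0 < paraboloid_volume.
Proof.
assert (H1 : forall x, -1/2 <= x <= 1/2 -> 1/2 <= RInt (paraboloid x) (-1) 1).
{ intros x Hx. apply Rle_trans with (RInt (paraboloid x) (-1/2) (1/2)).
  - replace (1/2) with (RInt (fun _ => 1/2) (-1/2) (1/2)) at 1.
    2:{ rewrite RInt_const. unfold scal; simpl; unfold mult; simpl. field. }
    apply RInt_le. lra. apply ex_RInt_cont; intros; apply continuous_const.
    apply ex_RInt_cont, continuous_paraboloid_r.
    intros y Hy. unfold paraboloid. eapply Rle_trans; [|apply pos_part_ge]. nra.
  - apply RInt_subinterval_le; try lra. apply continuous_paraboloid_r. intros; apply pos_part_ge_0. }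
apply Rlt_le_trans with (1/2). lra.
apply Rle_trans with (RInt (fun x => RInt (paraboloid x) (-1) 1) (-1/2) (1/2)).
- replace (1/2) with (RInt (fun _ => 1/2) (-1/2) (1/2)) at 1.
  2:{ rewrite RInt_const. unfold scal; simpl; unfold mult; simpl. field. }
  apply RInt_le. lra. apply ex_RInt_cont; intros; apply continuous_const.
  apply ex_RInt_cont. intros; apply continuous_RInt_paraboloid; lra.
  intros y Hy. apply H1. lra.
- apply RInt_subinterval_le; try lra. intros; apply continuous_RInt_paraboloid; lra.
  intros; apply RInt_paraboloid_ge_0; lra.
Qed.

Lemma RInt_affine (f : R -> R) u x0 a b : 0 < u -> (forall t, continuous f t) ->
  RInt (fun t => f (u * (t - x0))) a b = / u * RInt f (u * (a - x0)) (u * (b - x0)).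
Proof.
intros Hu Hf.
assert (H := RInt_comp_lin (V := R_CompleteNormedModule) f u (- (u * x0)) a b).
replace (u * a + - (u * x0)) with (u * (a - x0)) in H by ring.
replace (u * b + - (u * x0)) with (u * (b - x0)) in H by ring.
rewrite <- H by (apply ex_RInt_cont; auto).
transitivity (RInt (fun t => scal (/ u) (scal u (f (u * t + - (u * x0))))) a b).
- apply RInt_ext. intros t _. unfold scal; simpl; unfold mult; simpl.
  replace (u * t + - (u * x0)) with (u * (t - x0)) by ring. field. lra.
- apply (RInt_scal (V := R_CompleteNormedModule)).
  apply ex_RInt_cont. intros t. apply continuous_Rmult. apply continuous_const.
  apply continuous_real_comp; auto. apply continuous_Rplus. apply continuous_Rmult.
  apply continuous_const. apply continuous_id. apply continuous_const.
Qed.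

(** With [u = q / sqrt A] the integrand is [A] times the standard paraboloid at
    [u (x - x0), u (y - y0)]. Each of the two substitutions costs a factor [/ u], and
    [A / u ^ 2 = A ^ 2 / q ^ 2]. *)
Lemma RInt_scaled_paraboloid A q x0 y0 a b c d : 0 < A -> 0 < q -> c <= d ->
  RInt (fun x => RInt (fun y => pos_part (A - q ^ 2 * ((x - x0) ^ 2 + (y - y0) ^ 2))) c d) a b =
  A ^ 2 / q ^ 2 * RInt (fun x => RInt (paraboloid x) (q / sqrt A * (c - y0)) (q / sqrt A * (d - y0)))
     (q / sqrt A * (a - x0)) (q / sqrt A * (b - x0)).
Proof.
intros HA Hq Hcd. set (u := q / sqrt A).
assert (Hs : 0 < sqrt A) by (apply sqrt_lt_R0; auto).
assert (Hss : sqrt A * sqrt A = A) by (apply sqrt_sqrt; lra).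
assert (Hu : 0 < u) by (apply Rdiv_lt_0_compat; auto).
assert (Hu2 : u ^ 2 = q ^ 2 / A).
{ unfold u. replace A with (sqrt A * sqrt A) at 2. field. lra. }
set (H := fun x => RInt (paraboloid x) (u * (c - y0)) (u * (d - y0))).
transitivity (RInt (fun x => (A / u) * H (u * (x - x0))) a b).
- apply RInt_ext. intros x _.
  transitivity (RInt (fun y => scal A (paraboloid (u * (x - x0)) (u * (y - y0)))) c d).
  + apply RInt_ext. intros y _. unfold scal; simpl; unfold mult; simpl. unfold paraboloid.
    rewrite <- pos_part_mult by lra. f_equal.
    replace (A * (1 - ((u * (x - x0)) ^ 2 + (u * (y - y0)) ^ 2))) with
     (A - (A * u ^ 2) * ((x - x0) ^ 2 + (y - y0) ^ 2)) by ring.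
    rewrite Hu2. field. lra.
  + rewrite (RInt_scal (V := R_CompleteNormedModule)).
    rewrite (RInt_affine (paraboloid (u * (x - x0)))); auto using continuous_paraboloid_r.
    unfold scal; simpl; unfold mult; simpl. unfold H. field. lra.
    apply ex_RInt_cont. intros t. apply continuous_paraboloid. apply continuous_const.
    apply continuous_Rmult. apply continuous_const. apply continuous_Rminus. apply continuous_id. apply continuous_const.
- assert (HH : forall t, continuous H t).
  { intros t. apply continuous_RInt_paraboloid. apply Rmult_le_compat_l; lra. }
  transitivity (A / u * RInt (fun x => H (u * (x - x0))) a b).
  + apply (RInt_scal (V := R_CompleteNormedModule)). apply ex_RInt_cont. intros t.
    apply continuous_real_comp; auto.
    apply continuous_Rmult. apply continuous_const. apply continuous_Rminus. apply continuous_id. apply continuous_const.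
  + rewrite RInt_affine; auto. fold H. rewrite <- Rmult_assoc. f_equal.
    replace (A / u * / u) with (A / u ^ 2) by (field; lra). rewrite Hu2. field. lra.
Qed.

Lemma RInt_scaled_paraboloid_le A q x0 y0 a b c d : 0 < A -> 0 < q -> a <= b -> c <= d ->
  RInt (fun x => RInt (fun y => pos_part (A - q ^ 2 * ((x - x0) ^ 2 + (y - y0) ^ 2))) c d) a b
    <= A ^ 2 / q ^ 2 * paraboloid_volume.
Proof.
intros HA Hq Hab Hcd. rewrite RInt_scaled_paraboloid; auto.
set (u := q / sqrt A). assert (Hu : 0 < u) by (apply Rdiv_lt_0_compat; auto; apply sqrt_lt_R0; auto).
apply Rmult_le_compat_l. { left. apply Rdiv_lt_0_compat; apply pow_lt; auto. }
assert (H1 : u * (c - y0) <= u * (d - y0)) by (apply Rmult_le_compat_l; lra).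
assert (H2 : u * (a - x0) <= u * (b - x0)) by (apply Rmult_le_compat_l; lra).
apply Rle_trans with (RInt (fun x => RInt (paraboloid x) (-1) 1) (u * (a - x0)) (u * (b - x0))).
- apply RInt_le; auto; try (apply ex_RInt_cont; intros; apply continuous_RInt_paraboloid; lra).
  intros x _. apply RInt_support_le; auto. lra. apply continuous_paraboloid_r. intros; apply pos_part_ge_0.
  intros t Ht. apply paraboloid_eq_0. nra.
- apply RInt_support_le; auto. lra. intros; apply continuous_RInt_paraboloid; lra.
  intros; apply RInt_paraboloid_ge_0; lra.
  intros t Ht. rewrite (RInt_ext _ (fun _ => 0)).
  rewrite RInt_const. unfold scal; simpl; unfold mult; simpl. ring.
  intros y _. apply paraboloid_eq_0. nra.
Qed.

(** The four inequalities on the bounds say that the rectangle contains the square of half-side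
    [/ q] about the centre, hence the whole support. *)
Lemma RInt_scaled_paraboloid_ge q x0 y0 a b c d : 0 < q ->
  a <= x0 - / q -> x0 + / q <= b -> c <= y0 - / q -> y0 + / q <= d ->
  / q ^ 2 * paraboloid_volume <=
  RInt (fun x => RInt (fun y => pos_part (1 - q ^ 2 * ((x - x0) ^ 2 + (y - y0) ^ 2))) c d) a b.
Proof.
intros Hq H1 H2 H3 H4. assert (Hq' := Rinv_0_lt_compat q Hq).
rewrite RInt_scaled_paraboloid; try lra. rewrite sqrt_1.
replace (1 ^ 2 / q ^ 2) with (/ q ^ 2) by (field; lra). replace (q / 1) with q by field.
assert (E : q * / q = 1) by (field; lra).
assert (I1 : q * (a - x0) <= -1).
{ replace (-1) with (q * (- / q)) by lra. apply Rmult_le_compat_l; lra. }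
assert (I2 : 1 <= q * (b - x0)).
{ rewrite <- E. apply Rmult_le_compat_l; lra. }
assert (I3 : q * (c - y0) <= -1).
{ replace (-1) with (q * (- / q)) by lra. apply Rmult_le_compat_l; lra. }
assert (I4 : 1 <= q * (d - y0)).
{ rewrite <- E. apply Rmult_le_compat_l; lra. }
apply Rmult_le_compat_l. left. apply Rinv_0_lt_compat, pow_lt; auto.
apply Rle_trans with (RInt (fun x => RInt (paraboloid x) (-1) 1) (q * (a - x0)) (q * (b - x0))).
- apply RInt_subinterval_le; auto. lra. intros; apply continuous_RInt_paraboloid; lra.
  intros; apply RInt_paraboloid_ge_0; lra.
- apply RInt_le; try lra; try (apply ex_RInt_cont; intros; apply continuous_RInt_paraboloid; lra).
  intros x _. apply RInt_subinterval_le; auto. lra. apply continuous_paraboloid_r. intros; apply pos_part_ge_0.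
Qed.

(** * Bumps around 1 in the target *)

Lemma RInt_periodic (f : R -> R) a : (forall t, continuous f t) ->
  (forall t, f (t + 2 * PI) = f t) ->
  RInt f a (a + 2 * PI) = RInt f 0 (2 * PI).
Proof.
intros Hc Hp.
assert (E := RInt_comp_lin (V := R_CompleteNormedModule) f 1 (2 * PI) 0 a).
rewrite <- (RInt_Chasles (V := R_CompleteNormedModule) f a 0 (a + 2 * PI)); try (apply ex_RInt_cont; auto).
rewrite <- (RInt_Chasles (V := R_CompleteNormedModule) f 0 (2 * PI) (a + 2 * PI)); try (apply ex_RInt_cont; auto).
replace (1 * 0 + 2 * PI) with (2 * PI) in E by ring. replace (1 * a + 2 * PI) with (a + 2 * PI) in E by ring.
rewrite <- E by (apply ex_RInt_cont; auto).
rewrite (RInt_ext (fun y => scal 1 (f (1 * y + 2 * PI))) f).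
2:{ intros t _. unfold scal; simpl; unfold mult; simpl. rewrite Rmult_1_l, <- (Hp t). f_equal. ring. }
rewrite <- (opp_RInt_swap (V := R_CompleteNormedModule) f a 0) by (apply ex_RInt_cont; auto).
unfold plus, opp; simpl. ring.
Qed.

Lemma Rabs_sin_le x : Rabs (sin x) <= Rabs x.
Proof.
assert (H : forall x, 0 < x -> Rabs (sin x) <= x).
{ clear x. intros x Hx. apply Rabs_le. split.
  - destruct (Rle_dec x PI) as [H|H]. generalize (sin_ge_0 x). lra.
    generalize (SIN_bound x) PI2_1. lra.
  - left. apply sin_lt_x; auto. }
destruct (Rtotal_order x 0) as [Hx|[Hx|Hx]].
- rewrite (Rabs_left x Hx). rewrite <- (Ropp_involutive x) at 1. rewrite sin_neg, Rabs_Ropp. apply H. lra.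
- subst. rewrite sin_0. lra.
- rewrite (Rabs_pos_eq x) by lra. auto.
Qed.

(** The square splits into a radial part [(exp a - 1) ^ 2] and an angular part
    [2 exp a (1 - cos b)], where [1 - cos b <= b ^ 2 / 2] for every [b]. This makes quantitative
    that [exp w - 1] is almost [w], uniformly in the imaginary part. *)
Lemma Cmod_Cexp_minus_1_le a b e : Rabs a <= e -> e <= 1 / 2 ->
  Cmod (Cexp (a, b) - 1) ^ 2 <= (1 + 2 * e) ^ 2 * (a ^ 2 + b ^ 2).
Proof.
intros Ha He.
assert (Ha2 := Rabs_pos a). assert (Ha' := Rabs_le_between a e). apply proj1 in Ha'. specialize (Ha' Ha).
assert (E : Cmod (Cexp (a, b) - 1) ^ 2 = (exp a - 1) ^ 2 + 2 * exp a * (1 - cos b)).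
{ rewrite Cmod2_alt. unfold Cexp, Re, Im; simpl.
  assert (Hs : sin b * sin b = 1 - cos b * cos b) by (generalize (sin2_cos2 b); unfold Rsqr; lra).
  transitivity ((exp a * cos b - 1) * (exp a * cos b - 1) + exp a * exp a * (sin b * sin b)). ring.
  rewrite Hs. ring. }
rewrite E.
assert (Hc : 1 - cos b <= b ^ 2 / 2).
{ replace b with (2 * (b / 2)) at 1 by field. rewrite cos_2a_sin.
  assert (H := Rabs_sin_le (b / 2)). apply Rsqr_le_abs_1 in H. unfold Rsqr in H. nra. }
assert (Hc0 : 0 <= 1 - cos b) by (generalize (COS_bound b); lra).
assert (H1 : 1 + a <= exp a) by (apply exp_ineq1_le).
(* From [1 - a <= exp (- a)]; for [0 <= a <= 1 / 2] it bounds [exp a] by [1 + 2 a]. *)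
assert (H2 : exp a * (1 - a) <= 1).
{ assert (H := exp_ineq1_le (- a)). rewrite exp_Ropp in H. assert (Hp := exp_pos a).
  replace 1 with (exp a * / exp a) at 2 by (field; lra). apply Rmult_le_compat_l; lra. }
assert (Hp := exp_pos a).
assert (H3 : exp a <= 1 + 2 * e).
{ destruct (Rle_dec 0 a).
  - apply Rmult_le_reg_r with (1 - a). lra. eapply Rle_trans. exact H2. nra.
  - nra. }
assert (H4 : (exp a - 1) ^ 2 <= ((1 + 2 * e) * a) ^ 2).
{ rewrite <- (pow2_abs (exp a - 1)), <- (pow2_abs (_ * a)). apply pow_incr. split. apply Rabs_pos.
  rewrite Rabs_mult. rewrite (Rabs_pos_eq (1 + 2 * e)) by lra.
  destruct (Rle_dec 0 a).
  - rewrite !Rabs_pos_eq by lra.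
    assert (exp a <= 1 + 2 * a). { apply Rmult_le_reg_r with (1 - a). lra. eapply Rle_trans. exact H2. nra. }
    assert (exp a - 1 <= exp a * a) by lra. nra.
  - rewrite !Rabs_left1; try lra. nra. nra. }
assert (H5 : 2 * exp a * (1 - cos b) <= (1 + 2 * e) ^ 2 * b ^ 2).
{ apply Rle_trans with ((1 + 2 * e) * b ^ 2).
  - replace (2 * exp a * (1 - cos b)) with (exp a * (2 * (1 - cos b))) by ring.
    apply Rmult_le_compat; lra.
  - apply Rmult_le_compat_r. apply pow2_ge_0. nra. }
rewrite Rpow_mult_distr in H4. lra.
Qed.

(** Centred at 1 because proximity in the target is tested multiplicatively:
    [bump e (w * Cexp (- zeta))] depends on [log w - zeta] only modulo [2 pi i], so no branch of the
    logarithm enters. *)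
Definition bump (e : R) (u : C) : R := pos_part (1 - (Cmod (u - 1) / e) ^ 2).

Lemma continuous_bump {U : UniformSpace} e (f : U -> C) x :
  continuous_C f x -> continuous (fun u => bump e (f u)) x.
Proof.
intros Hf. apply continuous_pos_part, continuous_Rminus. apply continuous_const.
apply continuous_pow. apply continuous_Rmult. 2: apply continuous_const.
apply continuous_Cmod, continuous_Cminus; auto. apply continuous_const.
Qed.

Lemma bump_pos e u : 0 < e -> bump e u <> 0 -> Cmod (u - 1) < e.
Proof.
intros He Hb. apply Rnot_le_lt. intros H. apply Hb, pos_part_eq_0.
assert (1 <= Cmod (u - 1) / e). { apply Rmult_le_reg_r with e; auto. unfold Rdiv. rewrite Rmult_assoc, Rinv_l; lra. }
nra.
Qed.

Lemma continuous_pairC {U : UniformSpace} (f g : U -> R) x :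
  continuous f x -> continuous g x -> continuous_C (fun u => (f u, g u)) x.
Proof. exact (continuous_pair (V := R_UniformSpace) (W := R_UniformSpace) f g x). Qed.

Lemma Cexp_periodic (a : R) (b : R) : Cexp (a, b + 2 * PI) = Cexp (a, b).
Proof.
unfold Cexp, Re, Im; simpl. generalize (sin_period b 1) (cos_period b 1). simpl.
replace (2 * 1 * PI) with (2 * PI) by ring. intros -> ->. reflexivity.
Qed.

(** Since [exp w - 1] is nearly [w], the bump seen in logarithmic coordinates lies above a
    paraboloid of radius [e / (1 + 2 * e)] about [Lm]. The margin 1 in the bounds on [Re Lm] keeps
    its support inside [[T, L]], and there [W] is at least [W (Re Lm) - eta]. *)
Lemma RInt_bump_ge (W : R -> R) (Lm : C) eta e T L :
  (forall x, continuous W x) -> (forall x, 0 <= W x) -> 0 <= eta -> 0 < e <= 1 / 2 ->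
  T + 1 <= Re Lm <= L - 1 ->
  (forall x, Rabs (x - Re Lm) <= e -> W (Re Lm) - eta <= W x) ->
  (W (Re Lm) - eta) * ((e / (1 + 2 * e)) ^ 2 * paraboloid_volume) <=
  RInt (fun x => RInt (fun y => W x * bump e (Cexp (Lm - (x, y)))) 0 (2 * PI)) T L.
Proof.
intros HW HW0 Heta He HT Hosc. assert (HPI := PI2_1).
set (F := fun x y => W x * bump e (Cexp (Lm - (x, y)))).
assert (HF : forall (U : UniformSpace) (f g : U -> R) u, continuous f u -> continuous g u -> continuous (fun u : U => F (f u) (g u)) u).
{ intros U f g u Hf Hg. apply continuous_Rmult. apply continuous_real_comp; auto.
  apply continuous_bump, continuous_Cexp, continuous_Cminus. apply continuous_const.
  apply continuous_pairC; auto. }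
assert (HF0 : forall x y, 0 <= F x y).
{ intros. apply Rmult_le_pos; auto. apply pos_part_ge_0. }
assert (HFi : forall c d, c <= d -> forall x, continuous (fun x => RInt (F x) c d) x).
{ intros c d Hcd. apply continuous_RInt_param; auto. intros p. apply HF.
  apply continuous_fst_at. apply continuous_snd_at. }
assert (HFy : forall x y, continuous (F x) y).
{ intros. apply HF. apply continuous_const. apply continuous_id. }
change (RInt _ T L) with (RInt (fun x => RInt (F x) 0 (2 * PI)) T L).
(* If this factor is nonpositive, the left side is nonpositive and the integrand nonnegative. *)
destruct (Rle_dec (W (Re Lm) - eta) 0) as [Hn|Hn].
{ apply Rle_trans with 0.
  - assert (0 <= (e / (1 + 2 * e)) ^ 2 * paraboloid_volume).
    { apply Rmult_le_pos. apply pow2_ge_0. left. apply paraboloid_volume_pos. } nra.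
  - apply RInt_ge_0. lra. apply ex_RInt_cont. apply HFi. lra.
    intros x _. apply RInt_ge_0. lra. apply ex_RInt_cont, HFy. auto. }
set (k := W (Re Lm) - eta) in *.
set (X := Re Lm) in *. set (Y := Im Lm).
set (q := (1 + 2 * e) / e). assert (Hq : 0 < q) by (apply Rdiv_lt_0_compat; lra).
assert (Hqi : / q <= e). { unfold q. rewrite Rinv_div. apply Rmult_le_reg_r with (1 + 2 * e). lra. unfold Rdiv. rewrite Rmult_assoc, Rinv_l by lra. nra. }
replace ((e / (1 + 2 * e)) ^ 2) with (/ q ^ 2) by (unfold q; field; lra).
set (G := fun x y => pos_part (1 - q ^ 2 * ((x - X) ^ 2 + (y - Y) ^ 2))).
assert (HG : forall (U : UniformSpace) (f g : U -> R) u, continuous f u -> continuous g u -> continuous (fun u : U => G (f u) (g u)) u).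
{ intros U f g u Hf Hg. apply continuous_pos_part, continuous_Rminus. apply continuous_const.
  apply continuous_Rmult. apply continuous_const. apply continuous_Rplus; apply continuous_pow, continuous_Rminus; auto; apply continuous_const. }
assert (HGy : forall x y, continuous (G x) y).
{ intros. apply HG. apply continuous_const. apply continuous_id. }
assert (HGi : forall x, continuous (fun x => RInt (G x) (Y - PI) (Y + PI)) x).
{ apply continuous_RInt_param. lra. intros p. apply HG.
  apply continuous_fst_at. apply continuous_snd_at. }
apply Rle_trans with (k * RInt (fun x => RInt (G x) (Y - PI) (Y + PI)) T L).
{ apply Rmult_le_compat_l. lra. apply RInt_scaled_paraboloid_ge; auto; lra. }
(* Periodicity in [y] recentres the window at [Y = Im Lm], so that the paraboloid is not cut. *)
rewrite (RInt_ext (fun x => RInt (F x) 0 (2 * PI)) (fun x => RInt (F x) (Y - PI) (Y + PI))).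
2:{ intros x _. symmetry. replace (Y + PI) with (Y - PI + 2 * PI) by ring. apply RInt_periodic; auto.
    intros t. unfold F. do 2 f_equal.
    replace (Lm - (x, t))%C with (X - x, Y - (t + 2 * PI) + 2 * PI). rewrite Cexp_periodic. reflexivity.
    unfold X, Y, Re, Im, Cminus, Cplus, Copp; simpl. f_equal; ring. }
assert (EG : k * RInt (fun x => RInt (G x) (Y - PI) (Y + PI)) T L =
  RInt (fun x => RInt (fun y => k * G x y) (Y - PI) (Y + PI)) T L).
{ transitivity (RInt (fun x => scal k (RInt (G x) (Y - PI) (Y + PI))) T L).
  symmetry. apply (RInt_scal (V := R_CompleteNormedModule)). apply ex_RInt_cont; auto.
  apply RInt_ext. intros x _. symmetry. apply (RInt_scal (V := R_CompleteNormedModule) (G x)). apply ex_RInt_cont; auto. }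
rewrite EG.
apply RInt_le. lra.
{ apply ex_RInt_cont. apply continuous_RInt_param. lra. intros p. apply continuous_Rmult. apply continuous_const. apply HG.
  apply continuous_fst_at. apply continuous_snd_at. }
{ apply ex_RInt_cont. apply HFi. lra. }
intros x _. apply RInt_le. lra.
{ apply ex_RInt_cont. intros y. apply continuous_Rmult; auto. apply continuous_const. }
{ apply ex_RInt_cont; auto. }
intros y _.
destruct (Rle_dec 1 (q ^ 2 * ((x - X) ^ 2 + (y - Y) ^ 2))) as [H|H].
{ unfold G. rewrite pos_part_eq_0 by lra. rewrite Rmult_0_r. auto. }
apply Rnot_le_lt in H.
assert (Hr : (x - X) ^ 2 + (y - Y) ^ 2 < e ^ 2).
{ apply Rmult_lt_reg_l with (q ^ 2). apply pow_lt; auto.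
  apply Rlt_le_trans with 1; auto. unfold q. replace (((1 + 2 * e) / e) ^ 2 * e ^ 2) with ((1 + 2 * e) ^ 2) by (field; lra). nra. }
assert (Hx : Rabs (x - X) <= e).
{ rewrite <- (Rabs_pos_eq e) by lra. apply Rsqr_le_abs_0. unfold Rsqr. clear - Hr. generalize (pow2_ge_0 (y - Y)). simpl in *. lra. }
apply Rmult_le_compat. lra. apply pos_part_ge_0. apply Hosc; auto.
apply pos_part_le. apply Rplus_le_compat_l, Ropp_le_contravar.
unfold Rdiv. rewrite Rpow_mult_distr.
replace (Lm - (x, y))%C with (X - x, Y - y).
2:{ unfold X, Y, Re, Im, Cminus, Cplus, Copp; simpl. f_equal; ring. }
apply Rle_trans with ((1 + 2 * e) ^ 2 * ((X - x) ^ 2 + (Y - y) ^ 2) * (/ e) ^ 2).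
- apply Rmult_le_compat_r. apply pow2_ge_0. apply Cmod_Cexp_minus_1_le; try lra. rewrite Rabs_minus_sym. auto.
- right. unfold q. field. lra.
Qed.

(** * Uniform local estimates *)

(** Holomorphy recorded along real lines, by real and imaginary parts: the form to which the real
    mean value inequality applies. *)
Definition half_plane_derivative (Phi D : C -> C) : Prop :=
  forall (z v : C) (t : R), Re (z + RtoC t * v) < 0 ->
    is_derive (fun t : R => Re (Phi (z + RtoC t * v)%C)) t (Re (D (z + RtoC t * v)%C * v)) /\
    is_derive (fun t : R => Im (Phi (z + RtoC t * v)%C)) t (Im (D (z + RtoC t * v)%C * v)).

Lemma continuous_C_eps (f : C -> C) (z : C) :
  continuous_CC f z ->
  forall e, 0 < e -> exists d, 0 < d /\
    forall y : C, ball_C z d y -> Cmod (f y - f z) < e.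
Proof.
intros H e He.
assert (Hc : continuous_on_C (fun y => Cmod (f y - f z)) z).
{ apply continuous_Cmod, continuous_Cminus; auto. apply continuous_const. }
destruct (proj1 (continuous_real_iff _ _) Hc e He) as [d [Hd Hb]].
exists d. split; auto. intros y Hy. specialize (Hb y Hy).
replace (f z - f z)%C with (RtoC 0) in Hb by ring. rewrite Cmod_0, Rminus_0_r in Hb.
rewrite Rabs_pos_eq in Hb; auto. apply Cmod_ge_0.
Qed.

(** The mean value inequality for [Phi] minus the linear map [D z0], along the segment from [z] to
    [w]. Both points vary, which is more than differentiability at [z0]; continuity of [D] there
    makes this possible. *)
Lemma strict_derivative (Phi D : C -> C) (z0 : C) :
  half_plane_derivative Phi D -> Re z0 < 0 ->
  continuous_CC D z0 ->
  forall e, 0 < e -> exists d, 0 < d /\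
    forall z w : C, ball_C z0 d z -> ball_C z0 d w ->
      Cmod (Phi w - Phi z - D z0 * (w - z)) <= e * Cmod (w - z).
Proof.
intros HD Hz0 Hc e He.
(* One half of [e] for the real part and one for the imaginary part, estimated separately. *)
destruct (continuous_C_eps D z0 Hc (e / 2)) as [d [Hd Hb]]. lra.
set (r := Rmin d (- Re z0)).
assert (Hr : 0 < r) by (apply Rmin_pos; lra).
(* [bounded_variation] asks for the bound at all [t] with [|t| <= 1], negative ones included. The
   point [2 z - w], reached at [t = -1], can be three times as far from [z0] as [z] and [w] may
   be. *)
exists (r / 3). split. lra. intros z w Hz Hw.
assert (Hin : forall t, Rabs (t - 0) <= Rabs (1 - 0) -> ball_C z0 r (z + RtoC t * (w - z))%C).
{ intros t Ht. rewrite !Rminus_0_r, Rabs_R1 in Ht. apply Rabs_le_between in Ht.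
  destruct Hz as [Hz1 Hz2], Hw as [Hw1 Hw2].
  change (Rabs (fst z - fst z0) < r / 3) in Hz1. change (Rabs (snd z - snd z0) < r / 3) in Hz2.
  change (Rabs (fst w - fst z0) < r / 3) in Hw1. change (Rabs (snd w - snd z0) < r / 3) in Hw2.
  apply Rabs_lt_between in Hz1, Hz2, Hw1, Hw2.
  split; [change (Rabs (fst (z + RtoC t * (w - z))%C - fst z0) < r) | change (Rabs (snd (z + RtoC t * (w - z))%C - snd z0) < r)];
  simpl; apply Rabs_lt_between; split; nra. }
assert (Hre : forall t, Rabs (t - 0) <= Rabs (1 - 0) -> Re (z + RtoC t * (w - z)) < 0).
{ intros t Ht. destruct (Hin t Ht) as [H _].
  change (Rabs (Re (z + RtoC t * (w - z)) - Re z0) < r) in H. apply Rabs_lt_between in H.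
  generalize (Rmin_r d (- Re z0)). fold r. lra. }
assert (Hdif : forall t, Rabs (t - 0) <= Rabs (1 - 0) ->
   Cmod (D (z + RtoC t * (w - z))%C * (w - z) - D z0 * (w - z)) <= e / 2 * Cmod (w - z)).
{ intros t Ht. replace (D (z + RtoC t * (w - z)) * (w - z) - D z0 * (w - z))%C with
   ((D (z + RtoC t * (w - z)) - D z0) * (w - z))%C by ring.
  rewrite Cmod_mult. apply Rmult_le_compat_r. apply Cmod_ge_0. left. apply Hb.
  apply (ball_le z0 r). apply Rmin_l. auto. }
assert (H1 := bounded_variation (fun t => Re (Phi (z + RtoC t * (w - z))%C) - t * Re (D z0 * (w - z)))
  (fun t => Re (D (z + RtoC t * (w - z))%C * (w - z)) - Re (D z0 * (w - z))) (e / 2 * Cmod (w - z)) 0 1).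
assert (H2 := bounded_variation (fun t => Im (Phi (z + RtoC t * (w - z))%C) - t * Im (D z0 * (w - z)))
  (fun t => Im (D (z + RtoC t * (w - z))%C * (w - z)) - Im (D z0 * (w - z))) (e / 2 * Cmod (w - z)) 0 1).
assert (Hlin : forall k t, is_derive (fun t => t * k) t k).
{ intros k t. auto_derive. auto. ring. }
eapply Rle_trans. apply Cmod_le_abs.
replace (e * Cmod (w - z)) with (e / 2 * Cmod (w - z) * Rabs (1 - 0) + e / 2 * Cmod (w - z) * Rabs (1 - 0)).
2:{ rewrite Rminus_0_r, Rabs_R1. field. }
cbv beta in H1, H2.
replace (z + RtoC 1 * (w - z))%C with w in H1, H2 by ring.
replace (z + RtoC 0 * (w - z))%C with z in H1, H2 by ring.
apply Rplus_le_compat.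
- replace (Re (Phi w - Phi z - D z0 * (w - z))) with
   (Re (Phi w) - 1 * Re (D z0 * (w - z)) - (Re (Phi z) - 0 * Re (D z0 * (w - z)))) by (unfold Re; simpl; ring).
  apply H1. intros t Ht. split.
  + apply (is_derive_minus (V := R_NormedModule)). apply (HD z (w - z)%C t); auto. apply Hlin.
  + eapply Rle_trans; [|apply (Hdif t Ht)]. exact (re_le_Cmod (D (z + RtoC t * (w - z)) * (w - z) - D z0 * (w - z))%C).
- replace (Im (Phi w - Phi z - D z0 * (w - z))) with
   (Im (Phi w) - 1 * Im (D z0 * (w - z)) - (Im (Phi z) - 0 * Im (D z0 * (w - z)))) by (unfold Im; simpl; ring).
  apply H2. intros t Ht. split.
  + apply (is_derive_minus (V := R_NormedModule)). apply (HD z (w - z)%C t); auto. apply Hlin.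
  + eapply Rle_trans; [|apply (Hdif t Ht)]. exact (im_le_Cmod (D (z + RtoC t * (w - z)) * (w - z) - D z0 * (w - z))%C).
Qed.

Definition rectangle (a b c d : R) (z : C) : Prop := (a <= fst z <= b) /\ (c <= snd z <= d).

Lemma gauge_compact_rectangle a b c d : gauge_compact (U := C_UniformSpace) (rectangle a b c d).
Proof.
exact (gauge_compact_prod (U := R_UniformSpace) (V := R_UniformSpace) _ _
  (gauge_compact_interval a b) (gauge_compact_interval c d)).
Qed.

Lemma ball_half (z0 z w : C) d : ball_C z0 (d / 2) z ->
  ball_C z (d / 2) w -> ball_C z0 d w.
Proof. intros H1 H2. replace d with (d / 2 + d / 2) by field. eapply ball_triangle; eauto. Qed.

(** Strict differentiability at [z0] serves all base points [z] near [z0] once [D z0] is replaced by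
    [D z], at a cost of [e / 2]; compactness of the rectangle then makes the radius uniform. *)
Lemma uniform_strict_derivative (Phi D : C -> C) a b c d :
  half_plane_derivative Phi D -> b < 0 ->
  (forall z, Re z < 0 -> continuous_CC D z) ->
  forall e, 0 < e -> exists r, 0 < r /\
    forall z w : C, rectangle a b c d z -> ball_C z r w ->
      Cmod (Phi w - Phi z - D z * (w - z)) <= e * Cmod (w - z).
Proof.
intros HD Hb Hc e He.
destruct (gauge_compact_rectangle a b c d (fun r z => forall w : C, ball_C z r w ->
  Cmod (Phi w - Phi z - D z * (w - z)) <= e * Cmod (w - z))) as [r [Hr H]].
- intros r r' z Hrr H w Hw. apply H. apply (ball_le z r'); auto. lra.
- intros z0 [Hz0 _]; change C in z0. assert (Hz : Re z0 < 0) by (unfold Re; lra).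
  destruct (strict_derivative Phi D z0 HD Hz (Hc z0 Hz) (e / 2)) as [r [Hr H]]. lra.
  destruct (continuous_C_eps D z0 (Hc z0 Hz) (e / 2)) as [r' [Hr' H']]. lra.
  exists (Rmin (r / 2) r'). split. apply Rmin_pos; lra.
  intros z Hzb _ w Hw.
  assert (Hz1 := ball_le z0 _ _ (Rmin_l _ _) z Hzb).
  assert (Hz2 := ball_le z0 _ _ (Rmin_r _ _) z Hzb).
  apply (ball_le z _ _ (Rmin_l _ _)) in Hw.
  replace (Phi w - Phi z - D z * (w - z))%C with
    ((Phi w - Phi z - D z0 * (w - z)) + (D z0 - D z) * (w - z))%C by ring.
  eapply Rle_trans. apply Cmod_triangle.
  rewrite Cmod_mult, (Cmod_minus_sym (D z0)).
  assert (A1 : Cmod (Phi w - Phi z - D z0 * (w - z)) <= e / 2 * Cmod (w - z)).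
  { apply H. apply (ball_le z0 (r / 2)); auto. lra. apply (ball_half z0 z); auto. }
  assert (A2 : Cmod (D z - D z0) * Cmod (w - z) <= e / 2 * Cmod (w - z)).
  { apply Rmult_le_compat_r. apply Cmod_ge_0. left. auto. }
  lra.
- exists r. split; auto.
Qed.

Lemma uniform_continuity_rectangle (E : C -> C) a b c d :
  (forall z, rectangle a b c d z -> continuous_CC E z) ->
  forall e, 0 < e -> exists r, 0 < r /\
    forall z w : C, rectangle a b c d z -> ball_C z r w -> Cmod (E w - E z) <= e.
Proof.
intros Hc e He.
destruct (gauge_compact_rectangle a b c d (fun r z => forall w : C, ball_C z r w ->
  Cmod (E w - E z) <= e)) as [r [Hr H]].
- intros r r' z Hrr H w Hw. apply H. apply (ball_le z r'); auto. lra.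
- intros z0 Hz0. destruct (continuous_C_eps E z0 (Hc z0 Hz0) (e / 2)) as [r [Hr H]]. lra.
  exists (r / 2). split. lra. intros z Hz _ w Hw.
  replace (E w - E z)%C with ((E w - E z0) + (E z0 - E z))%C by ring.
  eapply Rle_trans. apply Cmod_triangle. rewrite (Cmod_minus_sym (E z0)).
  assert (A1 := H w (ball_half _ _ _ _ Hz Hw)).
  assert (A2 : Cmod (E z - E z0) < e / 2). { apply H. apply (ball_le z0 (r / 2)); auto. lra. }
  lra.
- exists r. split; auto.
Qed.

(** Compactness on pairs of points. Near the diagonal the lower slope comes from the nonzero
    derivative [Phi * E]; away from it, injectivity keeps the two values apart while [w - z] stays
    bounded. *)
Lemma uniform_injectivity (Phi E : C -> C) a b c d k p :
  half_plane_derivative Phi (fun z => Phi z * E z)%C -> a <= b -> b < 0 -> c <= d ->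
  (forall z, Re z < 0 -> continuous_CC Phi z) ->
  (forall z, Re z < 0 -> continuous_CC E z) ->
  (forall z, Re z < 0 -> Phi z <> RtoC 0) ->
  (forall z w : C, Re z < 0 -> Re w < 0 -> Rabs (snd w - snd z) <= p -> Phi z = Phi w -> z = w) ->
  0 < k ->
  exists m, 0 < m /\ forall z w : C, rectangle a b c d z -> rectangle a b c d w ->
    k <= Cmod (E z) -> Rabs (snd w - snd z) <= p -> m * Cmod (w - z) <= Cmod (Phi w - Phi z).
Proof.
intros HD Hab Hb Hcd HcP HcE HP0 Hinj Hk.
set (CC := prod_UniformSpace C_UniformSpace C_UniformSpace).
destruct (gauge_compact_prod (U := C_UniformSpace) (V := C_UniformSpace) _ _
  (gauge_compact_rectangle a b c d) (gauge_compact_rectangle a b c d)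
  (fun m q => k <= Cmod (E (fst q)) -> Rabs (snd (snd q) - snd (fst q)) <= p ->
    m * Cmod (snd q - fst q) <= Cmod (Phi (snd q) - Phi (fst q)))) as [m [Hm H]].
- intros m m' q Hmm H H1 H2. eapply Rle_trans; [|apply (H H1 H2)].
  apply Rmult_le_compat_r. apply Cmod_ge_0. lra.
- intros [z0 w0] [Hz0 Hw0]. simpl fst in *; simpl snd in *.
  assert (Hz : Re z0 < 0) by (destruct Hz0; unfold Re; lra).
  assert (Hw : Re w0 < 0) by (destruct Hw0; unfold Re; lra).
  assert (HcD : continuous_CC (fun z => Phi z * E z)%C z0).
  { apply continuous_Cmult; auto. }
  (* On the diagonal, either [|E z0| < k] and the condition on [E] fails nearby, or half the modulus
     of the derivative at [z0] is an admissible slope. *)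
  destruct (classic (z0 = w0)) as [<-|Hne].
  + destruct (Rlt_le_dec (Cmod (E z0)) k) as [HE|HE].
    * destruct (continuous_C_eps E z0 (HcE z0 Hz) (k - Cmod (E z0))) as [r [Hr Hr']]. lra.
      exists r. split; auto. intros [z w] [Hb1 Hb2] _ H1. simpl in *.
      specialize (Hr' z Hb1). generalize (Cmod_le_plus (E z) (E z0)). lra.
    * assert (HD0 : 0 < Cmod (Phi z0 * E z0)).
      { rewrite Cmod_mult. apply Rmult_lt_0_compat. apply Cmod_gt_0; auto. lra. }
      destruct (strict_derivative Phi _ z0 HD Hz HcD (Cmod (Phi z0 * E z0) / 2)) as [r [Hr Hr']]. lra.
      exists (Rmin r (Cmod (Phi z0 * E z0) / 2)). split. apply Rmin_pos; lra.
      intros [z w] [Hb1 Hb2] _ _ _. simpl in *.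
      apply (ball_le z0 _ _ (Rmin_l _ _)) in Hb1.
      apply (ball_le z0 _ _ (Rmin_l _ _)) in Hb2.
      specialize (Hr' z w Hb1 Hb2).
      assert (A := Cmod_le_plus (Phi z0 * E z0 * (w - z)) (Phi w - Phi z)).
      rewrite (Cmod_minus_sym (Phi z0 * E z0 * (w - z))), (Cmod_mult _ (w - z)) in A.
      assert (B := Rmin_r r (Cmod (Phi z0 * E z0) / 2)).
      apply Rle_trans with (Cmod (Phi z0 * E z0) / 2 * Cmod (w - z)).
      apply Rmult_le_compat_r; auto. apply Cmod_ge_0. lra.
  (* If the imaginary parts of [z0] and [w0] differ by more than [p], so do those of all nearby
     pairs, and the claim there is void. *)
  + destruct (Rlt_le_dec p (Rabs (snd w0 - snd z0))) as [Hp|Hp].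
    * exists ((Rabs (snd w0 - snd z0) - p) / 2). split. lra.
      intros [z w] [[_ Hb1] [_ Hb2]] _ _ H2. simpl in *.
      change (Rabs (snd z - snd z0) < (Rabs (snd w0 - snd z0) - p) / 2) in Hb1.
      change (Rabs (snd w - snd w0) < (Rabs (snd w0 - snd z0) - p) / 2) in Hb2.
      assert (A : Rabs (snd w0 - snd z0) <= Rabs (snd w - snd z) + (Rabs (snd z - snd z0) + Rabs (snd w - snd w0))).
      { replace (snd w0 - snd z0) with ((snd w - snd z) + ((snd z - snd z0) + - (snd w - snd w0))) by ring.
        eapply Rle_trans. apply Rabs_triang. apply Rplus_le_compat_l. eapply Rle_trans. apply Rabs_triang.
        rewrite Rabs_Ropp. lra. }
      lra.
    * assert (Hpos : 0 < Cmod (Phi w0 - Phi z0)).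
      { apply Cmod_gt_0. intros Heq. apply Hne. apply Hinj; auto.
        replace (Phi w0) with (Phi w0 - Phi z0 + Phi z0)%C by ring. rewrite Heq. ring. }
      destruct (continuous_C_eps Phi z0 (HcP z0 Hz) (Cmod (Phi w0 - Phi z0) / 4)) as [r1 [Hr1 H1]]. lra.
      destruct (continuous_C_eps Phi w0 (HcP w0 Hw) (Cmod (Phi w0 - Phi z0) / 4)) as [r2 [Hr2 H2]]. lra.
      (* [N] exceeds every distance inside the rectangle; the added 1 keeps it positive when the
         rectangle degenerates. *)
      set (N := (b - a) + (d - c) + 1). assert (HN : 0 < N) by (unfold N; lra).
      set (r3 := Cmod (Phi w0 - Phi z0) / 2 / N). assert (Hr3 : 0 < r3) by (apply Rdiv_lt_0_compat; lra).
      exists (Rmin r3 (Rmin r1 r2)). split. repeat apply Rmin_pos; auto.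
      intros [z w] [Hb1 Hb2] [Hz' Hw'] _ _. simpl in *.
      apply (ball_le z0 _ r1 (Rle_trans _ _ _ (Rmin_r _ _) (Rmin_l _ _))) in Hb1.
      apply (ball_le w0 _ r2 (Rle_trans _ _ _ (Rmin_r _ _) (Rmin_r _ _))) in Hb2.
      specialize (H1 z Hb1). specialize (H2 w Hb2).
      assert (A : Cmod (Phi w0 - Phi z0) / 2 <= Cmod (Phi w - Phi z)).
      { assert (A := Cmod_le_plus (Phi w0 - Phi z0) (Phi w - Phi z)).
        replace (Phi w0 - Phi z0 - (Phi w - Phi z))%C with ((Phi z - Phi z0) + - (Phi w - Phi w0))%C in A by ring.
        assert (B := Cmod_triangle (Phi z - Phi z0) (- (Phi w - Phi w0))). rewrite Cmod_opp in B. lra. }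
      eapply Rle_trans; [|exact A]. apply Rle_trans with (r3 * N).
      2:{ right. unfold r3. field. lra. }
      apply Rmult_le_compat. left; repeat apply Rmin_pos; auto. apply Cmod_ge_0. apply Rmin_l.
      eapply Rle_trans. apply Cmod_le_abs.
      destruct Hz', Hw'. unfold N, Re, Im; simpl.
      assert (Rabs (fst w + - fst z) <= b - a) by (apply Rabs_le; lra).
      assert (Rabs (snd w + - snd z) <= d - c) by (apply Rabs_le; lra). lra.
- exists m. split; auto. intros z w Hz Hw. apply (H (z, w)). split; auto.
Qed.

(** Here [P0] and [P] are two values of [Phi], [h] is the difference of their arguments, and [v]
    moves the tested target point to 1. The right side is the bump composed with the affine
    approximation of [Phi * v] and raised by [3 * x]; its centre is the zero of that approximation
    minus 1. *)
Lemma bump_pointwise_le (P0 P E0 v h : C) m x e : 0 < m -> 0 < e -> 0 < x <= 1 ->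
  Cmod (P0 * v - 1) < e -> (P0 * v * E0)%C <> RtoC 0 ->
  m * Cmod h <= Cmod (P - P0) ->
  Cmod (P - P0 - P0 * E0 * h) <= x * m / 2 * Cmod h ->
  bump e (P * v) <=
  pos_part (1 + 3 * x - (Cmod (P0 * v * E0) / e) ^ 2 * Cmod (h + (P0 * v - 1) / (P0 * v * E0)) ^ 2).
Proof.
intros Hm He Hx H0 Hp Hlow Hst.
destruct (Req_dec (bump e (P * v)) 0) as [Hz|Hz]. { rewrite Hz. apply pos_part_ge_0. }
assert (H1 := bump_pos e _ He Hz).
apply pos_part_le.
rewrite <- Rpow_mult_distr. unfold Rdiv at 2.
replace (Cmod (P0 * v * E0) * / e * Cmod (h + (P0 * v - 1) / (P0 * v * E0))) with
  (Cmod (P0 * v * E0) * Cmod (h + (P0 * v - 1) / (P0 * v * E0)) / e) by (unfold Rdiv; ring).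
rewrite <- Cmod_mult.
replace (P0 * v * E0 * (h + (P0 * v - 1) / (P0 * v * E0)))%C with (P0 * v * E0 * h + (P0 * v - 1))%C by (generalize (P0 * v - 1)%C; revert Hp; generalize (P0 * v * E0)%C; intros p Hp y; field; auto).
set (b := Cmod (P0 * v * E0 * h + (P0 * v - 1)) / e). set (a := Cmod (P * v - 1) / e).
assert (Ha : 0 <= a < 1).
{ split. apply Rdiv_le_0_compat; auto. apply Cmod_ge_0. apply Rmult_lt_reg_r with e; auto. unfold a, Rdiv. rewrite Rmult_assoc, Rinv_l; lra. }
assert (Hb : 0 <= b). { apply Rdiv_le_0_compat; auto. apply Cmod_ge_0. }
(* The linearization error is at most [x / 2] times [Cmod (P - P0)], by the lower slope [m]. As
   [P * v] and [P0 * v] are both within [e] of 1, it becomes at most [x * e] after multiplication by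
   [v]. *)
assert (Hab : b <= a + x).
{ apply Rmult_le_reg_r with e; auto. unfold a, b, Rdiv. rewrite Rmult_plus_distr_r, !Rmult_assoc, Rinv_l, !Rmult_1_r by lra.
  eapply Rle_trans. apply (Cmod_le_plus _ (P * v - 1)). apply Rplus_le_compat_l.
  replace (P0 * v * E0 * h + (P0 * v - 1) - (P * v - 1))%C with (- (v * (P - P0 - P0 * E0 * h)))%C by ring.
  rewrite Cmod_opp, Cmod_mult.
  apply Rle_trans with (Cmod v * (x / 2 * Cmod (P - P0))).
  - apply Rmult_le_compat_l. apply Cmod_ge_0. eapply Rle_trans. exact Hst.
    replace (x * m / 2 * Cmod h) with (x / 2 * (m * Cmod h)) by field. apply Rmult_le_compat_l; lra.
  - replace (Cmod v * (x / 2 * Cmod (P - P0))) with (x / 2 * (Cmod (P - P0) * Cmod v)) by ring.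
    rewrite <- Cmod_mult. replace ((P - P0) * v)%C with ((P * v - 1) + - (P0 * v - 1))%C by ring.
    assert (A := Cmod_triangle (P * v - 1) (- (P0 * v - 1))). rewrite Cmod_opp in A.
    apply Rle_trans with (x / 2 * (2 * e)). apply Rmult_le_compat_l; lra. right; field. }
(* Since [a < 1] and [x <= 1], [(a + x) ^ 2 <= a ^ 2 + 3 * x]. *)
assert (b ^ 2 <= (a + x) ^ 2) by (apply pow_incr; lra). nra.
Qed.

(** * The area inequality *)

(* Functions on [Re z < 0] are made total and continuous by precomposing with [clamp s],
[s < 0], as [RInt_Fubini4] is stated for everywhere continuous integrands. *)
Definition clamp (s : R) (z : C) : C := (Rmin (fst z) s, snd z).

Lemma continuous_clamp {U : UniformSpace} s (f : U -> C) x :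
  continuous_C f x -> continuous_C (fun u => clamp s (f u)) x.
Proof.
intros H. apply continuous_pairC. apply continuous_Rmin. apply continuous_Re; auto. apply continuous_const.
apply continuous_Im; auto.
Qed.

Lemma continuous_clamp_comp {U V : UniformSpace} s (F : C -> V) (f : U -> C) x :
  s < 0 -> (forall z, Re z < 0 -> continuous_on_C F z) ->
  continuous_C f x -> continuous (fun u => F (clamp s (f u))) x.
Proof.
intros Hs HF Hf. apply (continuous_comp (V := C_UniformSpace) (fun u => clamp s (f u)) F).
apply continuous_clamp; auto. apply HF. unfold Re, clamp; simpl. generalize (Rmin_r (fst (f x)) s). lra.
Qed.

Lemma clamp_eq s z : fst z <= s -> clamp s z = z.
Proof. intros H. destruct z. unfold clamp; simpl in *. rewrite Rmin_left; auto. Qed.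

Lemma RInt_RInt_le (f g : R -> R -> R) a b c d : a <= b -> c <= d ->
  (forall p, continuous (fun p : RR => f (fst p) (snd p)) p) ->
  (forall p, continuous (fun p : RR => g (fst p) (snd p)) p) ->
  (forall x y, a <= x <= b -> c <= y <= d -> f x y <= g x y) ->
  RInt (fun x => RInt (f x) c d) a b <= RInt (fun x => RInt (g x) c d) a b.
Proof.
intros Hab Hcd Hf Hg Hle.
assert (Hcy : forall h : R -> R -> R, (forall p, continuous (fun p : RR => h (fst p) (snd p)) p) ->
  forall x y, continuous (h x) y).
{ intros h H x y. apply (continuous_comp (fun t => (x, t)) (fun p => h (fst p) (snd p))).
  apply continuous_pair. apply continuous_const. apply continuous_id. apply H. }
apply RInt_le; auto; try (apply ex_RInt_cont, continuous_RInt_param; auto).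
intros x Hx. apply RInt_le; auto; try (apply ex_RInt_cont; auto).
intros y Hy. apply Hle; lra.
Qed.

(* Where [|E| <= k] the weight vanishes, so critical points of [Phi] need no separate
treatment. *)
Lemma RInt_bump_le (Phi E : C -> C) s1 s2 k rho :
  half_plane_derivative Phi (fun z => Phi z * E z)%C -> s1 <= s2 -> s2 < 0 ->
  (forall z, Re z < 0 -> continuous_CC Phi z) ->
  (forall z, Re z < 0 -> continuous_CC E z) ->
  (forall z, Re z < 0 -> Phi z <> RtoC 0) ->
  (forall s t, Phi (s, t + 2 * PI) = Phi (s, t)) ->
  (forall s t, E (s, t + 2 * PI) = E (s, t)) ->
  (forall z w, Re z < 0 -> Re w < 0 -> Rabs (snd w - snd z) <= PI -> Phi z = Phi w -> z = w) ->
  0 < k -> 0 < rho <= 1 ->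
  exists e0, 0 < e0 /\ forall e, 0 < e <= e0 -> forall v : C,
    RInt (fun s => RInt (fun t => pos_part (Cmod (E (clamp s2 (s, t))) ^ 2 - k ^ 2) *
      bump e (Phi (clamp s2 (s, t)) * v)) 0 (2 * PI)) s1 s2 <= (1 + rho) * (e ^ 2 * paraboloid_volume).
Proof.
intros HD Hs12 Hs2 HcP HcE HP0 HperP HperE Hinj Hk Hrho.
assert (HPI := PI2_1).
(* The losses accumulated below amount to the factor [((1 + x) (1 + 3 x) (1 + 2 x)) ^ 2 <= (1 + 7 x)
   ^ 2], comfortably below [1 + 100 * x]. *)
set (x := rho / 100).
assert (Hx : 0 < x <= / 100) by (unfold x; lra).
(* Large enough to contain every window of half-width [PI] centred at a point with ordinate in
   [[0, 2 * PI]]. *)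
set (K := rectangle s1 s2 (- PI) (3 * PI)).
assert (HKre : forall z, K z -> Re z < 0) by (intros z [[_ H] _]; unfold Re; lra).
destruct (uniform_injectivity Phi E s1 s2 (- PI) (3 * PI) k PI) as [m [Hm Hlow]]; auto. lra.
destruct (uniform_strict_derivative Phi _ s1 s2 (- PI) (3 * PI) HD Hs2
  (fun z Hz => continuous_Cmult _ _ _ (HcP z Hz) (HcE z Hz)) (x * m / 2)) as [r1 [Hr1 Hst]].
{ apply Rdiv_lt_0_compat. apply Rmult_lt_0_compat; lra. lra. }
destruct (uniform_continuity_rectangle E s1 s2 (- PI) (3 * PI)) with (e := x * k) as [r2 [Hr2 Hue]].
{ auto. }
{ apply Rmult_lt_0_compat; lra. }
destruct (gauge_compact_bounded (U := C_UniformSpace) K (fun z => Cmod (Phi z))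
  (gauge_compact_rectangle _ _ _ _)) as [M [HM HMb]].
{ intros z Hz. apply continuous_Cmod. auto. }
set (r := Rmin r1 r2). assert (Hr : 0 < r) by (apply Rmin_pos; auto).
(* Two points where the bump is nonzero have values of [Phi] at distance at most [4 * M * e]. This
   [e0] makes that at most [r * m / 2], so by the slope [m] the points are closer than [r]. *)
exists (Rmin x (r * m / (8 * M))). split.
{ apply Rmin_pos. lra. apply Rdiv_lt_0_compat. apply Rmult_lt_0_compat; lra. lra. }
intros e [He He'] v.
assert (Hex : e <= x) by (eapply Rle_trans; [exact He'|apply Rmin_l]).
assert (Her : e <= r * m / (8 * M)) by (eapply Rle_trans; [exact He'|apply Rmin_r]).
set (F := fun s t => pos_part (Cmod (E (clamp s2 (s, t))) ^ 2 - k ^ 2) * bump e (Phi (clamp s2 (s, t)) * v)).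
assert (HF : forall (U : UniformSpace) (f g : U -> R) u, continuous f u -> continuous g u ->
  continuous (fun u => F (f u) (g u)) u).
{ intros U f g u Hf Hg. apply continuous_Rmult.
  - apply continuous_pos_part, continuous_Rminus, continuous_const. apply continuous_pow, continuous_Cmod.
    apply (continuous_clamp_comp (V := C_UniformSpace)); auto. apply continuous_pairC; auto.
  - apply continuous_bump, continuous_Cmult, continuous_const.
    apply (continuous_clamp_comp (V := C_UniformSpace)); auto. apply continuous_pairC; auto. }
change (RInt _ s1 s2) with (RInt (fun s => RInt (F s) 0 (2 * PI)) s1 s2).
assert (HV := paraboloid_volume_pos).
(* Either the integrand vanishes on the rectangle, or one point [z0] where it does not locates all
   the others in a period window about it. *)
destruct (classic (exists z0, rectangle s1 s2 0 (2 * PI) z0 /\ F (fst z0) (snd z0) <> 0)) as [[z0 [Hz0 HF0]]|Hnone].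
2:{ apply Rle_trans with (RInt (fun s => RInt (fun t => 0) 0 (2 * PI)) s1 s2).
  - apply RInt_RInt_le; auto; try lra.
    intros p. apply HF. apply continuous_fst_at. apply continuous_snd_at.
    intros p. apply continuous_const.
    intros s t Hs Ht. right. apply NNPP. intros Hn. apply Hnone. exists (s, t). split; auto. split; auto.
  - rewrite (RInt_ext _ (fun _ => 0)).
    rewrite RInt_const. unfold scal; simpl; unfold mult; simpl. rewrite Rmult_0_r.
    apply Rmult_le_pos. lra. apply Rmult_le_pos. apply pow2_ge_0. lra.
    intros. rewrite RInt_const. unfold scal; simpl; unfold mult; simpl. ring. }
assert (HFnz : forall z, fst z <= s2 -> F (fst z) (snd z) <> 0 -> k < Cmod (E z) /\ bump e (Phi z * v) <> 0 /\
  F (fst z) (snd z) <= Cmod (E z) ^ 2 * bump e (Phi z * v)).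
{ intros z Hz Hn. unfold F in *. replace (fst z, snd z) with z in * by (destruct z; auto). rewrite clamp_eq in * by auto.
  assert (Hpp : 0 < Cmod (E z) ^ 2 - k ^ 2).
  { apply Rnot_le_lt. intros H. apply Hn. rewrite pos_part_eq_0; auto. ring. }
  split. { apply Rnot_le_lt. intros H. assert (Cmod (E z) ^ 2 <= k ^ 2). apply pow_incr. split; auto. apply Cmod_ge_0. lra. }
  split. { intros H. apply Hn. rewrite H. ring. }
  rewrite pos_part_eq by lra. apply Rmult_le_compat_r. apply pos_part_ge_0. generalize (pow2_ge_0 k). lra. }
assert (HzK0 : K z0). { destruct Hz0 as [A B]. split; auto. lra. }
destruct (HFnz z0) as [HE0 [Hb0 _]]; auto. { destruct Hz0; lra. }
assert (Hu0 := bump_pos e _ He Hb0).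
set (p := (Phi z0 * v * E z0)%C).
assert (Hu0n : 1 - e <= Cmod (Phi z0 * v)).
{ assert (A := Cmod_le_plus 1 (Phi z0 * v)). rewrite Cmod_1, Cmod_minus_sym in A. lra. }
assert (Hpn : (1 - e) * Cmod (E z0) <= Cmod p).
{ unfold p. rewrite Cmod_mult. apply Rmult_le_compat_r; auto. apply Cmod_ge_0. }
assert (Hp0 : 0 < Cmod p). { eapply Rlt_le_trans; [|exact Hpn]. apply Rmult_lt_0_compat; lra. }
assert (Hpz : p <> RtoC 0) by (apply Cmod_gt_0; auto).
set (q := Cmod p / e). assert (Hq : 0 < q) by (apply Rdiv_lt_0_compat; auto).
(* One Newton step from [z0] for the equation [Phi z * v = 1]: the model paraboloid is centred at
   [z0 - y]. *)
set (y := ((Phi z0 * v - 1) / p)%C).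
set (G := fun s t => (Cmod (E z0) ^ 2 * (1 + x) ^ 2) * pos_part (1 + 3 * x - q ^ 2 * ((s - (fst z0 - fst y)) ^ 2 + (t - (snd z0 - snd y)) ^ 2))).
assert (HG : forall (U : UniformSpace) (f g : U -> R) u, continuous f u -> continuous g u ->
  continuous (fun u => G (f u) (g u)) u).
{ intros U f g u Hf Hg. apply continuous_Rmult. apply continuous_const. apply continuous_pos_part, continuous_Rminus. apply continuous_const.
  apply continuous_Rmult. apply continuous_const.
  apply continuous_Rplus; apply continuous_pow, continuous_Rminus; auto; apply continuous_const. }
(* Recentring the period at [z0] keeps the ordinates within [PI] of that of [z0], the range in which
   injectivity is available. *)
rewrite (RInt_ext (fun s => RInt (F s) 0 (2 * PI)) (fun s => RInt (F s) (snd z0 - PI) (snd z0 + PI))).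
2:{ intros s _. symmetry. replace (snd z0 + PI) with (snd z0 - PI + 2 * PI) by ring. apply RInt_periodic; auto.
  intros t. apply HF. apply continuous_const. apply continuous_id.
  intros t. unfold F, clamp; simpl. rewrite HperP, HperE. reflexivity. }
apply Rle_trans with (RInt (fun s => RInt (G s) (snd z0 - PI) (snd z0 + PI)) s1 s2).
- apply RInt_RInt_le; auto; try lra.
  intros u. apply HF. apply continuous_fst_at. apply continuous_snd_at.
  intros u. apply HG. apply continuous_fst_at. apply continuous_snd_at.
  intros s t Hs Ht.
  destruct (Req_dec (F s t) 0) as [Hz|Hz].
  { rewrite Hz. apply Rmult_le_pos. apply Rmult_le_pos; apply pow2_ge_0. apply pos_part_ge_0. }
  set (z := (s, t) : C).
  destruct (HFnz z) as [HE [Hb HFle]]; auto. { simpl; lra. }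
  assert (Hu := bump_pos e _ He Hb).
  assert (HzK : K z). { destruct Hz0 as [A B]. split; simpl; lra. }
  assert (Hti : Rabs (snd z - snd z0) <= PI) by (simpl; apply Rabs_le; lra).
  assert (Hl := Hlow z0 z HzK0 HzK (Rlt_le _ _ HE0) Hti).
  assert (HPd : Cmod (Phi z - Phi z0) * Cmod v <= 2 * e).
  { rewrite <- Cmod_mult. replace ((Phi z - Phi z0) * v)%C with ((Phi z * v - 1) + - (Phi z0 * v - 1))%C by ring.
    assert (A := Cmod_triangle (Phi z * v - 1) (- (Phi z0 * v - 1))). rewrite Cmod_opp in A. lra. }
  assert (Hv : 1 / 2 <= M * Cmod v).
  { apply Rle_trans with (Cmod (Phi z0 * v)). lra. rewrite Cmod_mult. apply Rmult_le_compat_r. apply Cmod_ge_0.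
    specialize (HMb z0 HzK0). rewrite Rabs_pos_eq in HMb; auto. apply Cmod_ge_0. }
  assert (HPd2 : Cmod (Phi z - Phi z0) <= 4 * M * e).
  { assert (A := Cmod_ge_0 (Phi z - Phi z0)). assert (B := Cmod_ge_0 v).
    assert (Cmod (Phi z - Phi z0) * (M * Cmod v) <= 2 * e * M).
    { replace (Cmod (Phi z - Phi z0) * (M * Cmod v)) with (Cmod (Phi z - Phi z0) * Cmod v * M) by ring.
      apply Rmult_le_compat_r; lra. } nra. }
  assert (Hh : Cmod (z - z0) < r).
  { apply Rmult_lt_reg_l with m; auto. eapply Rle_lt_trans. exact Hl. eapply Rle_lt_trans. exact HPd2.
    apply Rle_lt_trans with (r * m / 2). 2: assert (0 < r * m) by (apply Rmult_lt_0_compat; auto); lra.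
    apply Rle_trans with (4 * M * (r * m / (8 * M))). apply Rmult_le_compat_l; lra. right. field. lra. }
  assert (Hst' := Hst z0 z HzK0 (ball_of_Cmod _ _ _ (Rlt_le_trans _ _ _ Hh (Rmin_l _ _)))).
  assert (Hue' := Hue z0 z HzK0 (ball_of_Cmod _ _ _ (Rlt_le_trans _ _ _ Hh (Rmin_r _ _)))).
  assert (HEE : Cmod (E z) <= Cmod (E z0) * (1 + x)).
  { assert (A := Cmod_le_plus (E z) (E z0)). nra. }
  eapply Rle_trans. exact HFle. unfold G.
  apply Rmult_le_compat. apply pow2_ge_0. apply pos_part_ge_0.
  { rewrite <- Rpow_mult_distr. apply pow_incr. split; auto. apply Cmod_ge_0. }
  eapply Rle_trans. apply (bump_pointwise_le (Phi z0) (Phi z) (E z0) v (z - z0)%C m x e); auto; try lra.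
  right. fold p. fold y. f_equal. unfold q. do 2 f_equal. rewrite Cmod2_alt. unfold Re, Im. simpl. ring.
- assert (E1 : RInt (fun s => RInt (G s) (snd z0 - PI) (snd z0 + PI)) s1 s2 <=
    Cmod (E z0) ^ 2 * (1 + x) ^ 2 * ((1 + 3 * x) ^ 2 / q ^ 2 * paraboloid_volume)).
  { set (A := Cmod (E z0) ^ 2 * (1 + x) ^ 2).
    set (H := fun s t => pos_part (1 + 3 * x - q ^ 2 * ((s - (fst z0 - fst y)) ^ 2 + (t - (snd z0 - snd y)) ^ 2))).
    assert (HH : forall (U : UniformSpace) (f g : U -> R) u, continuous f u -> continuous g u ->
      continuous (fun u => H (f u) (g u)) u).
    { intros U f g u Hf Hg. apply continuous_pos_part, continuous_Rminus. apply continuous_const.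
      apply continuous_Rmult. apply continuous_const.
      apply continuous_Rplus; apply continuous_pow, continuous_Rminus; auto; apply continuous_const. }
    assert (EQ : RInt (fun s => RInt (G s) (snd z0 - PI) (snd z0 + PI)) s1 s2 =
      A * RInt (fun s => RInt (H s) (snd z0 - PI) (snd z0 + PI)) s1 s2).
    { transitivity (RInt (fun s => scal A (RInt (H s) (snd z0 - PI) (snd z0 + PI))) s1 s2).
      - apply RInt_ext. intros s _. apply (RInt_scal (V := R_CompleteNormedModule) (H s)). apply ex_RInt_cont.
        intros t. apply HH. apply continuous_const. apply continuous_id.
      - apply (RInt_scal (V := R_CompleteNormedModule)). apply ex_RInt_cont. apply continuous_RInt_param. lra.
        intros u. apply HH. apply continuous_fst_at. apply continuous_snd_at. }
    rewrite EQ. apply Rmult_le_compat_l. apply Rmult_le_pos; apply pow2_ge_0.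
    apply RInt_scaled_paraboloid_le; lra. }
  eapply Rle_trans. exact E1.
  replace (Cmod (E z0) ^ 2 * (1 + x) ^ 2 * ((1 + 3 * x) ^ 2 / q ^ 2 * paraboloid_volume)) with
    ((1 + x) ^ 2 * (1 + 3 * x) ^ 2 * (Cmod (E z0) / Cmod p) ^ 2 * (e ^ 2 * paraboloid_volume)).
  2:{ unfold q. field. lra. }
  apply Rmult_le_compat_r. apply Rmult_le_pos. apply pow2_ge_0. lra.
  (* The Jacobian cancels here: the weight carries [|E z0|^2], the paraboloid has volume
     proportional to [/ Cmod p ^ 2], and [p / E z0 = Phi z0 * v] is within [e] of 1. *)
  assert (Hrat : Cmod (E z0) / Cmod p <= 1 + 2 * x).
  { apply Rmult_le_reg_r with (Cmod p); auto. unfold Rdiv. rewrite Rmult_assoc, Rinv_l, Rmult_1_r by lra.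
    apply Rle_trans with ((1 + 2 * x) * ((1 - x) * Cmod (E z0))).
    - assert (0 < Cmod (E z0)) by lra. replace (Cmod (E z0)) with (1 * Cmod (E z0)) at 1 by ring.
      rewrite <- Rmult_assoc. apply Rmult_le_compat_r. lra. nra.
    - apply Rmult_le_compat_l. lra. eapply Rle_trans; [|exact Hpn]. apply Rmult_le_compat_r; lra. }
  assert (Hrat0 : 0 <= Cmod (E z0) / Cmod p) by (apply Rdiv_le_0_compat; [lra|auto]).
  apply Rle_trans with (((1 + x) * (1 + 3 * x) * (1 + 2 * x)) ^ 2).
  { rewrite !Rpow_mult_distr. apply Rmult_le_compat_l. apply Rmult_le_pos; apply pow2_ge_0. apply pow_incr; auto. }
  assert (H1 : (1 + x) * (1 + 3 * x) * (1 + 2 * x) <= 1 + 7 * x).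
  { assert ((1 + x) * (1 + 3 * x) <= 1 + 9 / 2 * x) by nra. nra. }
  apply Rle_trans with ((1 + 7 * x) ^ 2). apply pow_incr. split; auto.
  { repeat apply Rmult_le_pos; lra. }
  replace rho with (100 * x) by (unfold x; field). nra.
Qed.

(** Quantifying over all parameter spaces and substitutions makes these notions stable under
    permuting, freezing or pairing variables, with no rearrangement of nested products. *)
Definition continuous2 (F : R -> R -> R) : Prop :=
  forall (U : UniformSpace) (f g : U -> R) u, continuous f u -> continuous g u ->
    continuous (fun u => F (f u) (g u)) u.
Definition continuous3 (F : R -> R -> R -> R) : Prop :=
  forall (U : UniformSpace) (f g h : U -> R) u, continuous f u -> continuous g u -> continuous h u ->
    continuous (fun u => F (f u) (g u) (h u)) u.
Definition continuous4 (F : R -> R -> R -> R -> R) : Prop :=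
  forall (U : UniformSpace) (f g h k : U -> R) u,
    continuous f u -> continuous g u -> continuous h u -> continuous k u ->
    continuous (fun u => F (f u) (g u) (h u) (k u)) u.

Lemma continuous2_prod (F : R -> R -> R) : continuous2 F ->
  forall p, continuous (fun p : RR => F (fst p) (snd p)) p.
Proof.
intros HF p. apply HF. apply continuous_fst_at.
apply continuous_snd_at.
Qed.

Lemma continuous2_RInt F c d : c <= d -> continuous2 F ->
  forall (U : UniformSpace) (f : U -> R) u, continuous f u -> continuous (fun u => RInt (F (f u)) c d) u.
Proof.
intros Hcd HF U f u Hf. apply (continuous_real_comp (fun x => RInt (F x) c d)); auto.
apply continuous_RInt_param; auto. apply continuous2_prod; auto.
Qed.

Lemma continuous3_RInt F c d : c <= d -> continuous3 F -> continuous2 (fun x y => RInt (F x y) c d).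
Proof.
intros Hcd HF U f g u Hf Hg.
apply (continuous_comp (V := RR) (fun u => (f u, g u)) (fun p => RInt (F (fst p) (snd p)) c d)).
apply continuous_pair; auto.
apply (continuous_RInt_param (fun p => F (fst p) (snd p))); auto.
intros q. apply HF.
apply continuous_fst', continuous_fst', continuous_id.
apply continuous_snd', continuous_fst', continuous_id.
apply continuous_snd', continuous_id.
Qed.

Lemma continuous4_RInt F c d : c <= d -> continuous4 F -> continuous3 (fun x y z => RInt (F x y z) c d).
Proof.
intros Hcd HF U f g h u Hf Hg Hh.
apply (continuous_comp (V := prod_UniformSpace (RR) R_UniformSpace)
  (fun u => ((f u, g u), h u)) (fun p => RInt (F (fst (fst p)) (snd (fst p)) (snd p)) c d)).
repeat apply continuous_pair; auto.
apply (continuous_RInt_param (fun p => F (fst (fst p)) (snd (fst p)) (snd p))); auto.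
intros q. apply HF.
apply continuous_fst', continuous_fst', continuous_fst', continuous_id.
apply continuous_snd', continuous_fst', continuous_fst', continuous_id.
apply continuous_snd', continuous_fst', continuous_id.
apply continuous_snd', continuous_id.
Qed.

(** Four adjacent exchanges of variables: [t] with [x], [s] with [x], [t] with [y], [s] with [y]. *)
Lemma RInt_Fubini4 (H : R -> R -> R -> R -> R) a b c d a' b' c' d' :
  a <= b -> c <= d -> a' <= b' -> c' <= d' -> continuous4 H ->
  RInt (fun s => RInt (fun t => RInt (fun x => RInt (fun y => H s t x y) c' d') a' b') c d) a b =
  RInt (fun x => RInt (fun y => RInt (fun s => RInt (fun t => H s t x y) c d) a b) c' d') a' b'.
Proof.
intros H1 H2 H3 H4 HH.
assert (cc : forall (U : UniformSpace) (x : R) (u : U), continuous (fun _ => x) u) by (intros; apply continuous_const).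
assert (Hy : continuous3 (fun s t x => RInt (H s t x) c' d')) by (apply continuous4_RInt; auto).
assert (Ht : continuous3 (fun s x y => RInt (fun t => H s t x y) c d)).
{ apply (continuous4_RInt (fun s x y t => H s t x y)); auto. intros U f g h k u Hf Hg Hh Hk. apply HH; auto. }
transitivity (RInt (fun s => RInt (fun x => RInt (fun t => RInt (H s t x) c' d') c d) a' b') a b).
{ apply RInt_ext. intros s _. apply (RInt_Fubini (fun t x => RInt (H s t x) c' d')); auto.
  apply (continuous2_prod (fun t x => RInt (H s t x) c' d')). intros U f g u Hf Hg. apply Hy; auto. }
transitivity (RInt (fun x => RInt (fun s => RInt (fun t => RInt (H s t x) c' d') c d) a b) a' b').
{ apply (RInt_Fubini (fun s x => RInt (fun t => RInt (H s t x) c' d') c d)); auto.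
  apply (continuous2_prod (fun s x => RInt (fun t => RInt (H s t x) c' d') c d)).
  apply (continuous3_RInt (fun s x t => RInt (H s t x) c' d')); auto.
  intros U f g h u Hf Hg Hh. apply Hy; auto. }
apply RInt_ext. intros x _.
transitivity (RInt (fun s => RInt (fun y => RInt (fun t => H s t x y) c d) c' d') a b).
{ apply RInt_ext. intros s _. apply (RInt_Fubini (fun t y => H s t x y)); auto.
  apply (continuous2_prod (fun t y => H s t x y)). intros U f g u Hf Hg. apply HH; auto. }
apply (RInt_Fubini (fun s y => RInt (fun t => H s t x y) c d)); auto.
apply (continuous2_prod (fun s y => RInt (fun t => H s t x y) c d)). intros U f g u Hf Hg. apply Ht; auto.
Qed.

Lemma RInt_Rmult (k : R) f a b : (forall t, continuous f t) -> RInt (fun t => k * f t) a b = k * RInt f a b.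
Proof. intros Hf. apply (RInt_scal (V := R_CompleteNormedModule)). apply ex_RInt_cont; auto. Qed.

Lemma RInt_RInt_Rmult (k : R) F a b c d : c <= d -> continuous2 F ->
  RInt (fun s => RInt (fun t => k * F s t) c d) a b = k * RInt (fun s => RInt (F s) c d) a b.
Proof.
intros Hcd HF. rewrite <- RInt_Rmult.
- apply RInt_ext. intros s _. apply RInt_Rmult. intros t. apply HF. apply continuous_const. apply continuous_id.
- intros t. apply continuous2_RInt; auto. apply continuous_id.
Qed.

Lemma uniformly_continuous_interval (W : R -> R) a b : (forall x, continuous W x) ->
  forall e, 0 < e -> exists d, 0 < d /\ forall x y, a <= x <= b -> Rabs (y - x) < d -> Rabs (W y - W x) <= e.
Proof.
intros HW e He.
destruct (gauge_compact_interval a b (fun d x => forall y : R, Rabs (y - x) < d -> Rabs (W y - W x) <= e)) as [d [Hd H]].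
- intros d d' x Hdd H y Hy. apply H. lra.
- intros x Hx. destruct (proj1 (continuous_real_iff W x) (HW x) (e / 2)) as [d [Hd H]]. lra.
  exists (d / 2). split. lra. intros y Hy _ y' Hy'. change (Rabs (y - x) < d / 2) in Hy.
  assert (A := H y). assert (B := H y'). change (Rabs (y - x) < d -> Rabs (W y - W x) < e / 2) in A.
  change (Rabs (y' - x) < d -> Rabs (W y' - W x) < e / 2) in B.
  replace (W y' - W y) with ((W y' - W x) + - (W y - W x)) by ring.
  eapply Rle_trans. apply Rabs_triang. rewrite Rabs_Ropp.
  assert (Rabs (y' - x) < d). { replace (y' - x) with ((y' - y) + (y - x)) by ring. eapply Rle_lt_trans. apply Rabs_triang. lra. }
  specialize (B H0). assert (Rabs (y - x) < d) by lra. specialize (A H1). lra.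
- exists d. split; auto.
Qed.

(** The left side is the integral of [W (Re zeta)] over the image of the rectangle under a logarithm
    of [Phi] with derivative [E]. Modulo [2 pi i] that image has no overlaps, and it lies in a strip
    whose period has height [2 * PI]. The proof computes one fourfold integral in both orders: for
    fixed source point the target integral is almost [W |E|^2] times the bump volume, for fixed
    target point the source integral is at most about [W] times the same volume. *)
Theorem area_inequality (Phi E Lm : C -> C) (W : R -> R) s1 s2 T L :
  half_plane_derivative Phi (fun z => Phi z * E z)%C -> s1 <= s2 -> s2 < 0 ->
  (forall z, Re z < 0 -> continuous_CC Phi z) ->
  (forall z, Re z < 0 -> continuous_CC E z) ->
  (forall z, Re z < 0 -> continuous_on_C (fun z => Re (Lm z)) z) ->
  (forall z, Re z < 0 -> Phi z = Cexp (Lm z)) ->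
  (forall s t, Phi (s, t + 2 * PI) = Phi (s, t)) ->
  (forall s t, E (s, t + 2 * PI) = E (s, t)) ->
  (forall z w, Re z < 0 -> Re w < 0 -> Rabs (snd w - snd z) <= PI -> Phi z = Phi w -> z = w) ->
  (forall x, continuous W x) -> (forall x, 0 <= W x) ->
  (forall z, rectangle s1 s2 0 (2 * PI) z -> T + 1 <= Re (Lm z) <= L - 1) ->
  RInt (fun s => RInt (fun t => W (Re (Lm (s, t))) * Cmod (E (s, t)) ^ 2) 0 (2 * PI)) s1 s2
    <= 2 * PI * RInt W T L.
Proof.
intros HD Hs12 Hs2 HcP HcE HcX HPL HperP HperE Hinj HW HW0 HTL.
assert (HPI := PI2_1). assert (HV := paraboloid_volume_pos).
assert (HTL' : T <= L).
{ destruct (HTL (s1, 0)). split; simpl; lra. lra. }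
set (Ec := fun s t => E (clamp s2 (s, t))). set (Pc := fun s t => Phi (clamp s2 (s, t))).
set (Xc := fun s t => Re (Lm (clamp s2 (s, t)))).
assert (cE : continuous2 (fun s t => Cmod (Ec s t))).
{ intros U f g u Hf Hg. apply continuous_Cmod. apply (continuous_clamp_comp (V := C_UniformSpace)); auto. apply continuous_pairC; auto. }
assert (cX : continuous2 Xc).
{ intros U f g u Hf Hg. apply (continuous_clamp_comp (V := R_UniformSpace) s2 (fun z => Re (Lm z))); auto. apply continuous_pairC; auto. }
set (S0 := fun s t => W (Xc s t) * Cmod (Ec s t) ^ 2).
assert (cS : continuous2 S0).
{ intros U f g u Hf Hg. apply continuous_Rmult. apply continuous_real_comp; auto. apply continuous_pow; auto. }
assert (ES : RInt (fun s => RInt (fun t => W (Re (Lm (s, t))) * Cmod (E (s, t)) ^ 2) 0 (2 * PI)) s1 s2 =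
  RInt (fun s => RInt (S0 s) 0 (2 * PI)) s1 s2).
{ apply RInt_ext. intros s Hs. rewrite Rmin_left, Rmax_right in Hs by lra.
  apply RInt_ext. intros t _. unfold S0, Xc, Ec. rewrite !clamp_eq by (simpl; lra). reflexivity. }
rewrite ES. clear ES.
destruct (gauge_compact_bounded (U := C_UniformSpace) (rectangle s1 s2 0 (2 * PI)) (fun z => Cmod (E z) ^ 2)
  (gauge_compact_rectangle _ _ _ _)) as [N1 [HN1 HN1b]].
{ intros z [Hz _]. apply continuous_pow, continuous_Cmod, HcE. unfold Re. lra. }
destruct (gauge_compact_bounded (fun x => T <= x <= L) W (gauge_compact_interval _ _)) as [N2 [HN2 HN2b]]; auto.
set (I := RInt W T L). set (Area := (s2 - s1) * (2 * PI)).
assert (HI : 0 <= I). { apply RInt_ge_0; auto. apply ex_RInt_cont; auto. }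
assert (HA : 0 <= Area). { apply Rmult_le_pos; lra. }
assert (Hmain : forall d, 0 < d <= 1 / 2 -> RInt (fun s => RInt (S0 s) 0 (2 * PI)) s1 s2 <=
  2 * PI * I + d * (3 * (2 * PI * I) + (N1 + N2) * Area)).
{ intros d Hd.
  destruct (RInt_bump_le Phi E s1 s2 d d) as [e0 [He0 Hup]]; auto; try lra.
  { intros z Hz. rewrite HPL; auto. apply Cexp_neq_0. }
  destruct (uniformly_continuous_interval W T L HW d) as [r [Hr Hosc]]. lra.
  (* [e0] for the upper estimate, [r / 2] for the oscillation of [W] on the bump, [d / 10] to have
     [(1 + 2 * e) ^ 2 <= 1 + d]. *)
  set (e := Rmin e0 (Rmin (r / 2) (d / 10))).
  assert (He : 0 < e) by (repeat apply Rmin_pos; lra).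
  assert (Hee0 : e <= e0) by apply Rmin_l.
  assert (Her : e <= r / 2) by (eapply Rle_trans; [apply Rmin_r|apply Rmin_l]).
  assert (Hed : e <= d / 10) by (eapply Rle_trans; [apply Rmin_r|apply Rmin_r]).
  set (wt := fun s t => pos_part (Cmod (Ec s t) ^ 2 - d ^ 2)).
  assert (cw : continuous2 wt).
  { intros U f g u Hf Hg. apply continuous_pos_part, continuous_Rminus, continuous_const. apply continuous_pow; auto. }
  (* For fixed [(s, t)] the bump is that of [Cexp (Lm (s, t) - (x, y))]; for fixed [(x, y)] it is
     that of [Phi] times a constant. These are the two forms estimated above. *)
  set (H := fun s t x y => W x * (wt s t * bump e (Pc s t * Cexp (- (x, y))%C))).
  assert (cH : continuous4 H).
  { intros U f g h k u Hf Hg Hh Hk. repeat apply continuous_Rmult; auto.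
    apply continuous_real_comp; auto.
    apply continuous_bump, continuous_Cmult. apply (continuous_clamp_comp (V := C_UniformSpace)); auto. apply continuous_pairC; auto.
    apply continuous_Cexp. apply (continuous_ext (U := C_UniformSpace) (fun u => (- h u, - k u))). reflexivity.
    apply continuous_pairC; apply continuous_Ropp; auto. }
  set (c1 := (e / (1 + 2 * e)) ^ 2 * paraboloid_volume). set (c2 := e ^ 2 * paraboloid_volume).
  assert (Hc2 : 0 < c2) by (apply Rmult_lt_0_compat; auto; apply pow_lt; auto).
  assert (Hc12 : c2 = (1 + 2 * e) ^ 2 * c1) by (unfold c1, c2; field; lra).
  assert (Hc1 : 0 < c1) by (apply Rmult_lt_0_compat; auto; apply pow_lt; apply Rdiv_lt_0_compat; lra).
  (* [d * N1] pays for replacing [W] by [W - d], and [d * N2] for cutting [d ^ 2] off the weight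
     [|E|^2]. *)
  set (R1 := fun s t => S0 s t - d * (N1 + N2)).
  assert (cR1 : continuous2 R1).
  { intros U f g u Hf Hg. apply continuous_Rminus; auto. apply continuous_const. }
  assert (Hlow : c1 * RInt (fun s => RInt (R1 s) 0 (2 * PI)) s1 s2 <=
     RInt (fun s => RInt (fun t => RInt (fun x => RInt (fun y => H s t x y) 0 (2 * PI)) T L) 0 (2 * PI)) s1 s2).
  { rewrite <- RInt_RInt_Rmult by (auto; lra).
    apply RInt_RInt_le; auto; try lra.
    { apply (continuous2_prod (fun s t => c1 * R1 s t)). intros U f g u Hf Hg. apply continuous_Rmult; auto. apply continuous_const. }
    { apply (continuous2_prod (fun s t => RInt (fun x => RInt (fun y => H s t x y) 0 (2 * PI)) T L)).
      apply (continuous3_RInt (fun s t x => RInt (fun y => H s t x y) 0 (2 * PI))); auto.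
      apply (continuous4_RInt H); auto. lra. }
    intros s t Hs Ht.
    assert (Hz : rectangle s1 s2 0 (2 * PI) (s, t)) by (split; simpl; lra).
    assert (Hzr : Re (s, t) < 0) by (unfold Re; simpl; lra).
    assert (EE : Ec s t = E (s, t)) by (unfold Ec; rewrite clamp_eq; auto; simpl; lra).
    assert (EX : Xc s t = Re (Lm (s, t))) by (unfold Xc; rewrite clamp_eq; auto; simpl; lra).
    assert (EP : Pc s t = Phi (s, t)) by (unfold Pc; rewrite clamp_eq; auto; simpl; lra).
    specialize (HTL _ Hz). specialize (HN1b _ Hz). rewrite Rabs_pos_eq in HN1b by apply pow2_ge_0.
    assert (HN2b' := HN2b (Re (Lm (s, t)))). rewrite Rabs_pos_eq in HN2b' by auto.
    assert (Hw0 : 0 <= wt s t) by apply pos_part_ge_0.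
    assert (EH : RInt (fun x => RInt (fun y => H s t x y) 0 (2 * PI)) T L =
       wt s t * RInt (fun x => RInt (fun y => W x * bump e (Cexp (Lm (s, t) - (x, y)))) 0 (2 * PI)) T L).
    { rewrite <- RInt_RInt_Rmult. 2: lra.
      - apply RInt_ext. intros x _. apply RInt_ext. intros y _. unfold H. rewrite EP, HPL, <- Cexp_plus by auto.
        unfold Cminus. rewrite <- !Rmult_assoc, (Rmult_comm (W x)). reflexivity.
      - intros U f g u Hf Hg. apply continuous_Rmult. apply continuous_real_comp; auto.
        apply continuous_bump, continuous_Cexp, continuous_Cminus. apply continuous_const. apply continuous_pairC; auto. }
    rewrite EH.
    apply Rle_trans with (wt s t * ((W (Re (Lm (s, t))) - d) * c1)).
    - replace (wt s t * ((W (Re (Lm (s, t))) - d) * c1)) with (c1 * (wt s t * (W (Re (Lm (s, t))) - d))) by ring.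
      apply Rmult_le_compat_l. lra. unfold R1, S0. rewrite EE, EX.
      assert (A1 : Cmod (E (s, t)) ^ 2 - d ^ 2 <= wt s t). { unfold wt. rewrite EE. apply pos_part_ge. }
      assert (A2 : wt s t <= Cmod (E (s, t)) ^ 2).
      { unfold wt. rewrite EE. apply Rmax_lub. apply pow2_ge_0. generalize (pow2_ge_0 d). lra. }
      assert (A3 := HW0 (Re (Lm (s, t)))).
      assert (A4 : W (Re (Lm (s, t))) * (Cmod (E (s, t)) ^ 2 - d ^ 2) <= W (Re (Lm (s, t))) * wt s t) by (apply Rmult_le_compat_l; auto).
      assert (A5 : d * wt s t <= d * N1) by (apply Rmult_le_compat_l; lra).
      assert (A6 : W (Re (Lm (s, t))) * d ^ 2 <= N2 * d).
      { apply Rmult_le_compat; auto. apply pow2_ge_0. apply HN2b'. lra. nra. }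
      lra.
    - apply Rmult_le_compat_l; auto. apply RInt_bump_ge; auto; try lra.
      intros x Hx. assert (A := Hosc (Re (Lm (s, t))) x).
      assert (Rabs (W x - W (Re (Lm (s, t)))) <= d). { apply A; lra. }
      apply Rabs_le_between in H0. lra. }
  assert (Hupp : RInt (fun s => RInt (fun t => RInt (fun x => RInt (fun y => H s t x y) 0 (2 * PI)) T L) 0 (2 * PI)) s1 s2
     <= (1 + d) * c2 * (2 * PI * I)).
  { rewrite RInt_Fubini4; auto; try lra.
    apply Rle_trans with (RInt (fun x => RInt (fun y => ((1 + d) * c2) * W x) 0 (2 * PI)) T L).
    - apply (RInt_RInt_le (fun x y => RInt (fun s => RInt (fun t => H s t x y) 0 (2 * PI)) s1 s2)); auto; try lra.
      { apply (continuous2_prod (fun x y => RInt (fun s => RInt (fun t => H s t x y) 0 (2 * PI)) s1 s2)).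
        apply (continuous3_RInt (fun x y s => RInt (fun t => H s t x y) 0 (2 * PI))); auto.
        apply (continuous4_RInt (fun x y s t => H s t x y)); auto. lra.
        intros U f g h k u Hf Hg Hh Hk. apply cH; auto. }
      { apply (continuous2_prod (fun x y => ((1 + d) * c2) * W x)). intros U f g u Hf Hg. apply continuous_Rmult. apply continuous_const. apply continuous_real_comp; auto. }
      intros x y _ _.
      assert (cxy : continuous2 (fun s t => wt s t * bump e (Pc s t * Cexp (- (x, y))%C))).
      { intros U f g u Hf Hg. apply continuous_Rmult; auto. apply continuous_bump, continuous_Cmult.
        apply (continuous_clamp_comp (V := C_UniformSpace)); auto. apply continuous_pairC; auto. apply continuous_const. }
      assert (H2pi : 0 <= 2 * PI) by lra.
      assert (EH := RInt_RInt_Rmult (W x) _ s1 s2 0 (2 * PI) H2pi cxy).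
      unfold H. rewrite EH, Rmult_comm. apply Rmult_le_compat_r; auto.
    - right. rewrite (RInt_ext _ (fun x => ((1 + d) * c2 * (2 * PI)) * W x)).
      rewrite RInt_Rmult by auto. fold I. ring.
      intros x _. rewrite RInt_const. unfold scal; simpl; unfold mult; simpl. ring. }
  assert (ER : RInt (fun s => RInt (R1 s) 0 (2 * PI)) s1 s2 = RInt (fun s => RInt (S0 s) 0 (2 * PI)) s1 s2 - d * (N1 + N2) * Area).
  { assert (E1 : forall s, RInt (R1 s) 0 (2 * PI) = RInt (S0 s) 0 (2 * PI) - d * (N1 + N2) * (2 * PI)).
    { intros s. unfold R1. assert (cs : forall t, continuous (S0 s) t).
      { intros t. apply cS. apply continuous_const. apply continuous_id. }
      transitivity (minus (RInt (S0 s) 0 (2 * PI)) (RInt (fun _ => d * (N1 + N2)) 0 (2 * PI))).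
      apply (RInt_minus (V := R_CompleteNormedModule) (S0 s)); apply ex_RInt_cont; auto. intros; apply continuous_const.
      rewrite RInt_const. unfold minus, plus, opp, scal; simpl; unfold mult; simpl. ring. }
    transitivity (minus (RInt (fun s => RInt (S0 s) 0 (2 * PI)) s1 s2) (RInt (fun _ => d * (N1 + N2) * (2 * PI)) s1 s2)).
    - rewrite <- (RInt_minus (V := R_CompleteNormedModule)).
      + apply RInt_ext. intros s _. apply E1.
      + apply ex_RInt_cont. intros t. apply continuous2_RInt; auto. lra. apply continuous_id.
      + apply ex_RInt_cont. intros; apply continuous_const.
    - rewrite RInt_const. unfold minus, plus, opp, scal; simpl; unfold mult; simpl. unfold Area. ring. }
  assert (HJ := Rle_trans _ _ _ Hlow Hupp). rewrite ER, Hc12 in HJ.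
  replace ((1 + d) * ((1 + 2 * e) ^ 2 * c1) * (2 * PI * I)) with (c1 * ((1 + d) * (1 + 2 * e) ^ 2 * (2 * PI * I))) in HJ by ring.
  apply Rmult_le_reg_l in HJ; auto.
  assert (Hk : (1 + d) * (1 + 2 * e) ^ 2 <= 1 + 3 * d).
  { assert ((1 + 2 * e) ^ 2 <= 1 + d) by nra. nra. }
  assert (H2I : 0 <= 2 * PI * I) by (apply Rmult_le_pos; lra).
  assert ((1 + d) * (1 + 2 * e) ^ 2 * (2 * PI * I) <= (1 + 3 * d) * (2 * PI * I)) by (apply Rmult_le_compat_r; auto).
  lra. }
(* The limit [d -> 0]: a positive gap would exceed the error term [d * B] for the [d] chosen
   below. *)
apply Rnot_lt_le. intros Hlt.
set (B := 3 * (2 * PI * I) + (N1 + N2) * Area).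
assert (HB : 0 <= B).
{ apply Rplus_le_le_0_compat; apply Rmult_le_pos; try lra. apply Rmult_le_pos; [lra|exact HI]. }
set (gap := RInt (fun s => RInt (S0 s) 0 (2 * PI)) s1 s2 - 2 * PI * I).
assert (Hgap : 0 < gap) by (unfold gap; fold I in Hlt; lra).
set (d := Rmin (1 / 2) (gap / (2 * (B + 1)))).
assert (Hd : 0 < d) by (apply Rmin_pos; [lra|apply Rdiv_lt_0_compat; lra]).
assert (Hd' : d * (B + 1) <= gap / 2).
{ apply Rle_trans with (gap / (2 * (B + 1)) * (B + 1)). apply Rmult_le_compat_r. lra. apply Rmin_r. right. field. lra. }
assert (Hf := Hmain d (conj Hd (Rmin_l _ _))). fold B in Hf. unfold gap in *. nra.
Qed.

(** * Complex power series *)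

Definition cseries (u : nat -> C) : C := (Series (fun n => Re (u n)), Series (fun n => Im (u n))).

Lemma ex_series_Re u : ex_series (fun n => Cmod (u n)) -> ex_series (fun n => Re (u n)).
Proof.
intros H. apply (ex_series_le (V := R_CompleteNormedModule) _ (fun n => Cmod (u n))); auto.
intros n. exact (re_le_Cmod (u n)).
Qed.

Lemma ex_series_Im u : ex_series (fun n => Cmod (u n)) -> ex_series (fun n => Im (u n)).
Proof.
intros H. apply (ex_series_le (V := R_CompleteNormedModule) _ (fun n => Cmod (u n))); auto.
intros n. exact (im_le_Cmod (u n)).
Qed.

Lemma ex_series_Rscal (c : R) (a : nat -> R) : ex_series a -> ex_series (fun n => c * a n).
Proof. intros H. exact (ex_series_scal (V := R_NormedModule) c a H). Qed.

Lemma cseries_ext u v : (forall n, u n = v n) -> cseries u = cseries v.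
Proof. intros H. unfold cseries. f_equal; apply Series_ext; intros n; rewrite H; reflexivity. Qed.

Lemma cseries_minus u v : ex_series (fun n => Cmod (u n)) -> ex_series (fun n => Cmod (v n)) ->
  cseries (fun n => u n - v n)%C = (cseries u - cseries v)%C.
Proof.
intros Hu Hv. unfold cseries, Cminus, Cplus, Copp. simpl. f_equal.
- rewrite <- Series_opp, <- Series_plus. apply Series_ext. reflexivity. apply ex_series_Re; auto.
  apply (ex_series_opp (V := R_NormedModule)). apply ex_series_Re; auto.
- rewrite <- Series_opp, <- Series_plus. apply Series_ext. reflexivity. apply ex_series_Im; auto.
  apply (ex_series_opp (V := R_NormedModule)). apply ex_series_Im; auto.
Qed.

Lemma cseries_scal c u : ex_series (fun n => Cmod (u n)) ->
  cseries (fun n => c * u n)%C = (c * cseries u)%C.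
Proof.
intros Hu. assert (H1 := ex_series_Re u Hu). assert (H2 := ex_series_Im u Hu).
unfold cseries, Cmult. simpl. f_equal.
- rewrite <- !Series_scal_l, <- Series_minus; [reflexivity| |]; apply ex_series_Rscal; auto.
- rewrite <- !Series_scal_l, <- Series_plus; [reflexivity| |]; apply ex_series_Rscal; auto.
Qed.

Lemma Cmod_cseries_le u : ex_series (fun n => Cmod (u n)) ->
  Cmod (cseries u) <= 2 * Series (fun n => Cmod (u n)).
Proof.
intros Hu. eapply Rle_trans. apply Cmod_le_abs. unfold cseries; simpl.
assert (A : forall f : C -> R, (forall z, Rabs (f z) <= Cmod z) -> Rabs (Series (fun n => f (u n))) <= Series (fun n => Cmod (u n))).
{ intros f Hf. eapply Rle_trans. apply Series_Rabs.
  apply (ex_series_le (V := R_CompleteNormedModule) _ (fun n => Cmod (u n))); auto.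
  intros n. unfold norm; simpl. unfold abs; simpl. rewrite Rabs_Rabsolu. apply Hf.
  apply Series_le; auto. intros n. split. apply Rabs_pos. apply Hf. }
assert (A1 := A Re re_le_Cmod). assert (A2 := A Im im_le_Cmod).
change (Rabs (Series (fun n => Re (u n))) + Rabs (Series (fun n => Im (u n))) <= 2 * Series (fun n => Cmod (u n))).
lra.
Qed.

Definition absolutely_convergent_on_disk (b : nat -> C) : Prop :=
  forall r, 0 <= r < 1 -> ex_series (fun n => Cmod (b n) * r ^ n).

Definition psum (b : nat -> C) (z : C) : C := cseries (fun n => b n * z ^ n)%C.

(* Coefficients of [z d/dz]. *)
Definition euler (b : nat -> C) (n : nat) : C := (INR n * b n)%C.

Lemma ex_series_psum b z : absolutely_convergent_on_disk b -> Cmod z < 1 ->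
  ex_series (fun n => Cmod (b n * z ^ n)).
Proof.
intros H Hz. apply (ex_series_ext (fun n => Cmod (b n) * Cmod z ^ n)).
intros n. rewrite Cmod_mult, Cmod_pow. reflexivity.
apply H. split; auto. apply Cmod_ge_0.
Qed.

Lemma CV_radius_ge (a : nat -> R) r : (exists M, forall n, Rabs (a n * r ^ n) <= M) ->
  Rbar_le r (CV_radius a).
Proof. intros H. apply (proj1 (CV_radius_bounded a)). exact H. Qed.

Lemma ex_series_bounded (a : nat -> R) : ex_series a -> exists M, forall n, Rabs (a n) <= M.
Proof.
intros H. apply ex_series_lim_0 in H.
destruct (proj2 (is_lim_seq_spec a 0) H (mkposreal 1 Rlt_0_1)) as [N HN]. simpl in HN.
assert (HM : forall m, exists M, forall n, (n < m)%nat -> Rabs (a n) <= M).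
{ induction m as [|m [M IH]]. exists 0. intros n Hn. inversion Hn.
  exists (Rmax M (Rabs (a m))). intros n Hn. destruct (Nat.eq_dec n m) as [->|Hne]. apply Rmax_r.
  eapply Rle_trans; [apply IH|apply Rmax_l]. Lia.lia. }
destruct (HM N) as [M HMN]. exists (Rmax M 1). intros n. destruct (Nat.lt_ge_cases n N).
- eapply Rle_trans; [apply HMN; auto|apply Rmax_l].
- specialize (HN n H0). rewrite Rminus_0_r in HN. eapply Rle_trans; [|apply Rmax_r]. lra.
Qed.

(** Reduces complex power series to the real one of the moduli, whose radius is known to be
    unchanged by differentiation. *)
Lemma absolutely_convergent_radius b : absolutely_convergent_on_disk b <-> Rbar_le 1 (CV_radius (fun n => Cmod (b n))).
Proof.
split.
- intros H. destruct (CV_radius (fun n => Cmod (b n))) as [r| |] eqn:E; simpl; auto.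
  + apply Rnot_lt_le. intros Hr.
    assert (H0 : Rbar_le 0 (CV_radius (fun n => Cmod (b n)))) by apply CV_radius_ge_0.
    rewrite E in H0. simpl in H0.
    assert (A : Rbar_le ((r + 1) / 2) (CV_radius (fun n => Cmod (b n)))).
    { apply CV_radius_ge. apply (ex_series_bounded (fun n => Cmod (b n) * ((r + 1) / 2) ^ n)). apply H. lra. }
    rewrite E in A. simpl in A. lra.
  + assert (H0 : Rbar_le 0 (CV_radius (fun n => Cmod (b n)))) by apply CV_radius_ge_0.
    rewrite E in H0. exact H0.
- intros H r Hr. apply (ex_series_ext (fun n => Rabs (Cmod (b n) * r ^ n))).
  intros n. rewrite Rabs_pos_eq; auto. apply Rmult_le_pos. apply Cmod_ge_0. apply pow_le; lra.
  apply CV_disk_inside. eapply Rbar_lt_le_trans; [|exact H]. simpl. rewrite Rabs_pos_eq; lra.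
Qed.

Lemma absolutely_convergent_euler b : absolutely_convergent_on_disk b ->
  absolutely_convergent_on_disk (euler b).
Proof.
intros H r Hr. apply absolutely_convergent_radius in H. rewrite <- CV_radius_derive in H.
assert (A := CV_disk_inside (PS_derive (fun n => Cmod (b n))) r).
assert (B : ex_series (fun n => Rabs (PS_derive (fun n => Cmod (b n)) n * r ^ n))).
{ apply A. eapply Rbar_lt_le_trans; [|exact H]. simpl. rewrite Rabs_pos_eq; lra. }
apply ex_series_incr_1.
apply (ex_series_Rscal r) in B. eapply ex_series_ext; [|exact B].
intros n. unfold scal; simpl; unfold mult; simpl. unfold PS_derive, euler.
rewrite Cmod_mult, Cmod_R, !Rabs_mult. rewrite (Rabs_pos_eq (Cmod _)) by apply Cmod_ge_0.
rewrite (Rabs_pos_eq (r ^ n)) by (apply pow_le; lra). ring.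
Qed.

(** Induction with remainder [R_(n+1) = (z + h) R_n + n z^n h^2 / z]. Dividing by [z] keeps all
    exponents equal to [n], which suits the operator [z d/dz]. *)
Lemma pow_taylor_le (z h : C) r n : z <> RtoC 0 -> Cmod z <= r -> Cmod (z + h) <= r ->
  Cmod ((z + h) ^ n - z ^ n - INR n * z ^ n * (h / z)) <= INR n ^ 2 * r ^ n * (Cmod h ^ 2 / Cmod z ^ 2).
Proof.
intros Hz H1 H2. assert (Hz0 : 0 < Cmod z) by (apply Cmod_gt_0; auto).
induction n as [|n IH].
- replace ((z + h) ^ 0 - z ^ 0 - INR 0 * z ^ 0 * (h / z))%C with (RtoC 0) by (simpl; field; auto).
  rewrite Cmod_0. simpl. right. ring.
- set (Rn := ((z + h) ^ n - z ^ n - INR n * z ^ n * (h / z))%C) in *.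
  replace ((z + h) ^ S n - z ^ S n - INR (S n) * z ^ S n * (h / z))%C with
    ((z + h) * Rn + INR n * z ^ n * (h * h / z))%C.
  2:{ unfold Rn. rewrite S_INR, RtoC_plus. simpl. field. auto. }
  eapply Rle_trans. apply Cmod_triangle. rewrite !Cmod_mult, Cmod_R, Cmod_pow, Cmod_div by auto.
  rewrite (Rabs_pos_eq (INR n)) by apply pos_INR. rewrite Cmod_mult.
  set (k := Cmod h ^ 2 / Cmod z ^ 2) in *.
  assert (Hk : 0 <= k). { apply Rdiv_le_0_compat. apply pow2_ge_0. apply pow_lt; auto. }
  assert (E : Cmod h * Cmod h / Cmod z = Cmod z * k) by (unfold k; field; lra).
  rewrite E.
  assert (Hn := pos_INR n).
  apply Rle_trans with (r * (INR n ^ 2 * r ^ n * k) + INR n * r ^ n * (r * k)).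
  + apply Rplus_le_compat.
    * apply Rmult_le_compat; auto; apply Cmod_ge_0.
    * apply Rmult_le_compat.
      apply Rmult_le_pos; auto. apply pow_le, Cmod_ge_0.
      apply Rmult_le_pos; lra.
      apply Rmult_le_compat_l; auto. apply pow_incr. split; auto. lra.
      apply Rmult_le_compat_r; auto.
  + rewrite S_INR. simpl.
    replace ((INR n + 1) * ((INR n + 1) * 1) * (r * r ^ n) * k) with
     (r * (INR n * (INR n * 1) * r ^ n * k) + INR n * r ^ n * (r * k) + (INR n + 1) * (r * r ^ n * k)) by ring.
    assert (0 <= (INR n + 1) * (r * r ^ n * k)).
    { assert (0 <= r ^ n) by (apply pow_le; lra). apply Rmult_le_pos. lra. apply Rmult_le_pos; auto. apply Rmult_le_pos; lra. } lra.
Qed.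

(** Stated with [Cmod] alone, because [C] carries two uniform structures: round balls from the
    absolute value and squares from the product. *)
Definition complex_derivative (f : C -> C) (z l : C) : Prop :=
  forall e, 0 < e -> exists d, 0 < d /\ forall h : C, Cmod h < d -> Cmod (f (z + h)%C - f z - l * h) <= e * Cmod h.

(** Termwise Taylor expansion. The remainders are dominated by [|h|^2 / |z|^2] times
    [n^2 |b_n| r^n], with [r] halfway between [|z|] and 1, and this is summable as [euler (euler b)]
    converges absolutely at [r]. *)
Lemma complex_derivative_psum b z : absolutely_convergent_on_disk b -> Cmod z < 1 -> z <> RtoC 0 ->
  complex_derivative (psum b) z (psum (euler b) z / z).
Proof.
intros Hb Hz Hz0. assert (Hz1 : 0 < Cmod z) by (apply Cmod_gt_0; auto).
assert (Hb1 := absolutely_convergent_euler b Hb). assert (Hb2 := absolutely_convergent_euler _ Hb1).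
set (r := (1 + Cmod z) / 2). assert (Hr : Cmod z < r < 1) by (unfold r; lra).
set (A := Series (fun n => Cmod (euler (euler b) n) * r ^ n)).
assert (HA : 0 <= A).
{ replace 0 with (0 * A) by ring. unfold A. rewrite <- Series_scal_l. apply Series_le; [|apply Hb2; lra].
  intros n. assert (0 <= Cmod (euler (euler b) n) * r ^ n). { apply Rmult_le_pos. apply Cmod_ge_0. apply pow_le; lra. } lra. }
set (K := 2 * A / Cmod z ^ 2).
assert (HK : 0 <= K). { apply Rdiv_le_0_compat. lra. apply pow_lt; auto. }
assert (Hq : forall h : C, Cmod (z + h) <= r -> Cmod (psum b (z + h) - psum b z - psum (euler b) z / z * h) <= K * Cmod h ^ 2).
{ intros h Hh.
  assert (E : (psum b (z + h) - psum b z - psum (euler b) z / z * h)%C =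
     cseries (fun n => b n * ((z + h) ^ n - z ^ n - INR n * z ^ n * (h / z)))%C).
  { replace (psum (euler b) z / z * h)%C with (h / z * psum (euler b) z)%C by (field; auto).
    unfold psum. rewrite <- cseries_scal by (apply ex_series_psum; auto).
    assert (X1 : ex_series (fun n => Cmod (b n * (z + h) ^ n))) by (apply ex_series_psum; auto; lra).
    assert (X2 : ex_series (fun n => Cmod (b n * z ^ n))) by (apply ex_series_psum; auto).
    assert (X3 : ex_series (fun n => Cmod (b n * (z + h) ^ n - b n * z ^ n))).
    { eapply (ex_series_le (V := R_CompleteNormedModule) _ (fun n => Cmod (b n * (z + h) ^ n) + Cmod (b n * z ^ n))).
      + intros n. unfold norm; simpl; unfold abs; simpl. rewrite Rabs_pos_eq by apply Cmod_ge_0.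
        unfold Cminus. eapply Rle_trans. apply Cmod_triangle. rewrite Cmod_opp. lra.
      + apply (ex_series_plus (V := R_NormedModule)); auto. }
    assert (X4 : ex_series (fun n => Cmod (h / z * (euler b n * z ^ n)))).
    { eapply ex_series_ext. intros n. symmetry. apply Cmod_mult.
      apply ex_series_Rscal. apply ex_series_psum; auto. }
    rewrite <- !cseries_minus; auto.
    apply cseries_ext. intros n. unfold euler. field. auto. }
  rewrite E.
  set (k := Cmod h ^ 2 / Cmod z ^ 2).
  assert (Hle : forall n, 0 <= Cmod (b n * ((z + h) ^ n - z ^ n - INR n * z ^ n * (h / z))) <= k * (Cmod (euler (euler b) n) * r ^ n)).
  { intros n. split. apply Cmod_ge_0. rewrite Cmod_mult.
    eapply Rle_trans. apply Rmult_le_compat_l. apply Cmod_ge_0. apply (pow_taylor_le z h r n); auto. lra.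
    right. unfold euler. rewrite !Cmod_mult, Cmod_R, (Rabs_pos_eq (INR n)) by apply pos_INR. fold k. ring. }
  assert (Hex : ex_series (fun n => k * (Cmod (euler (euler b) n) * r ^ n))).
  { apply ex_series_Rscal. apply Hb2. lra. }
  eapply Rle_trans. apply Cmod_cseries_le.
  - apply (ex_series_le (V := R_CompleteNormedModule) _ (fun n => k * (Cmod (euler (euler b) n) * r ^ n))); auto.
    intros n. unfold norm; simpl; unfold abs; simpl. rewrite Rabs_pos_eq by apply Cmod_ge_0. apply Hle.
  - apply Rle_trans with (2 * (k * A)). apply Rmult_le_compat_l. lra.
    unfold A. rewrite <- Series_scal_l. apply Series_le; auto.
    right. unfold K, k. field. lra. }
intros e He. exists (Rmin (r - Cmod z) (e / (K + 1))). split.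
{ apply Rmin_pos. lra. apply Rdiv_lt_0_compat; lra. }
intros h Hh. assert (H1 := Rlt_le_trans _ _ _ Hh (Rmin_l _ _)). assert (H2 := Rlt_le_trans _ _ _ Hh (Rmin_r _ _)).
eapply Rle_trans. apply Hq. eapply Rle_trans. apply Cmod_triangle. lra.
replace (K * Cmod h ^ 2) with ((K * Cmod h) * Cmod h) by ring.
apply Rmult_le_compat_r. apply Cmod_ge_0.
apply Rle_trans with ((K + 1) * (e / (K + 1))).
apply Rmult_le_compat; try lra. apply Cmod_ge_0. right. field. lra.
Qed.

(** * Complex differentiability and real derivatives along curves *)

Lemma complex_derivative_is_derive (f : C -> C) (z l : C) :
  @is_derive C_AbsRing C_NormedModule f z l -> complex_derivative f z l.
Proof.
intros [_ H] e He. specialize (H z (fun P HP => HP) (mkposreal e He)).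
destruct H as [d Hd]. exists d. split. apply cond_pos. intros h Hh.
assert (E : (z + h - z)%C = h) by ring.
assert (A : ball (M := AbsRing_UniformSpace C_AbsRing) z d (z + h)%C).
{ change (Cmod (z + h - z) < d). rewrite E. exact Hh. }
assert (B : Cmod (f (z + h)%C - f z - (z + h - z) * l) <= e * Cmod (z + h - z)) by exact (Hd _ A).
rewrite E in B. rewrite (Cmult_comm l h). exact B.
Qed.

Lemma complex_derivative_continuous (f : C -> C) z l : complex_derivative f z l ->
  continuous_CC f z.
Proof.
intros H. apply filterlim_locally. intros [e He].
destruct (H 1 Rlt_0_1) as [d [Hd Hd']].
set (m := Cmod l + 1). assert (Hm : 0 < m) by (generalize (Cmod_ge_0 l); unfold m; lra).
assert (Hr : 0 < Rmin d (e / m) / 2).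
{ assert (0 < Rmin d (e / m)). apply Rmin_pos; auto. apply Rdiv_lt_0_compat; auto. lra. }
exists (mkposreal _ Hr). intros y Hy. change C in y. apply Cmod_of_ball in Hy. simpl in Hy.
apply ball_of_Cmod. simpl.
set (h := (y - z)%C) in *. assert (Hh : Cmod h < Rmin d (e / m)) by lra.
assert (H1 := Rlt_le_trans _ _ _ Hh (Rmin_l _ _)). assert (H2 := Rlt_le_trans _ _ _ Hh (Rmin_r _ _)).
specialize (Hd' h H1). replace (z + h)%C with y in Hd' by (unfold h; ring).
assert (A := Cmod_le_plus (f y - f z) (l * h)). rewrite Cmod_mult in A.
apply Rle_lt_trans with (m * Cmod h). unfold m. lra.
apply Rlt_le_trans with (m * (e / m)). apply Rmult_lt_compat_l; auto. right. field. lra.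
Qed.

Lemma is_derive_eps (f : R -> R) t l :
  is_derive f t l <-> (forall e, 0 < e -> exists d, 0 < d /\ forall h, Rabs h < d -> Rabs (f (t + h) - f t - l * h) <= e * Rabs h).
Proof.
split.
- intros [_ H] e He. specialize (H t (fun P HP => HP) (mkposreal e He)).
  destruct H as [d Hd]. exists d. split. apply cond_pos. intros h Hh.
  specialize (Hd (t + h)). unfold minus, plus, opp, scal, norm in Hd; simpl in Hd. unfold mult, abs in Hd; simpl in Hd.
  replace (t + h + - t) with h in Hd by ring.
  replace (f (t + h) - f t - l * h) with (f (t + h) + - f t + - (h * l)) by ring. apply Hd.
  unfold ball; simpl. unfold AbsRing_ball, abs, minus, plus, opp; simpl. replace (t + h + - t) with h by ring. exact Hh.
- intros H. split. apply is_linear_scal_l.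
  intros x Hx. assert (E : t = x) by (apply (is_filter_lim_locally_unique (K := R_AbsRing) (V := R_NormedModule)); exact Hx).
  subst x. intros [e He]. destruct (H e He) as [d [Hd Hd']]. exists (mkposreal d Hd). intros y Hy. change R in y.
  unfold ball in Hy; simpl in Hy. unfold AbsRing_ball, abs, minus, plus, opp in Hy; simpl in Hy.
  specialize (Hd' (y + - t) Hy). unfold minus, plus, opp, scal, norm; simpl. unfold mult, abs; simpl.
  replace (t + (y + - t)) with y in Hd' by ring.
  replace (f y + - f t + - ((y + - t) * l)) with (f y - f t - l * (y + - t)) by ring. exact Hd'.
Qed.

Lemma complex_chain (f : C -> C) (x y : R -> R) t l x' y' :
  complex_derivative f (x t, y t) l -> is_derive x t x' -> is_derive y t y' ->
  is_derive (fun t => Re (f (x t, y t))) t (Re (l * (x', y'))) /\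
  is_derive (fun t => Im (f (x t, y t))) t (Im (l * (x', y'))).
Proof.
intros Hf Hx Hy.
assert (Hx' := proj1 (is_derive_eps x t x') Hx). assert (Hy' := proj1 (is_derive_eps y t y') Hy).
(* [N * |h|] bounds the increment of the curve: [|w| |h|] from its velocity, and at most [2 * |h|]
   from the errors of the two coordinates since [e1 <= 1]. *)
set (w := (x', y') : C). set (N := Cmod w + 2). assert (HN : 2 <= N) by (generalize (Cmod_ge_0 w); unfold N; lra).
set (m := Cmod l). assert (Hm := Cmod_ge_0 l). fold m in Hm.
assert (HH : forall e, 0 < e -> exists d, 0 < d /\ forall h, Rabs h < d ->
  Cmod (f (x (t + h), y (t + h)) - f (x t, y t) - RtoC h * (l * w)) <= e * Rabs h).
{ intros e He.
  set (e1 := Rmin 1 (e / (4 * (m + 1)))). assert (He1 : 0 < e1). { apply Rmin_pos. lra. apply Rdiv_lt_0_compat; lra. }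
  assert (He1' : e1 <= 1) by apply Rmin_l.
  assert (He1'' : 2 * (m * e1) <= e / 2).
  { apply Rle_trans with (2 * ((m + 1) * (e / (4 * (m + 1))))). 2: right; field; lra.
    apply Rmult_le_compat_l. lra. apply Rmult_le_compat; try lra. apply Rmin_r. }
  destruct (Hf (e / (2 * N))) as [d0 [Hd0 H0]]. apply Rdiv_lt_0_compat; lra.
  destruct (Hx' e1 He1) as [d1 [Hd1 H1]]. destruct (Hy' e1 He1) as [d2 [Hd2 H2]].
  exists (Rmin (d0 / N) (Rmin d1 d2)). split. repeat apply Rmin_pos; auto. apply Rdiv_lt_0_compat; lra.
  intros h Hh.
  assert (A0 : Rabs h < d0 / N) by (eapply Rlt_le_trans; [exact Hh|apply Rmin_l]).
  assert (A1 : Rabs h < d1) by (eapply Rlt_le_trans; [exact Hh|eapply Rle_trans; [apply Rmin_r|apply Rmin_l]]).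
  assert (A2 : Rabs h < d2) by (eapply Rlt_le_trans; [exact Hh|eapply Rle_trans; [apply Rmin_r|apply Rmin_r]]).
  specialize (H1 h A1). specialize (H2 h A2).
  set (k := (x (t + h) - x t, y (t + h) - y t) : C).
  assert (Hk : Cmod (k - RtoC h * w) <= 2 * e1 * Rabs h).
  { eapply Rle_trans. apply Cmod_le_abs. unfold k, w, Re, Im; simpl.
    replace (x (t + h) - x t + - (h * x' - 0 * y')) with (x (t + h) - x t - x' * h) by ring.
    replace (y (t + h) - y t + - (h * y' + 0 * x')) with (y (t + h) - y t - y' * h) by ring. lra. }
  assert (Hh0 := Rabs_pos h).
  assert (Hk2 : Cmod k <= N * Rabs h).
  { eapply Rle_trans. apply (Cmod_le_plus k (RtoC h * w)). rewrite Cmod_mult, Cmod_R. unfold N. nra. }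
  assert (Hk3 : Cmod k < d0).
  { eapply Rle_lt_trans. exact Hk2. apply Rlt_le_trans with (N * (d0 / N)). apply Rmult_lt_compat_l; lra. right; field; lra. }
  specialize (H0 k Hk3).
  replace ((x t, y t) + k)%C with (x (t + h), y (t + h)) in H0 by (unfold k, Cplus; simpl; f_equal; ring).
  set (Q := f (x (t + h), y (t + h))) in *.
  replace (Q - f (x t, y t) - RtoC h * (l * w))%C with
   ((Q - f (x t, y t) - l * k) + l * (k - RtoC h * w))%C by ring.
  eapply Rle_trans. apply Cmod_triangle. rewrite Cmod_mult. fold m.
  assert (B1 : e / (2 * N) * Cmod k <= e / 2 * Rabs h).
  { apply Rle_trans with (e / (2 * N) * (N * Rabs h)). apply Rmult_le_compat_l; auto. left. apply Rdiv_lt_0_compat; lra. right. field. lra. }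
  assert (B2 : m * Cmod (k - RtoC h * w) <= m * (2 * e1 * Rabs h)) by (apply Rmult_le_compat_l; auto).
  assert (B3 : m * (2 * e1 * Rabs h) <= e / 2 * Rabs h).
  { replace (m * (2 * e1 * Rabs h)) with (2 * (m * e1) * Rabs h) by ring. apply Rmult_le_compat_r; auto. }
  lra. }
split; apply is_derive_eps; intros e He; destruct (HH e He) as [d [Hd H]]; exists d; split; auto; intros h Hh; specialize (H h Hh).
- eapply Rle_trans; [|exact H]. eapply Rle_trans; [|apply re_le_Cmod]. right. f_equal.
  unfold Re; simpl. ring.
- eapply Rle_trans; [|exact H]. eapply Rle_trans; [|apply im_le_Cmod]. right. f_equal.
  unfold Im; simpl. ring.
Qed.

(** * The flux through vertical lines *)

Lemma locally_left_half_plane (z : C) : Re z < 0 -> locally (T := C_UniformSpace) z (fun w => Re w < 0).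
Proof.
intros H. assert (Hp : 0 < - Re z) by lra. exists (mkposreal _ Hp). intros w [Hw _].
change (Rabs (Re w - Re z) < - Re z) in Hw. apply Rabs_lt_between in Hw. change (Re w < 0). lra.
Qed.

Lemma locally_neg (s : R) : s < 0 -> locally s (fun x => x < 0).
Proof.
intros H. assert (Hp : 0 < - s) by lra. exists (mkposreal _ Hp). intros w Hw.
change (Rabs (w - s) < - s) in Hw. apply Rabs_lt_between in Hw. lra.
Qed.

Lemma continuous_slice (F : C -> R) s t : s < 0 ->
  (forall z, Re z < 0 -> continuous_on_C F z) -> continuous (fun t => F (s, t)) t.
Proof.
intros Hs H. apply (continuous_comp (V := C_UniformSpace) (fun t => (s, t)) F).
apply continuous_pairC. apply continuous_const. apply continuous_id. apply H. exact Hs.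
Qed.

(** Green's theorem in the strip. By Cauchy-Riemann, [k (X) E1] has [s]-derivative [W E1^2 + k D]
    and [- k (X) E2] has [t]-derivative [W E2^2 - k D]. The latter integrates to 0 over a period, so
    adding it cancels [k D] and leaves [W |E|^2]. *)
Lemma flux_identity (X E1 E2 D : C -> R) (k W : R -> R) :
  (forall z, Re z < 0 -> continuous_on_C X z) ->
  (forall z, Re z < 0 -> continuous_on_C E1 z) ->
  (forall z, Re z < 0 -> continuous_on_C E2 z) ->
  (forall z, Re z < 0 -> continuous_on_C D z) ->
  (forall s t, s < 0 -> is_derive (fun s => X (s, t)) s (E1 (s, t))) ->
  (forall s t, s < 0 -> is_derive (fun t => X (s, t)) t (- E2 (s, t))) ->
  (forall s t, s < 0 -> is_derive (fun s => E1 (s, t)) s (D (s, t))) ->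
  (forall s t, s < 0 -> is_derive (fun t => E2 (s, t)) t (D (s, t))) ->
  (forall s, X (s, 2 * PI) = X (s, 0)) -> (forall s, E2 (s, 2 * PI) = E2 (s, 0)) ->
  (forall x, is_derive k x (W x)) -> (forall x, continuous W x) ->
  forall s1 s2, s1 <= s2 -> s2 < 0 ->
  RInt (fun t => k (X (s2, t)) * E1 (s2, t)) 0 (2 * PI) - RInt (fun t => k (X (s1, t)) * E1 (s1, t)) 0 (2 * PI) =
  RInt (fun s => RInt (fun t => W (X (s, t)) * (E1 (s, t) ^ 2 + E2 (s, t) ^ 2)) 0 (2 * PI)) s1 s2.
Proof.
intros cX cE1 cE2 cD dXs dXt dE1 dE2 pX pE2 dk cW.
assert (HPI := PI2_1).
assert (ck : forall x, continuous k x).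
{ intros x. apply (ex_derive_continuous (V := R_NormedModule)). eexists; apply dk. }
set (DA := fun z => W (X z) * E1 z ^ 2 + k (X z) * D z).
set (DB := fun z => W (X z) * E2 z ^ 2 - k (X z) * D z).
set (F := fun z => W (X z) * (E1 z ^ 2 + E2 z ^ 2)).
assert (cDA : forall z, Re z < 0 -> continuous_on_C DA z).
{ intros z Hz. apply continuous_Rplus; apply continuous_Rmult; auto.
  apply continuous_real_comp; auto. apply continuous_pow; auto. apply continuous_real_comp; auto. }
assert (cDB : forall z, Re z < 0 -> continuous_on_C DB z).
{ intros z Hz. apply continuous_Rminus; apply continuous_Rmult; auto.
  apply continuous_real_comp; auto. apply continuous_pow; auto. apply continuous_real_comp; auto. }
assert (cF : forall z, Re z < 0 -> continuous_on_C F z).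
{ intros z Hz. apply continuous_Rmult. apply continuous_real_comp; auto. apply continuous_Rplus; apply continuous_pow; auto. }
assert (dA : forall s t, s < 0 -> is_derive (fun s => k (X (s, t)) * E1 (s, t)) s (DA (s, t))).
{ intros s t Hs.
  assert (A := is_derive_comp k (fun s => X (s, t)) s _ _ (dk _) (dXs s t Hs)).
  assert (B := is_derive_mult (K := R_AbsRing) _ _ s _ _ A (dE1 s t Hs) Rmult_comm).
  replace (DA (s, t)) with (plus (mult (scal (E1 (s, t)) (W (X (s, t)))) (E1 (s, t))) (mult (k (X (s, t))) (D (s, t)))).
  exact B. unfold DA, plus, mult, scal; simpl; unfold mult; simpl. ring. }
assert (dB : forall s t, s < 0 -> is_derive (fun t => - (k (X (s, t)) * E2 (s, t))) t (DB (s, t))).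
{ intros s t Hs.
  assert (A := is_derive_comp k (fun t => X (s, t)) t _ _ (dk _) (dXt s t Hs)).
  assert (B := is_derive_mult (K := R_AbsRing) _ _ t _ _ A (dE2 s t Hs) Rmult_comm).
  replace (DB (s, t)) with (opp (plus (mult (scal (- E2 (s, t)) (W (X (s, t)))) (E2 (s, t))) (mult (k (X (s, t))) (D (s, t))))).
  apply (is_derive_opp (V := R_NormedModule)). exact B.
  unfold DB, opp, plus, mult, scal; simpl; unfold mult; simpl. ring. }
assert (dV : forall s, s < 0 -> is_derive (fun s => RInt (fun t => k (X (s, t)) * E1 (s, t)) 0 (2 * PI)) s
   (RInt (fun t => F (s, t)) 0 (2 * PI))).
{ intros s Hs.
  assert (EQ : RInt (fun t => F (s, t)) 0 (2 * PI) =
    RInt (fun t => Derive (fun u => k (X (u, t)) * E1 (u, t)) s) 0 (2 * PI)).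
  { transitivity (RInt (fun t => DA (s, t)) 0 (2 * PI)).
    2:{ apply RInt_ext. intros t _. symmetry. apply is_derive_unique. auto. }
    assert (IB := is_RInt_derive (V := R_CompleteNormedModule) (fun t => - (k (X (s, t)) * E2 (s, t))) (fun t => DB (s, t)) 0 (2 * PI)
       (fun t _ => dB s t Hs) (fun t _ => continuous_slice DB s t Hs cDB)).
    apply is_RInt_unique in IB.
    assert (EP : RInt (fun t => DA (s, t) + DB (s, t)) 0 (2 * PI) = RInt (fun t => DA (s, t)) 0 (2 * PI) + RInt (fun t => DB (s, t)) 0 (2 * PI)).
    { apply (RInt_plus (V := R_CompleteNormedModule)); apply ex_RInt_cont; intros t; apply continuous_slice; auto. }
    transitivity (RInt (fun t => DA (s, t) + DB (s, t)) 0 (2 * PI)).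
    { apply RInt_ext. intros t _. unfold F, DA, DB. set (w := W (X (s, t))).
      change (w * (E1 (s, t) ^ 2 + E2 (s, t) ^ 2) = w * E1 (s, t) ^ 2 + k (X (s, t)) * D (s, t) + (w * E2 (s, t) ^ 2 - k (X (s, t)) * D (s, t))). ring. }
    rewrite EP, IB, pX, pE2. unfold minus, plus, opp; simpl. ring. }
  rewrite EQ. apply (is_derive_RInt_param (fun s t => k (X (s, t)) * E1 (s, t))).
  - destruct (locally_neg s Hs) as [d Hd]. exists d. intros u Hu t _. eexists. apply dA. apply Hd. exact Hu.
  - intros t _. apply continuity_2d_pt_filterlim.
    (* The identification of [Derive] with [DA] holds only for negative abscissae, hence an
       extension argument local at [(s, t)]. *)
    apply (continuous_ext_loc (T := C_UniformSpace) (U := R_UniformSpace)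
      (fun z : C => Derive (fun u => k (X (u, snd z)) * E1 (u, snd z)) (fst z)) DA (s, t)).
    + destruct (locally_left_half_plane (s, t) Hs) as [d Hd]. exists d. intros u Hu.
      symmetry. apply is_derive_unique. destruct u as [u v]. apply dA. apply (Hd (u, v) Hu).
    + apply cDA. exact Hs.
  - destruct (locally_neg s Hs) as [d Hd]. exists d. intros u Hu. apply ex_RInt_cont.
    intros t. apply (continuous_slice (fun z => k (X z) * E1 z)). apply Hd; exact Hu.
    intros z Hz. apply continuous_Rmult; auto. apply continuous_real_comp; auto. }
intros s1 s2 H12 Hs2.
set (Fc := fun s t => F (clamp (s2 / 2) (s, t))).
assert (cFc : continuous2 Fc).
{ intros U f g u Hf Hg. apply (continuous_clamp_comp (V := R_UniformSpace)); auto. lra. apply continuous_pairC; auto. }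
assert (EF : forall s, s <= s2 -> RInt (fun t => F (s, t)) 0 (2 * PI) = RInt (Fc s) 0 (2 * PI)).
{ intros s Hs. apply RInt_ext. intros t _. unfold Fc. rewrite clamp_eq; auto. simpl. lra. }
transitivity (RInt (fun s => RInt (Fc s) 0 (2 * PI)) s1 s2).
2:{ apply RInt_ext. intros s Hs. rewrite Rmin_left, Rmax_right in Hs by lra. symmetry. apply EF. lra. }
symmetry. apply is_RInt_unique.
apply (is_RInt_derive (V := R_CompleteNormedModule) (fun s => RInt (fun t => k (X (s, t)) * E1 (s, t)) 0 (2 * PI))).
- intros s Hs. rewrite Rmin_left, Rmax_right in Hs by lra. rewrite <- EF by lra. apply dV. lra.
- intros s _. apply continuous2_RInt; auto. lra. apply continuous_id.
Qed.

(** For [s1] far to the left, [V s2] is [V s1], at most [2 pi k T (1 - e)], plus an area term of at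
    most [- 2 pi k T]. Hence [V s2 <= - 2 pi e k T], and [e] is arbitrarily small. *)
Lemma flux_nonneg (Phi E Lm : C -> C) (D : C -> R) (lambda s2 : R) :
  0 < lambda -> s2 < 0 ->
  half_plane_derivative Phi (fun z => Phi z * E z)%C ->
  (forall z, Re z < 0 -> continuous_CC Phi z) ->
  (forall z, Re z < 0 -> continuous_CC E z) ->
  (forall z, Re z < 0 -> continuous_on_C (fun z => Re (Lm z)) z) ->
  (forall z, Re z < 0 -> continuous_on_C D z) ->
  (forall z, Re z < 0 -> Phi z = Cexp (Lm z)) ->
  (forall s t, Phi (s, t + 2 * PI) = Phi (s, t)) ->
  (forall s t, E (s, t + 2 * PI) = E (s, t)) ->
  (forall s t, Re (Lm (s, t + 2 * PI)) = Re (Lm (s, t))) ->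
  (forall z w, Re z < 0 -> Re w < 0 -> Rabs (snd w - snd z) <= PI -> Phi z = Phi w -> z = w) ->
  (forall s t, s < 0 -> is_derive (fun s => Re (Lm (s, t))) s (Re (E (s, t)))) ->
  (forall s t, s < 0 -> is_derive (fun t => Re (Lm (s, t))) t (- Im (E (s, t)))) ->
  (forall s t, s < 0 -> is_derive (fun s => Re (E (s, t))) s (D (s, t))) ->
  (forall s t, s < 0 -> is_derive (fun t => Im (E (s, t))) t (D (s, t))) ->
  (forall e, 0 < e -> exists s0, forall s t, s <= s0 -> Rabs (Re (E (s, t)) - 1) <= e) ->
  (forall T, exists s0, forall s t, s <= s0 -> Re (Lm (s, t)) <= T) ->
  0 <= RInt (fun t => exp (- (2 * lambda * Re (Lm (s2, t)))) * Re (E (s2, t))) 0 (2 * PI).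
Proof.
intros Hl Hs2 HD cP cE cX cD HPL pP pE pX Hinj dXs dXt dE1 dE2 HE1 HXm.
assert (HPI := PI2_1).
set (X := fun z => Re (Lm z)) in *.
destruct (gauge_compact_bounded (U := R_UniformSpace) (fun t => 0 <= t <= 2 * PI) (fun t => X (s2, t)) (gauge_compact_interval _ _)) as [M0 [HM0 HM0b]].
{ intros t _. apply (continuous_slice X); auto. }
set (T := - M0 - 1).
assert (HT : forall t, 0 <= t <= 2 * PI -> T + 1 <= X (s2, t)).
{ intros t Ht. specialize (HM0b t Ht). cbv beta in HM0b. apply Rabs_le_between in HM0b. unfold T. eapply Rle_trans; [|apply HM0b]. right; ring. }
set (W := fun x => 4 * lambda ^ 2 * exp (- (2 * lambda * x)) * Rmin 1 (pos_part (x - T))).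
assert (cW : forall x, continuous W x).
{ intros x. apply continuous_Rmult. apply continuous_Rmult. apply continuous_const.
  apply (continuous_real_comp exp). apply continuous_exp. apply continuous_Ropp, continuous_Rmult. apply continuous_const. apply continuous_id.
  apply continuous_Rmin. apply continuous_const. apply continuous_pos_part, continuous_Rminus. apply continuous_id. apply continuous_const. }
assert (HW0 : forall x, 0 <= W x).
{ intros x. apply Rmult_le_pos. apply Rmult_le_pos. clear - Hl. nra. left; apply exp_pos.
  apply Rmin_glb. lra. apply pos_part_ge_0. }
set (k := fun x => - (2 * lambda * exp (- (2 * lambda * (T + 1)))) + RInt W (T + 1) x).
assert (dk : forall x, is_derive k x (W x)).
{ intros x. replace (W x) with (0 + W x) by apply Rplus_0_l.
  apply (is_derive_plus (V := R_NormedModule) (fun _ => - (2 * lambda * exp (- (2 * lambda * (T + 1))))) (fun x => RInt W (T + 1) x) x 0 (W x)).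
  exact (is_derive_const (V := R_NormedModule) _ x).
  apply (is_derive_RInt (V := R_NormedModule) W _ (T + 1)); auto.
  exists (mkposreal 1 Rlt_0_1). intros y _. apply (RInt_correct (V := R_CompleteNormedModule)). apply ex_RInt_cont; auto. }
assert (kdiff : forall a b, RInt W a b = k b - k a).
{ intros a b.
  assert (A : RInt W (T + 1) a + RInt W a b = RInt W (T + 1) b).
  { apply (RInt_Chasles (V := R_CompleteNormedModule)); apply ex_RInt_cont; auto. }
  unfold k. lra. }
assert (kright : forall x, T + 1 <= x -> k x = - (2 * lambda * exp (- (2 * lambda * x)))).
{ intros x Hx. unfold k.
  assert (A : is_RInt (fun x => 4 * lambda ^ 2 * exp (- (2 * lambda * x))) (T + 1) x
    (minus (- (2 * lambda * exp (- (2 * lambda * x)))) (- (2 * lambda * exp (- (2 * lambda * (T + 1))))))).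
  { apply (is_RInt_derive (V := R_CompleteNormedModule) (fun x => - (2 * lambda * exp (- (2 * lambda * x))))).
    - intros y _. auto_derive; auto. ring.
    - intros y _. apply continuous_Rmult. apply continuous_const.
      apply (continuous_real_comp exp). apply continuous_exp. apply continuous_Ropp, continuous_Rmult. apply continuous_const. apply continuous_id. }
  apply (is_RInt_unique (V := R_CompleteNormedModule)) in A.
  rewrite (RInt_ext W (fun x => 4 * lambda ^ 2 * exp (- (2 * lambda * x)))), A.
  unfold minus, plus, opp; simpl. lra.
  intros y Hy. rewrite Rmin_left, Rmax_right in Hy by lra. unfold W.
  rewrite pos_part_eq by lra. rewrite Rmin_left by lra. apply Rmult_1_r. }
assert (kmono : forall a b, a <= b -> k a <= k b).
{ intros a b Hab. assert (0 <= RInt W a b). { apply RInt_ge_0; auto. apply ex_RInt_cont; auto. }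
  rewrite kdiff in H. lra. }
(* [k] increases to values of the form [- 2 lambda exp (- 2 lambda x)]; therefore its total increase
   is at most [- k T]. *)
assert (kneg : forall x, k x <= 0).
{ intros x. apply Rle_trans with (k (Rmax x (T + 1))). apply kmono, Rmax_l.
  rewrite kright by apply Rmax_r. generalize (exp_pos (- (2 * lambda * Rmax x (T + 1)))). nra. }
assert (kleft : forall x, x <= T -> k x = k T).
{ intros x Hx. assert (A := kdiff x T). rewrite (RInt_ext W (fun _ => 0)) in A.
  rewrite RInt_const in A. unfold scal in A; simpl in A; unfold mult in A; simpl in A. lra.
  intros y Hy. rewrite Rmin_left, Rmax_right in Hy by lra. unfold W. rewrite pos_part_eq_0 by lra.
  rewrite Rmin_right by lra. apply Rmult_0_r. }
assert (cE1 : forall z, Re z < 0 -> continuous_on_C (fun z => Re (E z)) z) by (intros; apply continuous_Re; auto).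
assert (cE2 : forall z, Re z < 0 -> continuous_on_C (fun z => Im (E z)) z) by (intros; apply continuous_Im; auto).
assert (pX0 : forall s, X (s, 2 * PI) = X (s, 0)).
{ intros s. rewrite <- (Rplus_0_l (2 * PI)) at 1. apply pX. }
assert (pE20 : forall s, Im (E (s, 2 * PI)) = Im (E (s, 0))).
{ intros s. rewrite <- (Rplus_0_l (2 * PI)) at 1. rewrite pE. reflexivity. }
set (V := fun s => RInt (fun t => k (X (s, t)) * Re (E (s, t))) 0 (2 * PI)).
assert (HV : forall e, 0 < e <= 1 -> V s2 <= - k T * (2 * PI) * e).
{ intros e He.
  destruct (HE1 e (proj1 He)) as [sa Ha]. destruct (HXm T) as [sb Hb].
  set (s1 := Rmin s2 (Rmin sa sb)).
  assert (H12 : s1 <= s2) by apply Rmin_l.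
  assert (H1a : s1 <= sa) by (eapply Rle_trans; [apply Rmin_r|apply Rmin_l]).
  assert (H1b : s1 <= sb) by (eapply Rle_trans; [apply Rmin_r|apply Rmin_r]).
  assert (Hfl := flux_identity X (fun z => Re (E z)) (fun z => Im (E z)) D k W cX cE1 cE2 cD dXs dXt dE1 dE2 pX0 pE20 dk cW s1 s2 H12 Hs2).
  destruct (gauge_compact_bounded (U := C_UniformSpace) (rectangle s1 s2 0 (2 * PI)) X (gauge_compact_rectangle _ _ _ _)) as [M [HM HMb]].
  { intros z [Hz _]. apply cX. unfold Re. lra. }
  (* The bounds enclose the values of [X] with the margin 1 required, and also lie outside the ramp:
     [k] equals [k T] at the left one and is at most 0 at the right one. *)
  assert (Har := area_inequality Phi E Lm W s1 s2 (Rmin T (- M - 1)) (Rmax (T + 1) (M + 1)) HD H12 Hs2 cP cE cX HPL pP pE Hinj cW HW0).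
  rewrite kdiff in Har.
  assert (Hk1 : k (Rmin T (- M - 1)) = k T) by (apply kleft, Rmin_l).
  assert (Hk2 := kneg (Rmax (T + 1) (M + 1))).
  assert (Hint : RInt (fun s => RInt (fun t => W (X (s, t)) * (Re (E (s, t)) ^ 2 + Im (E (s, t)) ^ 2)) 0 (2 * PI)) s1 s2 <= - k T * (2 * PI)).
  { eapply Rle_trans. 2: apply Rle_trans with (2 * PI * (k (Rmax (T + 1) (M + 1)) - k (Rmin T (- M - 1)))).
    2:{ apply Har. intros z Hz. specialize (HMb z Hz). apply Rabs_le_between in HMb. change (Re (Lm z)) with (X z).
      generalize (Rmin_r T (- M - 1)) (Rmax_r (T + 1) (M + 1)). lra. }
    right. apply RInt_ext. intros s _. apply RInt_ext. intros t _. rewrite Cmod2_alt. reflexivity.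
    rewrite Hk1. replace (- k T * (2 * PI)) with (2 * PI * (0 - k T)) by ring. apply Rmult_le_compat_l; lra. }
  assert (Hs1 : V s1 <= k T * (2 * PI) * (1 - e)).
  { unfold V. apply Rle_trans with (RInt (fun _ => k T * (1 - e)) 0 (2 * PI)).
    - apply RInt_le. lra.
      apply ex_RInt_cont. intros t. apply (continuous_slice (fun z => k (X z) * Re (E z))). lra.
      intros z Hz. apply continuous_Rmult; auto. apply continuous_real_comp; auto.
      apply (ex_derive_continuous (V := R_NormedModule)). eexists; apply dk.
      apply ex_RInt_cont; intros; apply continuous_const.
      intros t _. rewrite kleft by (apply Hb; auto). specialize (Ha s1 t H1a). apply Rabs_le_between in Ha.
      specialize (kneg T). nra.
    - right. rewrite RInt_const. unfold scal; simpl; unfold mult; simpl. ring. }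
  unfold V in *. lra. }
assert (HVneg : V s2 <= 0).
{ apply Rnot_lt_le. intros Hp.
  set (B := - k T * (2 * PI)) in *. assert (HB : 0 <= B). { apply Rmult_le_pos. specialize (kneg T). lra. lra. }
  set (e := Rmin 1 (V s2 / (2 * (B + 1)))).
  assert (He : 0 < e) by (apply Rmin_pos; [lra|apply Rdiv_lt_0_compat; lra]).
  assert (A := HV e (conj He (Rmin_l _ _))).
  assert (B * e <= V s2 / 2).
  { apply Rle_trans with ((B + 1) * (V s2 / (2 * (B + 1)))). apply Rmult_le_compat; try lra. apply Rmin_r. right. field. lra. }
  lra. }
assert (EV : V s2 = - (2 * lambda) * RInt (fun t => exp (- (2 * lambda * Re (Lm (s2, t)))) * Re (E (s2, t))) 0 (2 * PI)).
{ unfold V. rewrite <- RInt_Rmult.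
  - apply RInt_ext. intros t Ht. rewrite Rmin_left, Rmax_right in Ht by lra. rewrite kright by (apply HT; lra).
    change (X (s2, t)) with (Re (Lm (s2, t))). set (w := exp _).
    change (- (2 * lambda * w) * Re (E (s2, t)) = - (2 * lambda) * (w * Re (E (s2, t)))). ring.
  - intros t. apply (continuous_slice (fun z => exp (- (2 * lambda * Re (Lm z))) * Re (E z))); auto.
    intros z Hz. apply continuous_Rmult; auto. apply (continuous_real_comp exp). apply continuous_exp.
    apply continuous_Ropp, continuous_Rmult. apply continuous_const. apply cX; auto. }
rewrite EV in HVneg. nra.
Qed.

(** * Parseval's identity *)

Fixpoint partial_psum (p : nat -> C) (z : C) (N : nat) : C :=
  match N with
  | O => (p O * z ^ 0)%C
  | S n => (partial_psum p z n + p (S n) * z ^ S n)%C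
  end.

Lemma partial_psum_S p z n :
  partial_psum p z (S n) = (partial_psum p z n + p (S n) * z ^ S n)%C.
Proof. reflexivity. Qed.

Lemma cseries_incr_1 u : ex_series (fun n => Cmod (u n)) ->
  cseries u = (u O + cseries (fun n => u (S n)))%C.
Proof.
intros H. unfold cseries, Cplus; simpl. f_equal.
- apply (Series_incr_1 (fun n => Re (u n))). apply ex_series_Re; auto.
- apply (Series_incr_1 (fun n => Im (u n))). apply ex_series_Im; auto.
Qed.

(** The bound depends on [z] through [Cmod z] only, so partial sums converge uniformly on
    circles. *)
Lemma Cmod_psum_minus_partial_le p z N : absolutely_convergent_on_disk p -> Cmod z < 1 ->
  Cmod (psum p z - partial_psum p z N) <=
  2 * (Series (fun n => Cmod (p n) * Cmod z ^ n) - sum_n (fun n => Cmod (p n) * Cmod z ^ n) N).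
Proof.
intros Hp Hz. set (u := fun n => (p n * z ^ n)%C). set (A := fun n => Cmod (p n) * Cmod z ^ n).
assert (Hu : ex_series (fun n => Cmod (u n))) by (apply ex_series_psum; auto).
assert (Hsh : forall k, ex_series (fun n => Cmod (u (k + n)%nat))).
{ intros k. exact (proj1 (ex_series_incr_n (fun n => Cmod (u n)) k) Hu). }
assert (HA : forall n, A n = Cmod (u n)) by (intros; unfold A, u; rewrite Cmod_mult, Cmod_pow; reflexivity).
assert (E : forall N, psum p z = (partial_psum p z N + cseries (fun n => u (S N + n)%nat))%C).
{ induction N0 as [|n IH].
  - unfold psum. rewrite cseries_incr_1; auto.
  - rewrite IH, cseries_incr_1 by apply Hsh. simpl partial_psum. rewrite <- Cplus_assoc. f_equal. f_equal.
    + rewrite Nat.add_0_r. reflexivity.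
    + apply cseries_ext. intros k. f_equal. lia. }
rewrite (E N). replace (partial_psum p z N + cseries (fun n => u (S N + n)%nat) - partial_psum p z N)%C with (cseries (fun n => u (S N + n)%nat)) by ring.
eapply Rle_trans. apply Cmod_cseries_le. apply Hsh. right. f_equal.
assert (ER : forall N, Series A = sum_n A N + Series (fun n => Cmod (u (S N + n)%nat))).
{ induction N0 as [|n IH].
  - rewrite sum_O. rewrite Series_incr_1. f_equal. apply Series_ext; intros; apply HA.
    eapply ex_series_ext; [|exact Hu]. intros; symmetry; apply HA.
  - rewrite IH, sum_Sn. unfold plus; simpl. rewrite Rplus_assoc. f_equal.
    rewrite Series_incr_1 by exact (Hsh (S n)). rewrite Nat.add_0_r, HA. f_equal. apply Series_ext. intros k. do 2 f_equal. lia. }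
rewrite (ER N). lra.
Qed.

Lemma Cexp_0 : Cexp 0 = RtoC 1.
Proof. unfold Cexp, RtoC, Re, Im; simpl. rewrite exp_0, cos_0, sin_0. f_equal; ring. Qed.

Lemma Cexp_pow (z : C) n : (Cexp z ^ n)%C = Cexp (INR n * z).
Proof.
induction n as [|n IH].
- replace (INR 0 * z)%C with (RtoC 0) by (simpl; ring). rewrite Cexp_0. reflexivity.
- rewrite Cpow_S, IH, <- Cexp_plus. f_equal. rewrite S_INR, RtoC_plus. ring.
Qed.

Lemma Cconj_Cexp (z : C) : Cconj (Cexp z) = Cexp (Cconj z).
Proof. unfold Cconj, Cexp, Re, Im; simpl. rewrite cos_neg, sin_neg. f_equal; ring. Qed.

Lemma RInt_character (c : C) (S0 : R) (k : Z) : (k <> 0)%Z ->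
  RInt (fun t => Re (c * Cexp (S0, IZR k * t))) 0 (2 * PI) = 0.
Proof.
intros Hk. assert (Hk' : IZR k <> 0) by (apply not_0_IZR; auto).
set (F := fun t => exp S0 / IZR k * (Re c * sin (IZR k * t) + Im c * cos (IZR k * t))).
assert (A : is_RInt (fun t => Re (c * Cexp (S0, IZR k * t))) 0 (2 * PI) (minus (F (2 * PI)) (F 0))).
{ apply (is_RInt_derive (V := R_CompleteNormedModule)).
  - intros t _. unfold F. auto_derive; auto. unfold Re, Im, Cexp; simpl. field. auto.
  - intros t _. apply continuous_Re, continuous_Cmult. apply continuous_const. apply continuous_Cexp, continuous_pairC.
    apply continuous_const. apply continuous_Rmult. apply continuous_const. apply continuous_id. }
apply (is_RInt_unique (V := R_CompleteNormedModule)) in A. rewrite A.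
assert (HF : F (2 * PI) = F 0).
{ unfold F. rewrite Rmult_0_r, sin_0, cos_0.
  assert (Hs : sin (IZR k * (2 * PI)) = 0).
  { replace (IZR k * (2 * PI)) with (IZR (2 * k) * PI) by (rewrite mult_IZR; ring). apply sin_eq_0_1. eexists; reflexivity. }
  assert (Hc : cos (IZR k * (2 * PI)) = 1).
  { replace (IZR k * (2 * PI)) with (2 * (IZR k * PI)) by ring. rewrite cos_2a_sin.
    rewrite (sin_eq_0_1 (IZR k * PI)). ring. exists k. reflexivity. }
  rewrite Hs, Hc. reflexivity. }
rewrite HF. apply (minus_eq_zero (G := R_AbelianGroup)).
Qed.

Lemma continuous_circle s t : continuous (T := R_UniformSpace) (U := C_UniformSpace) (fun t => Cexp (s, t)) t.
Proof. apply continuous_Cexp, continuous_pairC. apply continuous_const. apply continuous_id. Qed.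

Lemma continuous_Cpow {U : UniformSpace} (f : U -> C) n x :
  continuous_C f x -> continuous_C (fun u => (f u ^ n)%C) x.
Proof.
intros H. induction n. apply continuous_const. simpl. apply continuous_Cmult; auto.
Qed.

Lemma continuous_Cconj {U : UniformSpace} (f : U -> C) x :
  continuous_C f x -> continuous_C (fun u => Cconj (f u)) x.
Proof.
intros H. apply continuous_pairC. apply continuous_Re; auto. apply continuous_Ropp, continuous_Im; auto.
Qed.

Lemma continuous_partial_psum {U : UniformSpace} p (f : U -> C) N x :
  continuous_C f x -> continuous_C (fun u => partial_psum p (f u) N) x.
Proof.
intros H. induction N.
- apply (continuous_Cmult (fun _ => p O) (fun u => (f u ^ 0)%C)). apply continuous_const. apply continuous_Cpow; auto.
- apply (continuous_Cplus (fun u => partial_psum p (f u) N) (fun u => (p (S N) * f u ^ S N)%C)); auto.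
  apply continuous_Cmult. apply continuous_const. apply continuous_Cpow; auto.
Qed.

Lemma RInt_Rplus (f g : R -> R) a b : (forall t, continuous f t) -> (forall t, continuous g t) ->
  RInt (fun t => f t + g t) a b = RInt f a b + RInt g a b.
Proof. intros Hf Hg. apply (RInt_plus (V := R_CompleteNormedModule)); apply ex_RInt_cont; auto. Qed.

Lemma RInt_monomials_orthogonal c s n m : n <> m ->
  RInt (fun t => Re (c * Cexp (s, t) ^ n * Cconj (Cexp (s, t) ^ m))) 0 (2 * PI) = 0.
Proof.
intros H. etransitivity; [|apply (RInt_character c ((INR n + INR m) * s) (Z.of_nat n - Z.of_nat m)); lia].
apply RInt_ext. intros t _. f_equal. rewrite !Cexp_pow, Cconj_Cexp, <- Cmult_assoc, <- Cexp_plus. do 2 f_equal.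
rewrite minus_IZR, <- !INR_IZR_INZ. unfold Cplus, Cmult, Cconj, RtoC; simpl. f_equal; ring.
Qed.

Lemma RInt_partial_psum_orthogonal c p s N m : (N < m)%nat ->
  RInt (fun t => Re (c * partial_psum p (Cexp (s, t)) N * Cconj (Cexp (s, t) ^ m))) 0 (2 * PI) = 0.
Proof.
assert (cm : forall c n, forall t, continuous (fun t => Re (c * Cexp (s, t) ^ n * Cconj (Cexp (s, t) ^ m))) t).
{ intros c' n t. apply continuous_Re, continuous_Cmult. apply continuous_Cmult. apply continuous_const.
  apply continuous_Cpow, continuous_circle. apply continuous_Cconj, continuous_Cpow, continuous_circle. }
intros Hm. induction N as [|N IH].
- etransitivity; [|apply (RInt_monomials_orthogonal (c * p O)%C s 0 m); lia].
  apply RInt_ext. intros t _. f_equal. simpl. ring.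
- transitivity (RInt (fun t => Re (c * partial_psum p (Cexp (s, t)) N * Cconj (Cexp (s, t) ^ m)) +
     Re (c * p (S N) * Cexp (s, t) ^ S N * Cconj (Cexp (s, t) ^ m))) 0 (2 * PI)).
  { apply RInt_ext. intros t _. rewrite !partial_psum_S.
    generalize (Cconj (Cexp (s, t) ^ m)) (Cexp (s, t) ^ S N)%C (partial_psum p (Cexp (s, t)) N).
    intros u v w. unfold Re; simpl.
    match goal with |- ?a = ?b => change (@eq R a b) end. ring. }
  assert (c1 : forall t, continuous (fun t => Re (c * partial_psum p (Cexp (s, t)) N * Cconj (Cexp (s, t) ^ m))) t).
  { intros t. apply continuous_Re, continuous_Cmult. apply continuous_Cmult. apply continuous_const.
    apply continuous_partial_psum, continuous_circle. apply continuous_Cconj, continuous_Cpow, continuous_circle. }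
  rewrite RInt_Rplus; auto. rewrite IH, RInt_monomials_orthogonal by lia. apply Rplus_0_l.
Qed.

(** Induction on the degree: the two cross products of a partial sum with the next monomial
    integrate to 0, and the last monomial against itself gives the new term. The second cross
    product is conjugated inside [Re], so that one orthogonality lemma covers both. *)
Lemma RInt_partial_psum_parseval p q s N :
  RInt (fun t => Re (partial_psum p (Cexp (s, t)) N * Cconj (partial_psum q (Cexp (s, t)) N))) 0 (2 * PI) =
  2 * PI * sum_n (fun n => Re (p n * Cconj (q n)) * exp s ^ (2 * n)) N.
Proof.
assert (Hd : forall n t, (Cexp (s, t) ^ n * Cconj (Cexp (s, t) ^ n))%C = RtoC (exp s ^ (2 * n))).
{ intros n t. rewrite <- Cmod2_conj. rewrite Cmod_pow, Cmod_Cexp. simpl Re. rewrite <- pow_mult. do 2 f_equal. lia. }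
assert (Hdiag : forall n, RInt (fun t => Re ((p n * Cexp (s, t) ^ n) * Cconj (q n * Cexp (s, t) ^ n))) 0 (2 * PI) =
   2 * PI * (Re (p n * Cconj (q n)) * exp s ^ (2 * n))).
{ intros n. rewrite (RInt_ext _ (fun _ => Re (p n * Cconj (q n)) * exp s ^ (2 * n))).
  rewrite RInt_const. unfold scal; simpl; unfold mult; simpl. rewrite Rminus_0_r. reflexivity.
  intros t _. rewrite Cmult_conj.
  replace (p n * Cexp (s, t) ^ n * (Cconj (q n) * Cconj (Cexp (s, t) ^ n)))%C with
    (p n * Cconj (q n) * (Cexp (s, t) ^ n * Cconj (Cexp (s, t) ^ n)))%C by ring.
  rewrite Hd. unfold Re, Im; simpl. rewrite Rmult_0_r. apply Rminus_0_r. }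
induction N as [|N IH].
- rewrite sum_O. apply (Hdiag O).
- rewrite sum_Sn. match goal with |- context [plus ?a ?b] => change (plus a b) with (a + b)%R end. rewrite Rmult_plus_distr_l.
  transitivity (RInt (fun t => Re (partial_psum p (Cexp (s, t)) N * Cconj (partial_psum q (Cexp (s, t)) N)) +
    (Re (Cconj (q (S N)) * partial_psum p (Cexp (s, t)) N * Cconj (Cexp (s, t) ^ S N)) +
    (Re (Cconj (p (S N)) * partial_psum q (Cexp (s, t)) N * Cconj (Cexp (s, t) ^ S N)) +
     Re ((p (S N) * Cexp (s, t) ^ S N) * Cconj (q (S N) * Cexp (s, t) ^ S N))))) 0 (2 * PI)).
  { apply RInt_ext. intros t _. rewrite !partial_psum_S.
    set (w := (Cexp (s, t) ^ S N)%C). generalize w; clear w. generalize (partial_psum p (Cexp (s, t)) N) (partial_psum q (Cexp (s, t)) N) (p (S N)) (q (S N)).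
    intros P Q pn qn z. unfold Re, Cconj; simpl.
    match goal with |- ?a = ?b => change (@eq R a b) end. ring. }
  assert (c1 : forall t, continuous (fun t => Re (partial_psum p (Cexp (s, t)) N * Cconj (partial_psum q (Cexp (s, t)) N))) t).
  { intros t. apply continuous_Re, continuous_Cmult. apply continuous_partial_psum, continuous_circle. apply continuous_Cconj, continuous_partial_psum, continuous_circle. }
  assert (c2 : forall c p t, continuous (fun t => Re (c * partial_psum p (Cexp (s, t)) N * Cconj (Cexp (s, t) ^ S N))) t).
  { intros c p' t. apply continuous_Re, continuous_Cmult. apply continuous_Cmult. apply continuous_const. apply continuous_partial_psum, continuous_circle. apply continuous_Cconj, continuous_Cpow, continuous_circle. }
  assert (c3 : forall t, continuous (fun t => Re ((p (S N) * Cexp (s, t) ^ S N) * Cconj (q (S N) * Cexp (s, t) ^ S N))) t).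
  { intros t. apply continuous_Re, continuous_Cmult. apply continuous_Cmult. apply continuous_const. apply continuous_Cpow, continuous_circle.
    apply continuous_Cconj, continuous_Cmult. apply continuous_const. apply continuous_Cpow, continuous_circle. }
  rewrite !RInt_Rplus; auto; repeat (intros; apply continuous_Rplus; auto).
  rewrite IH, !RInt_partial_psum_orthogonal, Hdiag by lia. simpl. ring.
Qed.

(** Passes from partial sums to the limit by uniform convergence on the circle. Two series are
    allowed because [euler b] has to be paired with [b]. *)
Lemma psum_parseval p q s : absolutely_convergent_on_disk p -> absolutely_convergent_on_disk q -> s < 0 ->
  (forall t, continuous (T := R_UniformSpace) (U := C_UniformSpace) (fun t => psum p (Cexp (s, t))) t) ->
  (forall t, continuous (T := R_UniformSpace) (U := C_UniformSpace) (fun t => psum q (Cexp (s, t))) t) ->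
  is_series (fun n => 2 * PI * (Re (p n * Cconj (q n)) * exp s ^ (2 * n)))
    (RInt (fun t => Re (psum p (Cexp (s, t)) * Cconj (psum q (Cexp (s, t))))) 0 (2 * PI)).
Proof.
intros Hp Hq Hs cp cq. assert (HPI := PI2_1).
assert (Hz : forall t, Cmod (Cexp (s, t)) = exp s) by (intros; apply Cmod_Cexp).
assert (Hr : 0 <= exp s < 1). { split. left; apply exp_pos. rewrite <- exp_0. apply exp_increasing; auto. }
set (A := fun n => Cmod (p n) * exp s ^ n). set (B := fun n => Cmod (q n) * exp s ^ n).
set (a := fun N => Series A - sum_n A N). set (b := fun N => Series B - sum_n B N).
assert (Ha : is_lim_seq a 0).
{ replace (Finite 0) with (Finite (Series A - Series A)) by (f_equal; ring).
  apply is_lim_seq_minus'. apply is_lim_seq_const. exact (Series_correct A (Hp _ Hr)). }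
assert (Hb : is_lim_seq b 0).
{ replace (Finite 0) with (Finite (Series B - Series B)) by (f_equal; ring).
  apply is_lim_seq_minus'. apply is_lim_seq_const. exact (Series_correct B (Hq _ Hr)). }
assert (Da : forall N t, Cmod (psum p (Cexp (s, t)) - partial_psum p (Cexp (s, t)) N) <= 2 * a N).
{ intros N t. assert (X := Cmod_psum_minus_partial_le p (Cexp (s, t)) N Hp). rewrite Hz in X. apply X, Hr. }
assert (Db : forall N t, Cmod (psum q (Cexp (s, t)) - partial_psum q (Cexp (s, t)) N) <= 2 * b N).
{ intros N t. assert (X := Cmod_psum_minus_partial_le q (Cexp (s, t)) N Hq). rewrite Hz in X. apply X, Hr. }
assert (Bp : forall t, Cmod (psum p (Cexp (s, t))) <= 2 * Series A).
{ intros t. eapply Rle_trans. apply Cmod_cseries_le. apply ex_series_psum; auto. rewrite Hz; apply Hr.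
  right. f_equal. apply Series_ext. intros n. rewrite Cmod_mult, Cmod_pow, Hz. reflexivity. }
assert (Bq : forall t, Cmod (psum q (Cexp (s, t))) <= 2 * Series B).
{ intros t. eapply Rle_trans. apply Cmod_cseries_le. apply ex_series_psum; auto. rewrite Hz; apply Hr.
  right. f_equal. apply Series_ext. intros n. rewrite Cmod_mult, Cmod_pow, Hz. reflexivity. }
set (I := RInt (fun t => Re (psum p (Cexp (s, t)) * Cconj (psum q (Cexp (s, t))))) 0 (2 * PI)).
set (IN := fun N => RInt (fun t => Re (partial_psum p (Cexp (s, t)) N * Cconj (partial_psum q (Cexp (s, t)) N))) 0 (2 * PI)).
set (err := fun N => 2 * PI * (2 * a N * (2 * Series B) + (2 * Series A + 2 * a N) * (2 * b N))).
assert (cI : forall t, continuous (fun t => Re (psum p (Cexp (s, t)) * Cconj (psum q (Cexp (s, t))))) t).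
{ intros t. apply continuous_Re, continuous_Cmult. apply cp. apply continuous_Cconj, cq. }
assert (cIN : forall N t, continuous (fun t => Re (partial_psum p (Cexp (s, t)) N * Cconj (partial_psum q (Cexp (s, t)) N))) t).
{ intros N t. apply continuous_Re, continuous_Cmult. apply continuous_partial_psum, continuous_circle. apply continuous_Cconj, continuous_partial_psum, continuous_circle. }
assert (Herr : forall N, Rabs (IN N - I) <= err N).
{ intros N.
  assert (E : IN N - I = RInt (fun t => Re (partial_psum p (Cexp (s, t)) N * Cconj (partial_psum q (Cexp (s, t)) N)) -
      Re (psum p (Cexp (s, t)) * Cconj (psum q (Cexp (s, t))))) 0 (2 * PI)).
  { symmetry. apply (RInt_minus (V := R_CompleteNormedModule)); apply ex_RInt_cont; auto. }
  rewrite E. unfold err. replace (2 * PI) with (2 * PI - 0) at 2 by ring. apply abs_RInt_le_const. lra.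
  apply ex_RInt_cont. intros t. apply continuous_Rminus; auto.
  intros t _. assert (D1 := Da N t). assert (D2 := Db N t). assert (D3 := Bp t). assert (D4 := Bq t).
  set (P := psum p (Cexp (s, t))) in *. set (Q := psum q (Cexp (s, t))) in *.
  set (PN := partial_psum p (Cexp (s, t)) N) in *. set (QN := partial_psum q (Cexp (s, t)) N) in *.
  assert (D5 : Cmod PN <= 2 * Series A + 2 * a N).
  { eapply Rle_trans. apply (Cmod_le_plus PN P). rewrite Cmod_minus_sym. lra. }
  assert (G := re_le_Cmod (PN * Cconj QN - P * Cconj Q)).
  replace (Re (PN * Cconj QN) - Re (P * Cconj Q)) with (Re (PN * Cconj QN - P * Cconj Q)) by (unfold Re; simpl; ring).
  eapply Rle_trans. exact G.
  replace (PN * Cconj QN - P * Cconj Q)%C with (- ((P - PN) * Cconj Q + PN * Cconj (Q - QN)))%C by (rewrite Cminus_conj; ring).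
  rewrite Cmod_opp. eapply Rle_trans. apply Cmod_triangle. rewrite !Cmod_mult, !Cmod_conj.
  apply Rplus_le_compat; apply Rmult_le_compat; auto; apply Cmod_ge_0. }
assert (Hlim : is_lim_seq err 0).
{ unfold err.
  replace (Finite 0) with (Finite (2 * PI * (2 * 0 * (2 * Series B) + (2 * Series A + 2 * 0) * (2 * 0)))) by (f_equal; ring).
  repeat first [apply is_lim_seq_const | exact Ha | exact Hb | apply is_lim_seq_mult' | apply is_lim_seq_plus']. }
match goal with |- is_series ?a _ => change (is_lim_seq (sum_n a) (Finite I)) end.
apply (is_lim_seq_ext IN).
{ intros N. unfold IN. rewrite RInt_partial_psum_parseval.
  symmetry. apply (sum_n_mult_l (K := R_AbsRing)). }
apply is_lim_seq_spec. intros [e He]. destruct (proj2 (is_lim_seq_spec err 0) Hlim (mkposreal e He)) as [N0 HN0].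
exists N0. intros N HN. specialize (HN0 N HN). simpl in *. rewrite Rminus_0_r in HN0.
eapply Rle_lt_trans. apply Herr. eapply Rle_lt_trans. apply Rle_abs. exact HN0.
Qed.

(** * Taylor coefficients and logarithmic coordinates *)

Lemma is_pseries_C_re_im (a : nat -> C) (z l : C) :
  @is_pseries C_AbsRing C_NormedModule a z l ->
  is_series (fun n => Re (a n * z ^ n)) (Re l) /\ is_series (fun n => Im (a n * z ^ n)) (Im l).
Proof.
intros H.
assert (Hp : forall n, pow_n (K := C_Ring) z n = (z ^ n)%C).
{ induction n as [|n IH]. reflexivity. simpl. rewrite IH. reflexivity. }
set (u := fun k => scal (V := C_NormedModule) (pow_n (K := C_AbsRing) z k) (a k)).
assert (Hu : forall n, u n = (a n * z ^ n)%C).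
{ intros n. unfold u. change (scal (V := C_NormedModule) (pow_n (K := C_AbsRing) z n) (a n)) with (pow_n (K := C_Ring) z n * a n)%C. rewrite Hp. apply Cmult_comm. }
assert (H0 : filterlim (sum_n u) eventually (locally (T := C_UniformSpace) l)) by exact H.
split.
- assert (A : filterlim (fun n => Re (sum_n u n)) eventually (locally (Re l))).
  { apply (filterlim_comp _ _ _ (sum_n u) (fun z : C => Re z) _ _ _ H0).
    exact (continuous_Re (fun z : C_UniformSpace => z) l (continuous_id l)). }
  apply (filterlim_ext (fun n => Re (sum_n u n))); [|exact A].
  induction x as [|n IH].
  + rewrite !sum_O, Hu. reflexivity.
  + rewrite !sum_Sn, <- IH. rewrite Hu. reflexivity.
- assert (A : filterlim (fun n => Im (sum_n u n)) eventually (locally (Im l))).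
  { apply (filterlim_comp _ _ _ (sum_n u) (fun z : C => Im z) _ _ _ H0).
    exact (continuous_Im (fun z : C_UniformSpace => z) l (continuous_id l)). }
  apply (filterlim_ext (fun n => Im (sum_n u n))); [|exact A].
  induction x as [|n IH].
  + rewrite !sum_O, Hu. reflexivity.
  + rewrite !sum_Sn, <- IH. rewrite Hu. reflexivity.
Qed.

(** Convergence at each real [r < 1] bounds the terms [a n * r ^ n], so the series of moduli has
    radius at least [r]; then [r] tends to 1. *)
Lemma taylor_coeffs_psum (h : C -> C) (a : nat -> C) : taylor_coeffs_on_disk h a ->
  absolutely_convergent_on_disk a /\ forall z, Cmod z < 1 -> psum a z = h z.
Proof.
intros H. split.
- apply absolutely_convergent_radius.
  assert (A : forall r, 0 <= r < 1 -> Rbar_le r (CV_radius (fun n => Cmod (a n)))).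
  { intros r Hr. apply CV_radius_ge.
    destruct (is_pseries_C_re_im a (RtoC r) (h (RtoC r))) as [H1 H2].
    { apply H. unfold in_disk. rewrite Cmod_R, Rabs_pos_eq; lra. }
    destruct (ex_series_bounded _ (ex_intro _ _ H1)) as [M1 HM1].
    destruct (ex_series_bounded _ (ex_intro _ _ H2)) as [M2 HM2].
    exists (M1 + M2). intros n. specialize (HM1 n). specialize (HM2 n).
    assert (E : Rabs (Cmod (a n) * r ^ n) = Cmod (a n * RtoC r ^ n)).
    { rewrite Cmod_mult, Cmod_pow, Cmod_R, (Rabs_pos_eq r) by lra. apply Rabs_pos_eq.
      apply Rmult_le_pos. apply Cmod_ge_0. apply pow_le; lra. }
    rewrite E. eapply Rle_trans. apply Cmod_le_abs. lra. }
  destruct (CV_radius (fun n => Cmod (a n))) as [r| |]; simpl; auto.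
  + apply Rnot_lt_le. intros Hr. assert (A0 := A 0). simpl in A0. assert (A1 := A ((r + 1) / 2)). simpl in A1. lra.
  + apply (A 0). lra.
- intros z Hz. destruct (is_pseries_C_re_im a z (h z)) as [H1 H2]. { apply H. exact Hz. }
  unfold psum, cseries. rewrite (is_series_unique _ _ H1), (is_series_unique _ _ H2).
  destruct (h z). reflexivity.
Qed.

Lemma psum_shift a z : absolutely_convergent_on_disk a -> Cmod z < 1 ->
  absolutely_convergent_on_disk (fun n => a (S n)) /\
  psum a z = (a O + z * psum (fun n => a (S n)) z)%C.
Proof.
intros Ha Hz.
assert (Hb : absolutely_convergent_on_disk (fun n => a (S n))).
{ intros r Hr. set (p := (1 + r) / 2). assert (Hp : r < p < 1) by (unfold p; lra).
  assert (A : ex_series (fun n => Cmod (a n) * p ^ n)) by (apply Ha; lra).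
  apply ex_series_incr_1 in A. apply (ex_series_Rscal (/ p)) in A.
  apply (ex_series_le (V := R_CompleteNormedModule) _ _ ) with (2 := A).
  intros n. unfold norm; simpl; unfold abs; simpl. rewrite Rabs_pos_eq.
  - apply Rle_trans with (Cmod (a (S n)) * p ^ n).
    apply Rmult_le_compat_l. apply Cmod_ge_0. apply pow_incr. lra.
    right. field. lra.
  - apply Rmult_le_pos. apply Cmod_ge_0. apply pow_le; lra. }
split; auto.
unfold psum at 1. rewrite cseries_incr_1 by (apply ex_series_psum; auto).
assert (E0 : (a O * z ^ 0)%C = a O) by (simpl; ring). rewrite E0. apply (f_equal (Cplus (a O))).
unfold psum. rewrite <- cseries_scal by (apply ex_series_psum; auto).
apply cseries_ext. intros n. simpl. ring.
Qed.

(** Control at the origin, which is not of the form [Cexp z]: in logarithmic coordinates it yields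
    the behaviour as [Re zeta -> -oo]. *)
Lemma psum_near_0 b : absolutely_convergent_on_disk b ->
  exists K, 0 < K /\ forall z, Cmod z <= 1 / 2 -> Cmod (psum b z - b O) <= K * Cmod z.
Proof.
intros Hb.
assert (Hb1 : absolutely_convergent_on_disk (fun n => b (S n))).
{ apply (psum_shift b 0 Hb). rewrite Cmod_0. lra. }
set (A := fun n => Cmod (b (S n)) * (1 / 2) ^ n).
assert (HA : ex_series A) by (apply Hb1; lra).
exists (2 * Series A + 1).
assert (HA0 : 0 <= Series A).
{ replace 0 with (0 * Series A) by ring. rewrite <- Series_scal_l. apply Series_le; auto.
  intros n. assert (0 <= A n). { apply Rmult_le_pos. apply Cmod_ge_0. apply pow_le; lra. } lra. }
split. lra. intros z Hz. destruct (psum_shift b z Hb) as [_ E]. lra.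
rewrite E. replace (b O + z * psum (fun n => b (S n)) z - b O)%C with (z * psum (fun n => b (S n)) z)%C by ring.
rewrite Cmod_mult, Rmult_comm. apply Rmult_le_compat_r. apply Cmod_ge_0.
eapply Rle_trans. apply Cmod_cseries_le. apply ex_series_psum; auto. lra.
assert (Series (fun n => Cmod (b (S n) * z ^ n)) <= Series A).
{ apply Series_le; auto. intros n. split. apply Cmod_ge_0. rewrite Cmod_mult, Cmod_pow.
  apply Rmult_le_compat_l. apply Cmod_ge_0. apply pow_incr. split; auto. apply Cmod_ge_0. }
lra.
Qed.

(** * Power series in the coordinate [zeta = log z] *)

Lemma Cmod_Cexp_lt_1 z : Re z < 0 -> Cmod (Cexp z) < 1.
Proof. intros H. rewrite Cmod_Cexp, <- exp_0. apply exp_increasing; auto. Qed.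

Lemma continuous_psum_Cexp b z : absolutely_convergent_on_disk b -> Re z < 0 ->
  continuous_CC (fun z => psum b (Cexp z)) z.
Proof.
intros Hb Hz. apply (continuous_comp (V := C_UniformSpace) (W := C_UniformSpace) Cexp (psum b)).
apply (continuous_Cexp (fun z : C_UniformSpace => z)). apply continuous_id.
eapply complex_derivative_continuous, complex_derivative_psum; auto. apply Cmod_Cexp_lt_1; auto. apply Cexp_neq_0.
Qed.

Lemma Cexp_line_derive (f : C -> C) (z v : C) (t : R) l :
  complex_derivative f (Cexp (z + RtoC t * v)) l ->
  is_derive (fun t : R => Re (f (Cexp (z + RtoC t * v)))) t (Re (l * (Cexp (z + RtoC t * v) * v))) /\
  is_derive (fun t : R => Im (f (Cexp (z + RtoC t * v)))) t (Im (l * (Cexp (z + RtoC t * v) * v))).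
Proof.
intros H.
replace (Cexp (z + RtoC t * v) * v)%C with
 (Re (Cexp (z + RtoC t * v) * v), Im (Cexp (z + RtoC t * v) * v)) by (destruct (Cexp (z + RtoC t * v) * v)%C; reflexivity).
apply (complex_chain f (fun t : R => Re (Cexp (z + RtoC t * v))) (fun t : R => Im (Cexp (z + RtoC t * v)))).
exact H.
all: assert (E : forall t : R, (z + RtoC t * v)%C = (Re z + t * Re v, Im z + t * Im v)) by
  (intros x; unfold Cplus, Cmult, RtoC, Re, Im; simpl; f_equal; ring).
- apply (is_derive_ext (fun t => exp (Re z + t * Re v) * cos (Im z + t * Im v))).
  { intros x. rewrite E. reflexivity. }
  rewrite E. auto_derive; auto. unfold Cexp, Cmult, Re, Im; simpl. ring.
- apply (is_derive_ext (fun t => exp (Re z + t * Re v) * sin (Im z + t * Im v))).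
  { intros x. rewrite E. reflexivity. }
  rewrite E. auto_derive; auto. unfold Cexp, Cmult, Re, Im; simpl. ring.
Qed.

(** For [z = Cexp zeta], [d / d zeta] is [z d / dz], hence [euler]. The direction is 1 here and [i]
    in the next lemma; together they are the Cauchy-Riemann equations. *)
Lemma psum_Cexp_derive_s b (s t : R) : absolutely_convergent_on_disk b -> s < 0 ->
  is_derive (fun s => Re (psum b (Cexp (s, t)))) s (Re (psum (euler b) (Cexp (s, t)))) /\
  is_derive (fun s => Im (psum b (Cexp (s, t)))) s (Im (psum (euler b) (Cexp (s, t)))).
Proof.
intros Hb Hs.
assert (H := Cexp_line_derive (psum b) (0, t) 1 s (psum (euler b) (Cexp (s, t)) / Cexp (s, t))).
assert (E : forall s : R, ((0, t) + RtoC s * 1)%C = (s, t)).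
{ intros x. unfold Cplus, Cmult, RtoC; simpl. f_equal; ring. }
rewrite E in H.
replace (psum (euler b) (Cexp (s, t)) / Cexp (s, t) * (Cexp (s, t) * 1))%C with (psum (euler b) (Cexp (s, t))) in H
 by (field; apply Cexp_neq_0).
destruct H as [H1 H2].
{ apply complex_derivative_psum; auto. apply Cmod_Cexp_lt_1; auto. apply Cexp_neq_0. }
split; [eapply is_derive_ext; [|exact H1] | eapply is_derive_ext; [|exact H2]]; intros x; cbv beta; rewrite E; reflexivity.
Qed.

Lemma psum_Cexp_derive_t b (s t : R) : absolutely_convergent_on_disk b -> s < 0 ->
  is_derive (fun t => Re (psum b (Cexp (s, t)))) t (- Im (psum (euler b) (Cexp (s, t)))) /\
  is_derive (fun t => Im (psum b (Cexp (s, t)))) t (Re (psum (euler b) (Cexp (s, t)))).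
Proof.
intros Hb Hs.
assert (H := Cexp_line_derive (psum b) (s, 0) Ci t (psum (euler b) (Cexp (s, t)) / Cexp (s, t))).
assert (E : forall t : R, ((s, 0%R) + RtoC t * Ci)%C = (s, t)).
{ intros x. unfold Cplus, Cmult, RtoC, Ci; simpl. f_equal; ring. }
rewrite E in H.
replace (psum (euler b) (Cexp (s, t)) / Cexp (s, t) * (Cexp (s, t) * Ci))%C with (psum (euler b) (Cexp (s, t)) * Ci)%C in H
 by (field; apply Cexp_neq_0).
destruct H as [H1 H2].
{ apply complex_derivative_psum; auto. apply Cmod_Cexp_lt_1; auto. apply Cexp_neq_0. }
replace (- Im (psum (euler b) (Cexp (s, t)))) with (Re (psum (euler b) (Cexp (s, t)) * Ci)) by (unfold Re, Im, Ci; simpl; ring).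
replace (Re (psum (euler b) (Cexp (s, t)))) with (Im (psum (euler b) (Cexp (s, t)) * Ci)) by (unfold Re, Im, Ci; simpl; ring).
split; [eapply is_derive_ext; [|exact H1] | eapply is_derive_ext; [|exact H2]]; intros x; cbv beta; rewrite E; reflexivity.
Qed.

(** Equal moduli give equal real parts. Then [cos (t' - t) = 1] forces the sine of the half
    difference to vanish, and that half difference is at most [PI / 2] in absolute value. *)
Lemma Cexp_injective (z w : C) : Rabs (snd w - snd z) <= PI -> Cexp z = Cexp w -> z = w.
Proof.
intros Hd H.
assert (H1 : Re z = Re w).
{ apply exp_inv. rewrite <- !Cmod_Cexp, H. reflexivity. }
destruct z as [s t], w as [s' t']. unfold Re in H1; simpl in *. subst s'.
unfold Cexp, Re, Im in H; simpl in H. injection H as Hc Hs.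
assert (He := exp_pos s). apply Rmult_eq_reg_l in Hc; [|lra]. apply Rmult_eq_reg_l in Hs; [|lra].
assert (Hcos : cos (t' - t) = 1).
{ rewrite cos_minus, Hc, Hs. generalize (sin2_cos2 t'). unfold Rsqr. lra. }
f_equal.
set (x := (t' - t) / 2). assert (Hx : t' - t = 2 * x) by (unfold x; field).
rewrite Hx, cos_2a_sin in Hcos. assert (Hsx : sin x = 0) by nra.
assert (Hb : - PI <= 2 * x <= PI). { rewrite <- Hx. apply Rabs_le_between; auto. }
assert (HPI := PI_RGT_0).
destruct (Rtotal_order x 0) as [Hn|[Hn|Hn]].
- assert (0 < sin (- x)) by (apply sin_gt_0; lra). rewrite sin_neg in H. lra.
- lra.
- assert (0 < sin x) by (apply sin_gt_0; lra). lra.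
Qed.

(** * Logarithmic derivatives *)

Lemma is_derive_inner_quotient (b1 b2 g1 g2 : R -> R) (t l b1' b2' g1' g2' : R) :
  is_derive b1 t b1' -> is_derive b2 t b2' -> is_derive g1 t g1' -> is_derive g2 t g2' ->
  l <> 0 -> b1 t ^ 2 + b2 t ^ 2 <> 0 ->
  is_derive (fun t => (g1 t * b1 t + g2 t * b2 t) / (l * (b1 t ^ 2 + b2 t ^ 2))) t
   (((g1' * b1 t + g1 t * b1' + g2' * b2 t + g2 t * b2') * (b1 t ^ 2 + b2 t ^ 2) -
     (g1 t * b1 t + g2 t * b2 t) * (2 * (b1 t * b1' + b2 t * b2'))) / (l * (b1 t ^ 2 + b2 t ^ 2) ^ 2)).
Proof.
intros H1 H2 H3 H4 Hl Hn. auto_derive.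
- repeat split; try (eexists; eassumption).
  replace (l * (b1 t * (b1 t * 1) + b2 t * (b2 t * 1))) with (l * (b1 t ^ 2 + b2 t ^ 2)) by ring.
  apply Rmult_integral_contrapositive; auto.
- rewrite (is_derive_unique (fun x : R => b1 x) _ _ H1), (is_derive_unique (fun x : R => b2 x) _ _ H2), (is_derive_unique (fun x : R => g1 x) _ _ H3), (is_derive_unique (fun x : R => g2 x) _ _ H4).
  field. auto.
Qed.

Lemma is_derive_ln_norm2 (b1 b2 : R -> R) (t l b1' b2' : R) :
  is_derive b1 t b1' -> is_derive b2 t b2' -> l <> 0 -> 0 < b1 t ^ 2 + b2 t ^ 2 ->
  is_derive (fun t => ln (b1 t ^ 2 + b2 t ^ 2) / (2 * l)) t ((b1' * b1 t + b2' * b2 t) / (l * (b1 t ^ 2 + b2 t ^ 2))).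
Proof.
intros H1 H2 Hl Hn. auto_derive.
- repeat split; try (eexists; eassumption).
  replace (b1 t * (b1 t * 1) + b2 t * (b2 t * 1)) with (b1 t ^ 2 + b2 t ^ 2) by ring. auto.
- rewrite (is_derive_unique (fun x : R => b1 x) _ _ H1), (is_derive_unique (fun x : R => b2 x) _ _ H2). field. split; lra.
Qed.

Lemma is_derive_norm2 (p1 p2 : R -> R) (t p1' p2' : R) :
  is_derive p1 t p1' -> is_derive p2 t p2' ->
  is_derive (fun t => p1 t ^ 2 + p2 t ^ 2) t (2 * (p1 t * p1' + p2 t * p2')).
Proof.
intros H1 H2. auto_derive. repeat split; eexists; eassumption.
rewrite (is_derive_unique (fun x : R => p1 x) _ _ H1), (is_derive_unique (fun x : R => p2 x) _ _ H2). ring.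
Qed.

Lemma is_derive_exp_double (x : R -> R) (t x' : R) :
  is_derive x t x' -> is_derive (fun t => exp (2 * x t)) t (2 * x' * exp (2 * x t)).
Proof.
intros H. auto_derive. repeat split; eexists; eassumption.
rewrite (is_derive_unique (fun y : R => x y) _ _ H). ring.
Qed.

Definition left_half_plane_continuous {V : UniformSpace} (h : C -> V) : Prop :=
  forall z, Re z < 0 -> continuous_on_C h z.

(* [cauchy_riemann h h'] says that [h' = dh/dzeta] in the coordinate [zeta = s + i t]. *)
Definition cauchy_riemann (h h' : C -> C) : Prop :=
  forall s t : R, s < 0 ->
    (is_derive (fun s => Re (h (s, t))) s (Re (h' (s, t))) /\
     is_derive (fun s => Im (h (s, t))) s (Im (h' (s, t)))) /\
    (is_derive (fun t => Re (h (s, t))) t (- Im (h' (s, t))) /\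
     is_derive (fun t => Im (h (s, t))) t (Re (h' (s, t)))).

Definition norm2 (h : C -> C) (z : C) : R := Re (h z) ^ 2 + Im (h z) ^ 2.

(* [1 - h' / (l h)] in real coordinates. *)
Definition log_quotient (l : R) (h h' : C -> C) (z : C) : C :=
  (1 - (Re (h' z) * Re (h z) + Im (h' z) * Im (h z)) / (l * norm2 h z),
   (Re (h' z) * Im (h z) + - Im (h' z) * Re (h z)) / (l * norm2 h z)).

(** The real part of the complex derivative of [log_quotient]. By Cauchy-Riemann it is both the
    [s]-derivative of its real part and the [t]-derivative of its imaginary part. *)
Definition log_quotient_derivative (l : R) (h h' h'' : C -> C) (z : C) : R :=
  - (((Re (h'' z) * Re (h z) + Re (h' z) * Re (h' z) + Im (h'' z) * Im (h z) + Im (h' z) * Im (h' z)) * norm2 h z -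
     (Re (h' z) * Re (h z) + Im (h' z) * Im (h z)) * (2 * (Re (h z) * Re (h' z) + Im (h z) * Im (h' z)))) / (l * norm2 h z ^ 2)).

Ltac continuous_real :=
  repeat match goal with
    | |- continuous (fun u => @?f u * @?g u) _ => apply (continuous_Rmult f g)
    | |- continuous (fun u => @?f u + @?g u) _ => apply (continuous_Rplus f g)
    | |- continuous (fun u => @?f u - @?g u) _ => apply (continuous_Rminus f g)
    | |- continuous (fun u => - @?f u) _ => apply (continuous_Ropp f)
    | |- continuous (fun u => @?f u ^ ?n) _ => apply (continuous_pow f n)
    end; try apply continuous_const; try assumption.

Lemma continuous_log_quotient l h h' : 0 < l ->
  left_half_plane_continuous (V := C_UniformSpace) h -> left_half_plane_continuous (V := C_UniformSpace) h' ->
  (forall z, Re z < 0 -> 0 < norm2 h z) ->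
  left_half_plane_continuous (V := C_UniformSpace) (log_quotient l h h').
Proof.
intros Hl c c' Hn z Hz.
assert (H1 := continuous_Re _ _ (c z Hz)). assert (H2 := continuous_Im _ _ (c z Hz)).
assert (H3 := continuous_Re _ _ (c' z Hz)). assert (H4 := continuous_Im _ _ (c' z Hz)).
assert (Hnz : l * norm2 h z <> 0) by (apply Rgt_not_eq, Rmult_lt_0_compat; auto).
apply continuous_pairC.
- apply continuous_Rminus. apply continuous_const. apply continuous_Rdiv; auto; unfold norm2; continuous_real.
- apply continuous_Rdiv; auto; unfold norm2; continuous_real.
Qed.

Lemma continuous_log_quotient_derivative l h h' h'' : 0 < l ->
  left_half_plane_continuous (V := C_UniformSpace) h -> left_half_plane_continuous (V := C_UniformSpace) h' ->
  left_half_plane_continuous (V := C_UniformSpace) h'' ->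
  (forall z, Re z < 0 -> 0 < norm2 h z) ->
  left_half_plane_continuous (log_quotient_derivative l h h' h'').
Proof.
intros Hl c c' c'' Hn z Hz.
assert (H1 := continuous_Re _ _ (c z Hz)). assert (H2 := continuous_Im _ _ (c z Hz)).
assert (H3 := continuous_Re _ _ (c' z Hz)). assert (H4 := continuous_Im _ _ (c' z Hz)).
assert (H5 := continuous_Re _ _ (c'' z Hz)). assert (H6 := continuous_Im _ _ (c'' z Hz)).
assert (Hnz : l * norm2 h z ^ 2 <> 0) by (apply Rgt_not_eq, Rmult_lt_0_compat; auto; apply pow_lt; auto).
apply continuous_Ropp, continuous_Rdiv; auto; unfold norm2; continuous_real.
Qed.

Lemma is_derive_log_quotient_s l h h' h'' (s t : R) : 0 < l ->
  cauchy_riemann h h' -> cauchy_riemann h' h'' -> (forall z, Re z < 0 -> 0 < norm2 h z) -> s < 0 ->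
  is_derive (fun s => Re (log_quotient l h h' (s, t))) s (log_quotient_derivative l h h' h'' (s, t)).
Proof.
intros Hl H H' Hn Hs. destruct (H s t Hs) as [[D1 D2] _]. destruct (H' s t Hs) as [[D3 D4] _].
replace (log_quotient_derivative l h h' h'' (s, t)) with (0 + log_quotient_derivative l h h' h'' (s, t)) by ring.
apply (is_derive_minus (V := R_NormedModule) (fun _ => 1)). apply (is_derive_const (V := R_NormedModule) 1 s).
apply (is_derive_inner_quotient (fun s => Re (h (s, t))) (fun s => Im (h (s, t))) (fun s => Re (h' (s, t))) (fun s => Im (h' (s, t)))); auto.
lra. apply Rgt_not_eq, (Hn (s, t)); auto.
Qed.

Lemma is_derive_log_quotient_t l h h' h'' (s t : R) : 0 < l ->
  cauchy_riemann h h' -> cauchy_riemann h' h'' -> (forall z, Re z < 0 -> 0 < norm2 h z) -> s < 0 ->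
  is_derive (fun t => Im (log_quotient l h h' (s, t))) t (log_quotient_derivative l h h' h'' (s, t)).
Proof.
intros Hl H H' Hn Hs. destruct (H s t Hs) as [_ [D1 D2]]. destruct (H' s t Hs) as [_ [D3 D4]].
assert (Hnz := Hn (s, t) Hs). unfold norm2 in Hnz.
(* The imaginary part of [log_quotient] is again an inner product over a squared norm, now of
   [(Im h, Re h)] with [(Re h', - Im h')], so the same quotient rule applies. *)
assert (A := is_derive_inner_quotient (fun t => Im (h (s, t))) (fun t => Re (h (s, t))) (fun t => Re (h' (s, t))) (fun t => - Im (h' (s, t))) t l
   _ _ _ _ D2 D1 D3 (is_derive_opp (V := R_NormedModule) _ _ _ D4)).
replace (log_quotient_derivative l h h' h'' (s, t)) with
 (((- Im (h'' (s, t)) * Im (h (s, t)) + Re (h' (s, t)) * Re (h' (s, t)) + - Re (h'' (s, t)) * Re (h (s, t)) + - Im (h' (s, t)) * - Im (h' (s, t))) * (Im (h (s, t)) ^ 2 + Re (h (s, t)) ^ 2) -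
   (Re (h' (s, t)) * Im (h (s, t)) + - Im (h' (s, t)) * Re (h (s, t))) * (2 * (Im (h (s, t)) * Re (h' (s, t)) + Re (h (s, t)) * - Im (h' (s, t))))) / (l * (Im (h (s, t)) ^ 2 + Re (h (s, t)) ^ 2) ^ 2)).
- apply (is_derive_ext (fun t => (Re (h' (s, t)) * Im (h (s, t)) + - Im (h' (s, t)) * Re (h (s, t))) / (l * (Im (h (s, t)) ^ 2 + Re (h (s, t)) ^ 2)))).
  { intros y. unfold log_quotient, norm2. rewrite (Rplus_comm (Re (h (s, y)) ^ 2)). reflexivity. }
  apply A. lra. apply Rgt_not_eq. rewrite Rplus_comm. exact Hnz.
- unfold log_quotient_derivative, norm2. revert Hnz.
  generalize (Re (h (s, t))) (Im (h (s, t))) (Re (h' (s, t))) (Im (h' (s, t))) (Re (h'' (s, t))) (Im (h'' (s, t))).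
  intros b1 b2 g1 g2 d1 d2 Hnz. field. split; lra.
Qed.

(** For [h = exp (- l G)] the differentiated function is [s + Re G]; with [G = log (f z / z)] this
    is the real part of [log f]. *)
Lemma is_derive_log_modulus_s l h h' (s t : R) : 0 < l ->
  cauchy_riemann h h' -> (forall z, Re z < 0 -> 0 < norm2 h z) -> s < 0 ->
  is_derive (fun s => s - ln (norm2 h (s, t)) / (2 * l)) s (Re (log_quotient l h h' (s, t))).
Proof.
intros Hl H Hn Hs. destruct (H s t Hs) as [[D1 D2] _].
apply (is_derive_minus (V := R_NormedModule) (fun s => s)). apply (is_derive_id (K := R_AbsRing)).
apply (is_derive_ln_norm2 (fun s => Re (h (s, t))) (fun s => Im (h (s, t)))); auto. lra. apply (Hn (s, t)); auto.
Qed.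

Lemma is_derive_log_modulus_t l h h' (s t : R) : 0 < l ->
  cauchy_riemann h h' -> (forall z, Re z < 0 -> 0 < norm2 h z) -> s < 0 ->
  is_derive (fun t => s - ln (norm2 h (s, t)) / (2 * l)) t (- Im (log_quotient l h h' (s, t))).
Proof.
intros Hl H Hn Hs. destruct (H s t Hs) as [_ [D1 D2]].
replace (- Im (log_quotient l h h' (s, t))) with (0 - (- Im (h' (s, t)) * Re (h (s, t)) + Re (h' (s, t)) * Im (h (s, t))) / (l * norm2 h (s, t))).
2:{ change (Im (log_quotient l h h' (s, t))) with ((Re (h' (s, t)) * Im (h (s, t)) + - Im (h' (s, t)) * Re (h (s, t))) / (l * norm2 h (s, t))). unfold Rdiv. ring. }
apply (is_derive_minus (V := R_NormedModule) (fun _ => s)). apply (is_derive_const (V := R_NormedModule) s t).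
apply (is_derive_ln_norm2 (fun t => Re (h (s, t))) (fun t => Im (h (s, t)))); auto. lra. apply (Hn (s, t)); auto.
Qed.

(* The modulus determines a holomorphic function up to a constant factor: the partial
derivatives of [ln |f (Cexp zeta)|] give the logarithmic derivative. *)
Lemma derivative_of_log_modulus (f Lm E : C -> C) (s t : R) l :
  (forall z, Re z < 0 -> f (Cexp z) = Cexp (Lm z)) -> s < 0 ->
  is_derive (fun s => Re (Lm (s, t))) s (Re (E (s, t))) ->
  is_derive (fun t => Re (Lm (s, t))) t (- Im (E (s, t))) ->
  complex_derivative f (Cexp (s, t)) l ->
  (l * Cexp (s, t) = f (Cexp (s, t)) * E (s, t))%C.
Proof.
intros HPL Hz dXs dXt Hl.
set (Phi := fun z => f (Cexp z)). set (m := (l * Cexp (s, t))%C).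
change (m = (Phi (s, t) * E (s, t))%C).
assert (HP0 : Phi (s, t) <> RtoC 0) by (unfold Phi; rewrite HPL by auto; apply Cexp_neq_0).
assert (Es : forall s0 : R, ((0, t) + RtoC s0 * 1)%C = (s0, t)) by (intros x; unfold Cplus, Cmult, RtoC; simpl; f_equal; ring).
assert (Et : forall t0 : R, ((s, 0%R) + RtoC t0 * Ci)%C = (s, t0)) by (intros x; unfold Cplus, Cmult, RtoC, Ci; simpl; f_equal; ring).
assert (Hs := Cexp_line_derive f (0, t) 1 s l). assert (Ht := Cexp_line_derive f (s, 0) Ci t l).
rewrite Es in Hs. rewrite Et in Ht. specialize (Hs Hl). specialize (Ht Hl).
rewrite Cmult_1_r in Hs. rewrite Cmult_assoc in Ht. fold m in Hs, Ht.
(* Differentiating [|Phi|^2 = exp (2 Re Lm)] in [s] and in [t] gives the real and imaginary parts of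
   [conj Phi * m = |Phi|^2 E], from which the nonzero factor [conj Phi] is cancelled at the end. *)
assert (Hmod : forall s t, s < 0 -> Re (Phi (s, t)) ^ 2 + Im (Phi (s, t)) ^ 2 = exp (2 * Re (Lm (s, t)))).
{ intros s' t' Hs'. rewrite <- Cmod2_alt. unfold Phi. rewrite HPL, Cmod_Cexp by auto. simpl. rewrite Rmult_1_r, <- exp_plus. f_equal. ring. }
set (N := exp (2 * Re (Lm (s, t)))).
assert (HN : 0 < N) by apply exp_pos.
assert (Q1 : Re (Phi (s, t)) * Re m + Im (Phi (s, t)) * Im m = Re (E (s, t)) * N).
{ destruct Hs as [H1 H2].
  apply (is_derive_ext _ (fun s => Re (Phi (s, t)))) in H1. 2:{ intros x. rewrite Es. reflexivity. }
  apply (is_derive_ext _ (fun s => Im (Phi (s, t)))) in H2. 2:{ intros x. rewrite Es. reflexivity. }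
  assert (A1 := is_derive_norm2 _ _ _ _ _ H1 H2).
  assert (A2 := is_derive_exp_double _ _ _ dXs).
  apply (is_derive_ext_loc _ (fun s => Re (Phi (s, t)) ^ 2 + Im (Phi (s, t)) ^ 2)) in A2.
  2:{ destruct (locally_neg s Hz) as [d Hd]. exists d. intros y Hy. symmetry. apply Hmod. apply (Hd y Hy). }
  apply is_derive_unique in A1. apply is_derive_unique in A2. rewrite A1 in A2. cbv beta in A2. change (exp (2 * Re (Lm (s, t)))) with N in A2. apply (Rmult_eq_reg_l 2); [|lra]. rewrite <- Rmult_assoc. exact A2. }
assert (Q2 : Re (Phi (s, t)) * Im m - Im (Phi (s, t)) * Re m = Im (E (s, t)) * N).
{ destruct Ht as [H1 H2].
  apply (is_derive_ext _ (fun t => Re (Phi (s, t)))) in H1. 2:{ intros x. rewrite Et. reflexivity. }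
  apply (is_derive_ext _ (fun t => Im (Phi (s, t)))) in H2. 2:{ intros x. rewrite Et. reflexivity. }
  assert (A1 := is_derive_norm2 _ _ _ _ _ H1 H2).
  assert (A2 := is_derive_exp_double _ _ _ dXt).
  apply (is_derive_ext _ (fun t => Re (Phi (s, t)) ^ 2 + Im (Phi (s, t)) ^ 2)) in A2.
  2:{ intros y. symmetry. apply Hmod. auto. }
  apply is_derive_unique in A1. apply is_derive_unique in A2. rewrite A1 in A2. cbv beta in A2. change (exp (2 * Re (Lm (s, t)))) with N in A2.
  replace (Re (m * Ci)) with (- Im m) in A2 by (unfold Re, Im, Ci; simpl; ring).
  replace (Im (m * Ci)) with (Re m) in A2 by (unfold Re, Im, Ci; simpl; ring).
  assert (A3 : 2 * (Re (Phi (s, t)) * - Im m + Im (Phi (s, t)) * Re m) = 2 * - Im (E (s, t)) * N) by exact A2. lra. }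
assert (HNN : Re (Phi (s, t)) ^ 2 + Im (Phi (s, t)) ^ 2 = N) by (apply Hmod; auto).
assert (HC : (Cconj (Phi (s, t)) * m)%C = (Cconj (Phi (s, t)) * (Phi (s, t) * E (s, t)))%C).
{ assert (X1 : (Cconj (Phi (s, t)) * Phi (s, t))%C = RtoC N).
  { rewrite Cmult_comm, <- Cmod2_conj. f_equal. rewrite Cmod2_alt. exact HNN. }
  rewrite Cmult_assoc, X1.
  revert Q1 Q2. generalize (Phi (s, t)) m (E (s, t)). intros [p1 p2] [m1 m2] [e1 e2]. unfold Re, Im, Cmult, Cconj, RtoC; simpl.
  intros Q1 Q2. f_equal; lra. }
assert (HPc : Cconj (Phi (s, t)) <> RtoC 0).
{ apply Cmod_gt_0. rewrite Cmod_conj. apply Cmod_gt_0. auto. }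
replace m with (/ Cconj (Phi (s, t)) * (Cconj (Phi (s, t)) * m))%C by (field; auto).
rewrite HC. field. auto.
Qed.

(** * Prawitz's inequality *)

(** [be] is [(f z / z) ^ (- lambda)] in logarithmic coordinates, [ga] and [de] its first two
    derivatives. They supply a [log f] with enough smoothness for the flux argument, whose
    conclusion is then rewritten in terms of [be] and [ga]. *)
Lemma prawitz_integral (f g be ga de : C -> C) (lambda s2 : R) :
  analytic_on_disk f -> univalent_on_disk f -> 0 < lambda -> is_Log_f_over_z f g ->
  left_half_plane_continuous (V := C_UniformSpace) be -> left_half_plane_continuous (V := C_UniformSpace) ga ->
  left_half_plane_continuous (V := C_UniformSpace) de ->
  cauchy_riemann be ga -> cauchy_riemann ga de ->
  (forall s t, be (s, t + 2 * PI) = be (s, t)) -> (forall s t, ga (s, t + 2 * PI) = ga (s, t)) ->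
  (forall z, Re z < 0 -> be z = Cexp (RtoC (- lambda) * g (Cexp z))) ->
  (forall e, 0 < e -> exists s0, s0 < 0 /\
     forall s t, s <= s0 -> 1 / 2 <= Cmod (be (s, t)) /\ Cmod (ga (s, t)) <= e) ->
  s2 < 0 ->
  0 <= RInt (fun t => Re (be (s2, t) * Cconj (be (s2, t))) - Re (ga (s2, t) * Cconj (be (s2, t))) / lambda) 0 (2 * PI).
Proof.
intros Hf Hu Hl [gc [g0 Hg]] cbe cga cde CR1 CR2 pbe pga Hbg Hsmall Hs2.
set (Lm := fun z => (z + g (Cexp z))%C).
set (Phi := fun z => f (Cexp z)).
set (E := log_quotient lambda be ga). set (D := log_quotient_derivative lambda be ga de).
assert (Hbe : forall z, Re z < 0 -> Cmod (be z) = exp (- lambda * Re (g (Cexp z)))).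
{ intros z Hz. rewrite Hbg, Cmod_Cexp by auto. f_equal. unfold Re; simpl. ring. }
assert (Hn : forall z, norm2 be z = Cmod (be z) ^ 2) by (intros; unfold norm2; rewrite Cmod2_alt; reflexivity).
assert (Hn2 : forall z, Re z < 0 -> norm2 be z = exp (- (2 * lambda * Re (g (Cexp z))))).
{ intros z Hz. rewrite Hn, Hbe by auto. simpl. rewrite Rmult_1_r, <- exp_plus. f_equal. ring. }
assert (Hn0 : forall z, Re z < 0 -> 0 < norm2 be z) by (intros z Hz; rewrite Hn2 by auto; apply exp_pos).
(* [g] is only known to be continuous; expressed through the modulus of [be], the real part of [Lm]
   becomes differentiable. *)
assert (HX : forall z, Re z < 0 -> Re (Lm z) = Re z - ln (norm2 be z) / (2 * lambda)).
{ intros z Hz. rewrite Hn2, ln_exp by auto. unfold Lm, Re; simpl. field. lra. }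
assert (cE := continuous_log_quotient lambda be ga Hl cbe cga Hn0).
assert (cD := continuous_log_quotient_derivative lambda be ga de Hl cbe cga cde Hn0).
assert (dXs : forall s t, s < 0 -> is_derive (fun s => Re (Lm (s, t))) s (Re (E (s, t)))).
{ intros s t Hs. apply (is_derive_ext_loc (fun s => s - ln (norm2 be (s, t)) / (2 * lambda))).
  - destruct (locally_neg s Hs) as [d Hd]. exists d. intros y Hy. symmetry. apply HX. apply (Hd y Hy).
  - apply is_derive_log_modulus_s; auto. }
assert (dXt : forall s t, s < 0 -> is_derive (fun t => Re (Lm (s, t))) t (- Im (E (s, t)))).
{ intros s t Hs. apply (is_derive_ext (fun t => s - ln (norm2 be (s, t)) / (2 * lambda))).
  - intros y. symmetry. apply HX. auto.
  - apply is_derive_log_modulus_t; auto. }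
assert (dE1 := fun s t => is_derive_log_quotient_s lambda be ga de s t Hl CR1 CR2 Hn0).
assert (dE2 := fun s t => is_derive_log_quotient_t lambda be ga de s t Hl CR1 CR2 Hn0).
assert (HPL : forall z, Re z < 0 -> Phi z = Cexp (Lm z)).
{ intros z Hz. unfold Phi, Lm. rewrite Cexp_plus, Hg. field. apply Cexp_neq_0. apply Cmod_Cexp_lt_1; auto. apply Cexp_neq_0. }
(* The derivative of [f], known so far only to exist, is identified with an expression that is
   continuous. *)
assert (Hder : forall z, Re z < 0 -> complex_derivative f (Cexp z) (Phi z * E z / Cexp z)).
{ intros [s t] Hz. destruct (Hf (Cexp (s, t)) (Cmod_Cexp_lt_1 _ Hz)) as [l Hl']. change C in l.
  apply complex_derivative_is_derive in Hl'.
  replace (Phi (s, t) * E (s, t) / Cexp (s, t))%C with l; auto.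
  unfold Phi. rewrite <- (derivative_of_log_modulus f Lm E s t l HPL Hz (dXs s t Hz) (dXt s t Hz) Hl').
  field. apply Cexp_neq_0. }
assert (HD : half_plane_derivative Phi (fun z => Phi z * E z)%C).
{ intros z v t Hz. assert (A := Cexp_line_derive f z v t _ (Hder _ Hz)).
  replace (Phi (z + RtoC t * v) * E (z + RtoC t * v) * v)%C with
   (Phi (z + RtoC t * v) * E (z + RtoC t * v) / Cexp (z + RtoC t * v) * (Cexp (z + RtoC t * v) * v))%C.
  exact A. field. apply Cexp_neq_0. }
assert (cexp : forall z : C, continuous_CC Cexp z).
{ intros z. apply (continuous_Cexp (fun z : C_UniformSpace => z)). apply continuous_id. }
assert (cP : forall z, Re z < 0 -> continuous_CC Phi z).
{ intros z Hz. apply (continuous_comp (V := C_UniformSpace) (W := C_UniformSpace) Cexp f); auto.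
  eapply complex_derivative_continuous. apply Hder. auto. }
assert (cX : forall z, Re z < 0 -> continuous_on_C (fun z => Re (Lm z)) z).
{ intros z Hz. apply continuous_Re. apply (continuous_Cplus (fun z : C_UniformSpace => z)). apply continuous_id.
  apply (continuous_comp (V := C_UniformSpace) (W := C_UniformSpace) Cexp g); auto.
  apply gc. apply Cmod_Cexp_lt_1; auto. }
assert (pP : forall s t, Phi (s, t + 2 * PI) = Phi (s, t)) by (intros; unfold Phi; rewrite Cexp_periodic; auto).
assert (pE : forall s t, E (s, t + 2 * PI) = E (s, t)) by (intros; unfold E, log_quotient, norm2; rewrite pbe, pga; auto).
assert (pX : forall s t, Re (Lm (s, t + 2 * PI)) = Re (Lm (s, t))) by (intros; unfold Lm, Re; simpl; rewrite Cexp_periodic; auto).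
assert (Hinj : forall z w, Re z < 0 -> Re w < 0 -> Rabs (snd w - snd z) <= PI -> Phi z = Phi w -> z = w).
{ intros z w Hz Hw Hd H. apply Cexp_injective; auto. apply Hu; auto; apply Cmod_Cexp_lt_1; auto. }
(* [E - 1] is [- ga / (lambda be)], where [|be| >= 1 / 2] and [ga] is small far to the left. *)
assert (HE1 : forall e, 0 < e -> exists s0, forall s t, s <= s0 -> Rabs (Re (E (s, t)) - 1) <= e).
{ intros e He. destruct (Hsmall (e * lambda / 2)) as [s0 [Hs0 H]]. { apply Rdiv_lt_0_compat; [apply Rmult_lt_0_compat; lra|lra]. }
  exists s0. intros s t Hs. destruct (H s t Hs) as [H1 H2].
  assert (Hz : Re (s, t) < 0) by (unfold Re; simpl; lra).
  set (q := (Re (ga (s, t)) * Re (be (s, t)) + Im (ga (s, t)) * Im (be (s, t)))).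
  assert (Hln : 0 < lambda * norm2 be (s, t)) by (apply Rmult_lt_0_compat; auto).
  change (Rabs (1 - q / (lambda * norm2 be (s, t)) - 1) <= e).
  replace (1 - q / (lambda * norm2 be (s, t)) - 1) with (- (q / (lambda * norm2 be (s, t)))) by ring.
  rewrite Rabs_Ropp. unfold Rdiv. rewrite Rabs_mult, Rabs_inv, (Rabs_pos_eq (lambda * _)) by lra.
  assert (Hq : Rabs q <= Cmod (ga (s, t)) * Cmod (be (s, t))).
  { replace q with (Re (ga (s, t) * Cconj (be (s, t)))) by (unfold q, Re, Im; simpl; ring).
    eapply Rle_trans. apply re_le_Cmod. rewrite Cmod_mult, Cmod_conj. lra. }
  apply Rmult_le_reg_r with (lambda * norm2 be (s, t)). auto.
  rewrite Rmult_assoc, Rinv_l, Rmult_1_r by lra.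
  eapply Rle_trans. exact Hq. rewrite Hn.
  replace (e * (lambda * Cmod (be (s, t)) ^ 2)) with ((e * lambda * Cmod (be (s, t))) * Cmod (be (s, t))) by ring.
  apply Rmult_le_compat_r. apply Cmod_ge_0. eapply Rle_trans. exact H2.
  assert (0 < e * lambda) by (apply Rmult_lt_0_compat; auto). nra. }
assert (HXm : forall T, exists s0, forall s t, s <= s0 -> Re (Lm (s, t)) <= T).
{ intros T. destruct (Hsmall 1 Rlt_0_1) as [s0 [Hs0 H]].
  exists (Rmin s0 (T + ln (1 / 4) / (2 * lambda))). intros s t Hs.
  assert (Hs1 : s <= s0) by (eapply Rle_trans; [exact Hs|apply Rmin_l]).
  assert (Hs3 : s <= T + ln (1 / 4) / (2 * lambda)) by (eapply Rle_trans; [exact Hs|apply Rmin_r]).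
  destruct (H s t Hs1) as [H1 _].
  rewrite HX by (unfold Re; simpl; lra). change (Re (s, t)) with s.
  assert (Hln : ln (1 / 4) <= ln (norm2 be (s, t))).
  { apply ln_le. lra. rewrite Hn. nra. }
  assert (ln (1 / 4) / (2 * lambda) <= ln (norm2 be (s, t)) / (2 * lambda)).
  { apply Rmult_le_compat_r; auto. left. apply Rinv_0_lt_compat. lra. }
  lra. }
assert (A := flux_nonneg Phi E Lm D lambda s2 Hl Hs2 HD cP cE cX cD HPL pP pE pX Hinj dXs dXt dE1 dE2 HE1 HXm).
assert (cfin : forall t, continuous (fun t => Re (be (s2, t) * Cconj (be (s2, t))) - Re (ga (s2, t) * Cconj (be (s2, t))) / lambda) t).
{ intros t. apply (continuous_slice (fun z => Re (be z * Cconj (be z)) - Re (ga z * Cconj (be z)) / lambda)); auto.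
  intros z Hz. apply continuous_Rminus. apply continuous_Re, continuous_Cmult; auto. apply continuous_Cconj; auto.
  apply continuous_Rmult. apply continuous_Re, continuous_Cmult; auto. apply continuous_Cconj; auto. apply continuous_const. }
(* On the line [Re zeta = s2], [|f|^(- 2 lambda) = exp (- 2 lambda s2) |be|^2], and the positive
   constant factor does not affect the sign. *)
assert (EQ : RInt (fun t => exp (- (2 * lambda * Re (Lm (s2, t)))) * Re (E (s2, t))) 0 (2 * PI) =
  exp (- (2 * lambda * s2)) * RInt (fun t => Re (be (s2, t) * Cconj (be (s2, t))) - Re (ga (s2, t) * Cconj (be (s2, t))) / lambda) 0 (2 * PI)).
{ rewrite <- RInt_Rmult by exact cfin. apply RInt_ext. intros t _.
  assert (Hz : Re (s2, t) < 0) by exact Hs2.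
  assert (E1 : exp (- (2 * lambda * Re (Lm (s2, t)))) = exp (- (2 * lambda * s2)) * norm2 be (s2, t)).
  { rewrite Hn2 by auto. rewrite <- exp_plus. f_equal. unfold Lm, Re; simpl. ring. }
  rewrite E1. rewrite Rmult_assoc. apply Rmult_eq_compat_l.
  assert (Hnz := Hn0 _ Hz).
  change (Re (E (s2, t))) with (1 - (Re (ga (s2, t)) * Re (be (s2, t)) + Im (ga (s2, t)) * Im (be (s2, t))) / (lambda * norm2 be (s2, t))).
  replace (Re (be (s2, t) * Cconj (be (s2, t)))) with (norm2 be (s2, t)) by (unfold norm2, Re, Im; simpl; ring).
  replace (Re (ga (s2, t) * Cconj (be (s2, t)))) with (Re (ga (s2, t)) * Re (be (s2, t)) + Im (ga (s2, t)) * Im (be (s2, t))) by (unfold Re, Im; simpl; ring).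
  field. split; lra. }
rewrite EQ in A. assert (He := exp_pos (- (2 * lambda * s2))).
apply Rmult_le_reg_l with (1 := He). rewrite Rmult_0_r. exact A.
Qed.

(** Parseval for the pairs [(b, b)] and [(euler b, b)] yields the sums of [|b_n|^2] and [n |b_n|^2],
    weighted by [r^(2n)] with [r = exp s]. *)
Lemma prawitz_partial_inequality (f g : C -> C) (b : nat -> C) (lambda s : R) :
  analytic_on_disk f -> univalent_on_disk f -> 0 < lambda -> is_Log_f_over_z f g ->
  absolutely_convergent_on_disk b -> b O = RtoC 1 ->
  (forall z, Cmod z < 1 -> z <> RtoC 0 -> psum b z = Cexp (RtoC (- lambda) * g z)) ->
  s < 0 ->
  exists l, l <= 0 /\ is_series (fun n => (INR n - lambda) * Cmod (b n) ^ 2 * exp s ^ (2 * n)) l.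
Proof.
intros Hf Hu Hl HLog Hb Hb0 Hbg Hs.
assert (HPI := PI2_1).
assert (Hb1 := absolutely_convergent_euler b Hb). assert (Hb2 := absolutely_convergent_euler _ Hb1).
destruct (psum_near_0 b Hb) as [K0 [HK0 Hn1]]. destruct (psum_near_0 (euler b) Hb1) as [K1 [HK1 Hn3]].
assert (Hsmall : forall e, 0 < e -> exists s0, s0 < 0 /\ forall s t, s <= s0 ->
  1 / 2 <= Cmod (psum b (Cexp (s, t))) /\ Cmod (psum (euler b) (Cexp (s, t))) <= e).
(* [K0 * r <= 1 / 2] keeps [psum b] within [1 / 2] of [b O = 1], and [K1 * r <= e] bounds
   [psum (euler b)], whose constant term is 0. *)
{ intros e He. set (r := Rmin (1 / 2) (Rmin (/ (2 * K0)) (e / K1))).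
  assert (Hr : 0 < r). { repeat apply Rmin_pos; try lra. apply Rinv_0_lt_compat; lra. apply Rdiv_lt_0_compat; lra. }
  assert (Hr1 : r <= 1 / 2) by apply Rmin_l.
  assert (Hr2 : r <= / (2 * K0)) by (eapply Rle_trans; [apply Rmin_r|apply Rmin_l]).
  assert (Hr3 : r <= e / K1) by (eapply Rle_trans; [apply Rmin_r|apply Rmin_r]).
  exists (ln r). split. { rewrite <- ln_1. apply ln_increasing; lra. }
  intros s' t Hs'.
  assert (Hz : Cmod (Cexp (s', t)) <= r).
  { rewrite Cmod_Cexp. change (Re (s', t)) with s'. rewrite <- (exp_ln r) by auto.
    destruct Hs' as [Hs'|Hs']. left; apply exp_increasing; auto. right; rewrite Hs'; auto. }
  assert (H1 := Hn1 (Cexp (s', t)) (Rle_trans _ _ _ Hz Hr1)). assert (H2 := Hn3 (Cexp (s', t)) (Rle_trans _ _ _ Hz Hr1)).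
  rewrite Hb0 in H1.
  set (B := psum b (Cexp (s', t))) in *. set (G := psum (euler b) (Cexp (s', t))) in *.
  assert (E0 : (G - euler b 0)%C = G) by (unfold euler; simpl; ring). rewrite E0 in H2.
  split.
  - assert (A := Cmod_le_plus 1 B). rewrite Cmod_1, Cmod_minus_sym in A.
    assert (K0 * Cmod (Cexp (s', t)) <= 1 / 2).
    { apply Rle_trans with (K0 * / (2 * K0)). apply Rmult_le_compat_l; lra. right; field; lra. } lra.
  - eapply Rle_trans. exact H2. apply Rle_trans with (K1 * (e / K1)). apply Rmult_le_compat_l; lra. right; field; lra. }
assert (I := prawitz_integral f g (fun z => psum b (Cexp z)) (fun z => psum (euler b) (Cexp z)) (fun z => psum (euler (euler b)) (Cexp z)) lambda s
  Hf Hu Hl HLog (fun z Hz => continuous_psum_Cexp b z Hb Hz) (fun z Hz => continuous_psum_Cexp _ z Hb1 Hz) (fun z Hz => continuous_psum_Cexp _ z Hb2 Hz)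
  (fun s t H => conj (psum_Cexp_derive_s b s t Hb H) (psum_Cexp_derive_t b s t Hb H))
  (fun s t H => conj (psum_Cexp_derive_s _ s t Hb1 H) (psum_Cexp_derive_t _ s t Hb1 H))
  (fun s t => f_equal (psum b) (Cexp_periodic s t)) (fun s t => f_equal (psum (euler b)) (Cexp_periodic s t))
  (fun z Hz => Hbg _ (Cmod_Cexp_lt_1 z Hz) (Cexp_neq_0 z)) Hsmall Hs).
assert (cb : forall p, absolutely_convergent_on_disk p -> forall t, continuous (T := R_UniformSpace) (U := C_UniformSpace) (fun t => psum p (Cexp (s, t))) t).
{ intros p Hp t. apply (continuous_comp (V := C_UniformSpace) (W := C_UniformSpace) (fun t => (s, t)) (fun z => psum p (Cexp z))).
  apply continuous_pairC. apply continuous_const. apply continuous_id. apply continuous_psum_Cexp. exact Hp. exact Hs. }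
assert (S1 := psum_parseval b b s Hb Hb Hs (cb b Hb) (cb b Hb)).
assert (S2 := psum_parseval (euler b) b s Hb1 Hb Hs (cb _ Hb1) (cb b Hb)).
set (F1 := fun t => Re (psum b (Cexp (s, t)) * Cconj (psum b (Cexp (s, t))))) in *.
set (F2 := fun t => Re (psum (euler b) (Cexp (s, t)) * Cconj (psum b (Cexp (s, t))))) in *.
assert (c1 : forall t, continuous F1 t).
{ intros t. apply continuous_Re, continuous_Cmult. apply (cb b Hb). apply continuous_Cconj, (cb b Hb). }
assert (c2 : forall t, continuous F2 t).
{ intros t. apply continuous_Re, continuous_Cmult. apply (cb _ Hb1). apply continuous_Cconj, (cb b Hb). }
assert (EI : RInt F1 0 (2 * PI) + - / lambda * RInt F2 0 (2 * PI) >= 0).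
{ rewrite <- RInt_Rmult by exact c2. rewrite <- RInt_Rplus. 2: exact c1. 2: intros t; apply continuous_Rmult; [apply continuous_const|apply c2].
  apply Rle_ge. eapply Rle_trans. exact I. right. apply RInt_ext. intros t _.
  change (F1 t - F2 t / lambda = F1 t + - / lambda * F2 t). unfold Rdiv. ring. }
set (I1 := RInt F1 0 (2 * PI)) in *. set (I2 := RInt F2 0 (2 * PI)) in *.
exists (/ (2 * PI) * (I2 - lambda * I1)). split.
- assert (0 < / (2 * PI)) by (apply Rinv_0_lt_compat; lra).
  assert (lambda * (I1 + - / lambda * I2) >= 0) by nra.
  replace (lambda * (I1 + - / lambda * I2)) with (lambda * I1 - I2) in H0 by (field; lra). nra.
- assert (S3 := is_series_scal (V := R_NormedModule) (/ (2 * PI)) _ _ (is_series_minus (V := R_NormedModule) _ _ _ _ S2 (is_series_scal (V := R_NormedModule) lambda _ _ S1))).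
  eapply is_series_ext; [|exact S3].
  intros n.
  assert (E1 : Re (b n * Cconj (b n)) = Cmod (b n) ^ 2) by (rewrite Cmod2_alt; unfold Re, Im; simpl; ring).
  assert (E2 : Re (euler b n * Cconj (b n)) = INR n * Cmod (b n) ^ 2) by (rewrite Cmod2_alt; unfold euler, Re, Im; simpl; ring).
  change (/ (2 * PI) * (2 * PI * (Re (euler b n * Cconj (b n)) * exp s ^ (2 * n)) +
    - (lambda * (2 * PI * (Re (b n * Cconj (b n)) * exp s ^ (2 * n))))) =
    (INR n - lambda) * Cmod (b n) ^ 2 * exp s ^ (2 * n)).
  rewrite E1, E2. field. lra.
Qed.

(** Past [N0] all terms are nonnegative, so a partial sum is at most the whole Abel mean; being a
    finite sum, it is continuous at [s = 0], which removes the factors. The exponent [2 * S n]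
    reflects that the term of index 0 has been split off. *)
Lemma series_bound_of_abel_means (c : nat -> R) (M : R) (N0 : nat) :
  (forall n, (N0 <= n)%nat -> 0 <= c n) ->
  (forall s, s < 0 -> exists l, l <= M /\ is_series (fun n => c n * exp s ^ (2 * S n)) l) ->
  ex_series c /\ Series c <= M.
Proof.
intros Hpos HM.
assert (Hpart : forall N s, (N0 <= N)%nat -> s < 0 -> sum_n (fun n => c n * exp s ^ (2 * S n)) N <= M).
{ intros N s HN Hs. destruct (HM s Hs) as [l [Hl Hser]]. eapply Rle_trans; [|exact Hl].
  apply (is_lim_seq_incr_compare (fun n => sum_n (fun n => c n * exp s ^ (2 * S n)) (n + N)) l) with (n := O).
  - apply (is_lim_seq_incr_n (sum_n (fun n => c n * exp s ^ (2 * S n))) N). exact Hser.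
  - intros n. change (S n + N)%nat with (S (n + N)). rewrite sum_Sn.
    match goal with |- ?x <= plus ?x ?y => change (x <= x + y) end.
    assert (0 <= c (S (n + N)) * exp s ^ (2 * S (S (n + N)))).
    { apply Rmult_le_pos. apply Hpos. lia. apply pow_le. left; apply exp_pos. }
    lra. }
assert (Hc : forall N s, continuous (fun s => sum_n (fun n => c n * exp s ^ (2 * S n)) N) s).
{ intros N s. induction N as [|N IH].
  - apply (continuous_ext (fun s => c O * exp s ^ (2 * 1))). intros x. rewrite sum_O. reflexivity.
    apply continuous_Rmult. apply continuous_const. apply (continuous_pow exp). apply continuous_exp.
  - apply (continuous_ext (fun s => sum_n (fun n => c n * exp s ^ (2 * S n)) N + c (S N) * exp s ^ (2 * S (S N)))).
    intros x. rewrite sum_Sn. reflexivity.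
    apply continuous_Rplus; auto. apply continuous_Rmult. apply continuous_const. apply (continuous_pow exp). apply continuous_exp. }
assert (Hbound : forall N, (N0 <= N)%nat -> sum_n c N <= M).
{ intros N HN. apply Rnot_lt_le. intros Hlt.
  (* If a partial sum exceeded [M], it would still do so at the negative [s = - (d / 2)]. *)
  destruct (proj1 (continuous_real_iff _ _) (Hc N 0) (sum_n c N - M)) as [d [Hd H]]. lra.
  assert (Hb : ball (M := R_UniformSpace) 0 d (- (d / 2))).
  { change (Rabs (- (d / 2) - 0) < d). rewrite Rminus_0_r, Rabs_Ropp, Rabs_pos_eq; lra. }
  specialize (H _ Hb). assert (A := Hpart N (- (d / 2)) HN). cbv beta in H.
  rewrite (sum_n_ext (fun n => c n * exp 0 ^ (2 * S n)) c) in H.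
  2:{ intros n. rewrite exp_0, pow1. apply Rmult_1_r. }
  apply Rabs_lt_between in H. lra. }
assert (Hinc : forall n, sum_n c (n + N0) <= sum_n c (S n + N0)).
{ intros n. change (S n + N0)%nat with (S (n + N0)). rewrite sum_Sn. change (sum_n c (n + N0) <= sum_n c (n + N0) + c (S (n + N0))).
  assert (0 <= c (S (n + N0))) by (apply Hpos; lia). lra. }
destruct (ex_finite_lim_seq_incr (fun n => sum_n c (n + N0)) M Hinc) as [l Hl].
{ intros n. apply Hbound. lia. }
assert (Hser : is_series c l) by (apply (is_lim_seq_incr_n (sum_n c) N0) in Hl; exact Hl).
split. exists l; exact Hser.
rewrite (is_series_unique _ _ Hser).
apply (is_lim_seq_le (fun n => sum_n c (n + N0)) (fun _ => M) l M); auto.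
intros n. apply Hbound. lia. apply is_lim_seq_const.
Qed.

(** Dividing by [z] shifts the coefficients but gives the identity only for [z <> 0]. The value of
    [a 1] is found by letting a positive real [x] tend to 0, where [g] is continuous with value
    0. *)
Lemma Kc_taylor_shift (g : C -> C) (c : C) (a : nat -> C) :
  (forall z, in_disk z -> continuous_CC g z) -> g (RtoC 0) = RtoC 0 ->
  taylor_coeffs_on_disk (Kc c g) a ->
  absolutely_convergent_on_disk (fun n => a (S n)) /\ a 1%nat = RtoC 1 /\
  forall z, Cmod z < 1 -> z <> RtoC 0 -> psum (fun n => a (S n)) z = Cexp (c * g z).
Proof.
intros gc g0 Ha. destruct (taylor_coeffs_psum _ _ Ha) as [Hac Hps].
assert (H01 : Cmod 0 < 1) by (rewrite Cmod_0; lra).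
destruct (psum_shift a 0 Hac H01) as [Hb E0].
assert (Ha0 : a O = RtoC 0).
{ assert (A := Hps (RtoC 0) H01). unfold Kc in A. rewrite E0 in A. rewrite !Cmult_0_l, Cplus_0_r in A. exact A. }
set (b := fun n => a (S n)) in *.
assert (Hbg : forall z, Cmod z < 1 -> z <> RtoC 0 -> psum b z = Cexp (c * g z)).
{ intros z Hz Hz0. assert (A := Hps z Hz). rewrite (proj2 (psum_shift a z Hac Hz)), Ha0, Cplus_0_l in A. unfold Kc in A. fold b in A.
  replace (psum b z) with (/ z * (z * psum b z))%C by (field; auto). rewrite A. field. auto. }
split; auto. split; auto.
change (a 1%nat) with (b O).
apply NNPP. intros Hne.
assert (Hd : 0 < Cmod (b O - 1)).
{ apply Cmod_gt_0. intros H. apply Hne. replace (b O) with (b O - 1 + 1)%C by ring. rewrite H. ring. }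
set (e := Cmod (b O - 1)) in *.
destruct (psum_near_0 b Hb) as [K [HK Hn]].
assert (cc : continuous_CC (fun z => Cexp (c * g z)) (RtoC 0)).
{ apply continuous_Cexp, continuous_Cmult. apply continuous_const. apply gc. exact H01. }
destruct (continuous_C_eps _ _ cc (e / 2)) as [d [Hd' Hcont]]. lra.
(* At [x] the series is within [e / 4] of [b O] and the exponential within [e / 2] of 1, although
   [b O] and 1 are at distance [e]. *)
set (x := Rmin (1 / 2) (Rmin (d / 2) (e / (4 * K)))).
assert (Hx : 0 < x). { repeat apply Rmin_pos; try lra. apply Rdiv_lt_0_compat; lra. }
assert (Hx1 : x <= 1 / 2) by apply Rmin_l.
assert (Hx2 : x <= d / 2) by (eapply Rle_trans; [apply Rmin_r|apply Rmin_l]).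
assert (Hx3 : x <= e / (4 * K)) by (eapply Rle_trans; [apply Rmin_r|apply Rmin_r]).
assert (Hmx : Cmod (RtoC x) = x) by (rewrite Cmod_R, Rabs_pos_eq; lra).
assert (A1 := Hn (RtoC x)). rewrite Hmx in A1. specialize (A1 Hx1).
assert (A2 : Cmod (Cexp (c * g (RtoC x)) - Cexp (c * g (RtoC 0))) < e / 2).
{ apply Hcont. apply ball_of_Cmod. replace (RtoC x - RtoC 0)%C with (RtoC x) by ring. rewrite Hmx. lra. }
rewrite g0, Cmult_0_r, Cexp_0 in A2.
rewrite (Hbg (RtoC x)) in A1; [|rewrite Hmx; lra|].
2:{ apply Cmod_gt_0. rewrite Hmx. exact Hx. }
set (w := Cexp (c * g (RtoC x))) in *.
assert (A3 : K * x <= e / 4).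
{ apply Rle_trans with (K * (e / (4 * K))). apply Rmult_le_compat_l; lra. right. field. lra. }
assert (A4 := Cmod_triangle (w - 1) (- (w - b O))). rewrite Cmod_opp in A4.
replace (w - 1 + - (w - b O))%C with (b O - 1)%C in A4 by ring. fold e in A4. lra.
Qed.

Theorem theorem4p3 :
  forall (f : C -> C) (lambda : R) (g : C -> C) (a : nat -> C),
    analytic_on_disk f ->
    univalent_on_disk f ->
    f (RtoC 0) = (RtoC 0) ->
    @is_derive C_AbsRing C_NormedModule f (RtoC 0) (RtoC 1) ->
    0 < lambda ->
    is_Log_f_over_z f g ->
    taylor_coeffs_on_disk (Kc (RtoC (- lambda)) g) a ->
    ex_series (fun n : nat => (INR (n + 2) - 1 - lambda) * (Cmod (a (n + 2)%nat)) ^ 2) /\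
    Series (fun n : nat => (INR (n + 2) - 1 - lambda) * (Cmod (a (n + 2)%nat)) ^ 2) <= lambda.
Proof.
intros f lambda g a Hf Hu _ _ Hl HLog Ha.
destruct (Kc_taylor_shift g (RtoC (- lambda)) a (proj1 HLog) (proj1 (proj2 HLog)) Ha) as [Hb [Hb0 Hbg]].
(* The coefficient [(n + 2) - 1 - lambda = n + 1 - lambda] is nonnegative from the index [S N0] on,
   [N0] being the integer part of [lambda]. *)
destruct (nfloor_ex lambda) as [N0 HN0]. lra.
apply (series_bound_of_abel_means _ lambda (S N0)).
- intros n Hn. apply Rmult_le_pos; [|apply pow2_ge_0].
  apply le_INR in Hn. rewrite S_INR in Hn. rewrite plus_INR. simpl (INR 2). lra.
- intros s Hs.
  destruct (prawitz_partial_inequality f g (fun n => a (S n)) lambda s Hf Hu Hl HLog Hb Hb0 Hbg Hs) as [l [Hl0 Hser]].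
  (* The term of index 0 is [- lambda * |a_1|^2 = - lambda]; splitting it off adds [lambda] to the
     sum. *)
  exists (l + lambda). split. lra.
  assert (A := is_series_incr_1 (V := R_NormedModule) (fun n => (INR n - lambda) * Cmod (a (S n)) ^ 2 * exp s ^ (2 * n)) (l + lambda)).
  assert (B : is_series (fun n => (INR (S n) - lambda) * Cmod (a (S (S n))) ^ 2 * exp s ^ (2 * S n)) (l + lambda)).
  { assert (E : l = l + lambda + (INR 0 - lambda) * Cmod (a 1%nat) ^ 2 * exp s ^ (2 * 0)).
    { rewrite Hb0, Cmod_1. simpl. ring. }
    rewrite E in Hser. exact (A Hser). }
  apply (is_series_ext _ _ _) with (2 := B). intros n.
  rewrite plus_INR, S_INR. replace (n + 2)%nat with (S (S n)) by lia. simpl (INR 2).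
  replace (INR n + (1 + 1) - 1) with (INR n + 1) by ring. reflexivity.
Qed.
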